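(* Assume the true model: $\beta_{01},\dots,\beta_{0n}$ are i.i.d. with density $g_0$, and $\boldsymbol Y\mid\boldsymbol\beta_0\sim\mathcal N(X\boldsymbol\beta_0,\sigma^2 I_m)$, where $m\ge n$, $X\in\mathbb R^{m\times n}$ is a fixed design matrix of full column rank, and $\sigma^2>0$ is known ($X$ and $\sigma^2$ may depend on $(m,n)$). Assume that $g_0$ is a fixed density supported on a known compact interval $[a,b]$ and that there are constants $\alpha\in(0,1]$, $L_0<\infty$, $0<m_0\le M_0<\infty$ with $m_0\le g_0(x)\le M_0$ and $|g_0(x)-g_0(y)|\le L_0|x-y|^\alpha$ for all $x,y\in[a,b]$. Let $c_{\mathrm{Cast}}>0$ and $c_{\mathrm{noise}}>0$ be sufficiently small constants (the required smallness depending only on $a,b,\alpha,L_0,m_0,M_0$), and set $$L_{\mathrm{Cast}}:=\Big\lfloor\log_2\Big(c_{\mathrm{Cast}}\Big(\frac{n}{\log n}\Big)^{\frac1{2\alpha+1}}\Big)\Big\rfloor,\qquad L_{\mathrm{noise}}:=\max\Big\{\ell\in\mathbb N:\ \frac{2^{3\ell/2}}{\ell^{3/2}}\le c_{\mathrm{noise}}\frac{\lambda_{\min}(X^\top X)}{\sigma^2 n^{3/2}}\Big\},\qquad L:=\min\{L_{\mathrm{Cast}},L_{\mathrm{noise}}\}.$$ Suppose that $X$ is such that $L\to\infty$ as $m,n\to\infty$. Then, with $$\varepsilon_n(L):=(b-a)^\alpha 2^{-\alpha L}+(b-a)^{-1}\sqrt{\frac{L2^L}{n}},$$ one has $\varepsilon_n(L)\to0$,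 and there exists a constant $C_0>0$ (not depending on $m,n$) such that $$\mathbb E_{g_0}\Big[\Pi_L\big(\|g-g_0\|_\infty>C_0\,\varepsilon_n(L)\,\big|\,\boldsymbol Y\big)\Big]\longrightarrow0\qquad\text{as } m,n\to\infty,$$ where $\Pi_L(\cdot\mid\boldsymbol Y)$ is the posterior of $g$ under the level-$L$ truncated P\'olya tree working model.
   Context: Limits ''as $m,n\to\infty$'' are along any sequence of pairs $(m,n)$ with $m\ge n$ and $m,n\to\infty$. $\mathbb E_{g_0}$ is expectation under the true joint law $\mathbb P_{g_0}$ of $(\boldsymbol\beta_0,\boldsymbol Y)$; $\lambda_{\min}$ denotes the smallest eigenvalue; $\|\cdot\|_\infty$ is the sup-norm on $[a,b]$; $\mathbb N=\{1,2,\dots\}$. (Since $L\to\infty$ is assumed, $L_{\mathrm{noise}}$ and $L$ are well defined and positive for all large $(m,n)$.) Dyadic partition: for $l\ge0$, $[a,b]$ is partitioned into $I^l_k=[a+(b-a)k2^{-l},\,a+(b-a)(k+1)2^{-l})$ for $0\le k\le 2^l-2$ and $I^l_{2^l-1}=[b-(b-a)2^{-l},\,b]$. Truncated P\'olya tree prior $\Pi_L$ of depth $L$: let $V_{l,k}\sim\mathrm{Beta}(1,1)$ be independent for $0\le l\le L-1$, $0\le k<2^l$. Set $G(I^0_0)=1$, and recursively $G(I^{l+1}_{2k})=V_{l,k}G(I^l_k)$, $G(I^{l+1}_{2k+1})=(1-V_{l,k})G(I^l_k)$. $\Pi_L$ is the law of the random piecewise-constant density $g(x)=\sum_{k=0}^{2^L-1}\frac{2^L}{b-a}G(I^L_k)\mathbf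 1\{x\in I^L_k\}$, $x\in[a,b]$. Working model: $g\sim\Pi_L$; $\beta_1,\dots,\beta_n\mid g$ i.i.d. with density $g$; $\boldsymbol Y\mid\boldsymbol\beta\sim\mathcal N(X\boldsymbol\beta,\sigma^2I_m)$. $\Pi_L(\cdot\mid\boldsymbol y)$ denotes the posterior (conditional) distribution of $g$ given $\boldsymbol Y=\boldsymbol y$ under the working model (given by Bayes' formula), and $\Pi_L(\cdot\mid\boldsymbol Y)$ is obtained by plugging in the data $\boldsymbol Y$, which is generated from the true law $\mathbb P_{g_0}$. *)

(* Defs.v *)
From HB Require Import structures.
From mathcomp Require Import all_boot all_order all_algebra.
From mathcomp Require Import all_classical all_reals all_analysis.

Set Implicit Arguments.
Unset Strict Implicit.
Unset Printing Implicit Defensive.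

Import Order.TTheory GRing.Theory Num.Theory.
Import numFieldNormedType.Exports.

Local Open Scope classical_set_scope.
Local Open Scope ring_scope.

(* [tuple_measure mu n] is the [n]-fold product of [mu]; see [tuple_measure_box]. *)

Section tuple_measure.
Context d (T : measurableType d) (R : realType).

Definition cons_pair n (p : T * n.-tuple T) : n.+1.-tuple T :=
  [tuple of p.1 :: p.2].

Lemma measurable_cons_pair n : measurable_fun [set: T * n.-tuple T] (@cons_pair n).
Proof. exact: measurable_cons. Qed.

Section step.
Variables (mu : {sigma_finite_measure set T -> \bar R}) (n : nat).
Variable nu : {sigma_finite_measure set (n.-tuple T) -> \bar R}.

Definition tuple_measure_step : set (n.+1.-tuple T) -> \bar R :=
  pushforward (mu \x nu)%E (@cons_pair n).

Let step0 : tuple_measure_step set0 = 0%E.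
Proof. by rewrite /tuple_measure_step /pushforward preimage_set0 measure0. Qed.

Let step_ge0 A : (0 <= tuple_measure_step A)%E.
Proof. exact: (measure_ge0 (mu \x nu)%E). Qed.

Let step_sigma_additive : semi_sigma_additive tuple_measure_step.
Proof.
exact: (@measure_semi_sigma_additive _ _ _
  (measure_function_pushforward__canonical__measure_function_Measure
    (mu \x nu)%E (@measurable_cons_pair n))).
Qed.

HB.instance Definition _ := isMeasure.Build _ _ _ tuple_measure_step
  step0 step_ge0 step_sigma_additive.

Let step_sigma_finite : sigma_finite setT tuple_measure_step.
Proof.
have /sigma_finiteP[F [FT ndF Foo]] := sigma_finiteT mu.
have /sigma_finiteP[G [GT ndG Goo]] := sigma_finiteT nu.
pose h (t : n.+1.-tuple T) : T * n.-tuple T := (thead t, [tuple of behead t]).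
have mh : measurable_fun setT h.
  apply: measurable_fun_pair; last exact: measurable_behead.
  exact: measurable_tnth.
exists (fun k => h @^-1` (F k `*` G k)).
  rewrite -preimage_bigcup (_ : \bigcup_k _ = setT) ?preimage_setT//.
  apply/seteqP; split=> // -[x y] _.
  have : [set: T] x by []. have : [set: n.-tuple T] y by [].
  rewrite GT FT => -[k _ Gky] [l _ Flx]; exists (maxn k l) => //; split => /=.
    by move: x Flx; exact/subsetPset/ndF/leq_maxr.
  by move: y Gky; exact/subsetPset/ndG/leq_maxl.
move=> k; have [mF Fk] := Foo k; have [mG Gk] := Goo k; split.
  by rewrite -[X in measurable X]setTI; apply: mh => //; exact: measurableX.
rewrite /tuple_measure_step /pushforward -comp_preimage.
rewrite (_ : h \o _ = id).
  by rewrite preimage_id product_measure1E// lte_mul_pinfty// ge0_fin_numE.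
apply/funext => -[x t] /=; rewrite /h /cons_pair theadE/=; congr pair.
exact/val_inj.
Qed.

HB.instance Definition _ := Measure_isSigmaFinite.Build _ _ _
  tuple_measure_step step_sigma_finite.

End step.

Fixpoint tuple_measure (mu : {sigma_finite_measure set T -> \bar R}) (n : nat) :
    {sigma_finite_measure set (n.-tuple T) -> \bar R} :=
  match n with
  | 0%N => \d_([tuple] : 0.-tuple T)
  | n'.+1 => tuple_measure_step mu (tuple_measure mu n')
  end.

Lemma tuple_measure_box (mu : {sigma_finite_measure set T -> \bar R}) n
    (A : 'I_n -> set T) : (forall i, measurable (A i)) ->
  tuple_measure mu n [set t | forall i, A i (tnth t i)] = (\prod_(i < n) mu (A i))%E.
Proof.
elim: n A => [|n IH] A mA.
  rewrite big_ord0 /= diracE (_ : [set t | _] = setT) ?in_setT//.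
  by apply/seteqP; split => // t _ [].
have mB : measurable [set t : n.-tuple T | forall i, A (lift ord0 i) (tnth t i)].
  rewrite (_ : mkset _ = \bigcap_(i in [set: 'I_n])
      ((@tnth n T ^~ i) @^-1` A (lift ord0 i))).
    apply: fin_bigcap_measurable => // i _; rewrite -[X in measurable X]setTI.
    exact: measurable_tnth.
  by apply/seteqP; split => t /= tA i; [move=> _|]; exact: tA.
rewrite big_ord_recl /= /tuple_measure_step /pushforward.
rewrite (_ : _ @^-1` _ =
    A ord0 `*` [set t : n.-tuple T | forall i, A (lift ord0 i) (tnth t i)]).
  rewrite product_measure1E//; congr (_ * _)%E.
  by apply: (IH (fun i => A (lift ord0 i))) => i; exact: mA.
apply/seteqP; split => -[x t] /=.
  move=> xtA; split; first by have := xtA ord0; rewrite /cons_pair tnth0.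
  by move=> i; have := xtA (lift ord0 i); rewrite /cons_pair tnthS.
move=> [/= xA tA] i; case: (unliftP ord0 i) => [j|] ->; rewrite /cons_pair.
  by rewrite tnthS.
by rewrite tnth0.
Qed.

End tuple_measure.

Section polya_tree.
Context (R : realType) (a b : R).

Definition dyadic_cell (l k : nat) : interval R :=
  if k.+1 == (2 ^ l)%N then `[b - (b - a) / 2 ^+ l, b]
  else `[a + (b - a) * k%:R / 2 ^+ l, a + (b - a) * k.+1%:R / 2 ^+ l[.

(* [V_(l,k)], for [l < L] and [k < 2 ^ l], is entry [2 ^ l - 1 + k] of a tuple
   of length [2 ^ L - 1] (breadth-first order). *)
Definition split_var (N : nat) (V : N.-tuple R) (l k : nat) : R :=
  nth 0 V (2 ^ l - 1 + k)%N.

Fixpoint cell_mass (N : nat) (V : N.-tuple R) (l k : nat) : R :=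
  match l with
  | 0%N => 1
  | l'.+1 => let v := split_var V l' k./2 in
      (if odd k then 1 - v else v) * cell_mass V l' k./2
  end.

Definition polya_density (L : nat) (V : (2 ^ L - 1).-tuple R) (x : R) : R :=
  \sum_(k < 2 ^ L)
    2 ^+ L / (b - a) * cell_mass V L k * (x \in dyadic_cell L k)%:R.

(* The prior is the law of [polya_density V] for [V] drawn from this measure. *)
Definition split_prior (L : nat) :
    {sigma_finite_measure set ((2 ^ L - 1).-tuple (measurableTypeR R)) -> \bar R} :=
  tuple_measure (beta_prob 1 1) (2 ^ L - 1).

End polya_tree.

Section linear_model.
Context (R : realType) (m n : nat) (X : 'M[R]_(m, n)) (sigma : R).

Definition lebesgue_tuple (k : nat) :
    {sigma_finite_measure set (k.-tuple (measurableTypeR R)) -> \bar R} :=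
  tuple_measure lebesgue_measure k.

(* The joint Lebesgue density of [(beta, Y)] when [beta] is i.i.d. with density
   [g] and [Y | beta ~ N(X beta, sigma^2 I_m)]. *)
Definition joint_density (g : R -> R) (beta : n.-tuple R) (y : m.-tuple R) : R :=
  (\prod_(i < n) g (tnth beta i)) *
  \prod_(k < m) normal_pdf ((X *m \col_i tnth beta i) k 0) sigma (tnth y k).

Definition true_expectation (g0 : R -> R)
    (f : n.-tuple R -> m.-tuple R -> \bar R) : \bar R :=
  (\int[lebesgue_tuple n \x lebesgue_tuple m]_z
     ((joint_density g0 z.1 z.2)%:E * f z.1 z.2))%E.

(* Up to the Bayes denominator [working_evidence setT y], the posterior mass of
   [B]; the integral over [V] is the integral over the prior on densities. *)
Definition working_evidence (a b : R) (L : nat) (B : set (R -> R))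
    (y : m.-tuple R) : \bar R :=
  (\int[split_prior R L]_(V in [set V | B (polya_density a b V)])
     \int[lebesgue_tuple n]_beta
       (joint_density (polya_density a b V) beta y)%:E)%E.

Definition posterior (a b : R) (L : nat) (B : set (R -> R)) (y : m.-tuple R) : R :=
  fine (working_evidence a b L B y) / fine (working_evidence a b L setT y).

End linear_model.

Section levels.
Context (R : realType).

Definition lambda_min (n : nat) (A : 'M[R]_n) : R := inf [set x | eigenvalue A x].

Definition log2 (x : R) : R := ln x / ln 2.

(* [Num.truncn] is the floor on nonnegative reals and [0] on negative ones. *)
Definition level_cast (alpha c : R) (n : nat) : nat :=
  Num.truncn (log2 (c * (n%:R / ln n%:R) `^ (2 * alpha + 1)^-1)).

(* The maximum, or [0] if there is none. *)
Definition level_noise (c : R) (m n : nat) (X : 'M[R]_(m, n)) (sigma : R) : nat :=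
  let S := [set l : nat | (0 < l)%N /\
    2 `^ (3 * l%:R / 2) / l%:R `^ (3 / 2) <=
      c * (lambda_min (X^T *m X) / (sigma ^+ 2 * n%:R `^ (3 / 2)))] in
  xget 0%N [set l | S l /\ forall l', S l' -> (l' <= l)%N].

Definition level (alpha cCast cNoise : R) (m n : nat) (X : 'M[R]_(m, n))
    (sigma : R) : nat :=
  minn (level_cast alpha cCast n) (level_noise cNoise X sigma).

Definition rate (a b alpha : R) (n L : nat) : R :=
  (b - a) `^ alpha * 2 `^ (- alpha * L%:R)
  + (b - a)^-1 * Num.sqrt (L%:R * 2 ^+ L / n%:R).

(* Valued in [\bar R], so that an unbounded [f] has norm [+oo]. *)
Definition sup_norm (a b : R) (f : R -> R) : \bar R :=
  ereal_sup [set `|f x|%:E | x in `[a, b]].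

End levels.

(* Main.v *)
Require Import Defs.
From mathcomp Require Import all_boot all_order all_algebra.
From mathcomp Require Import all_classical all_reals all_analysis.
From mathcomp Require Import measurable_realfun zify ring lra.

Set Implicit Arguments.
Unset Strict Implicit.
Unset Printing Implicit Defensive.

Import Order.TTheory GRing.Theory Num.Theory.
Import numFieldNormedType.Exports.

Local Open Scope classical_set_scope.
Local Open Scope ring_scope.

(** The data determine the unobserved sample [beta0] only up to the error of the
    least squares estimator, and the size of that sample grows, so the posterior is
    studied through its mixture representation. Under the
    working model, the law of the density given the data is the average, over the
    working posterior of the observations [beta], of its law given [beta]; and given
    [beta] the splits of the tree are independent Beta variables, governed by
    the numbers of entries of [beta] in the dyadic cells ([lik_in]). Write
    [q = sqrt (L 2 ^ L / n)], the stochastic part of the rate. Three comparisons, each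
    costing a relative error of order [q] on the mass of a leaf, give the theorem.

    From the random density to the counts of [beta]. Each split is within
    [sqrt (2 L / count)] of the empirical proportion outside an event of posterior
    probability of order [exp (- 2 L)], so that a union bound over the [2 ^ L - 1]
    nodes is affordable ([beta_tail], [split_concentration]). The relative errors
    along a branch form a geometric progression dominated by the leaf level, where
    they are of order [q] ([cell_mass_estimate]).

    From the counts of [beta] to those of [beta0]. The squared distance of either
    vector to the least squares estimator is at most [K n s ^ 2 / lambda_min] outside
    an event of probability [exp (- c K n)] ([lse_dist_mgf]). For [beta0] this is a
    statement about the true law. For [beta], drawn from the working posterior, it is
    first proved under the working law and then transferred to the true one. The
    density of the true law of the sample with respect to the working law is at most
    [A ^ n] ([marginal_ge]), an exponential factor that a large [K] compensates
    ([expected_posterior_le], [total_tail_le]). Hence at most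
    [4 K n s ^ 2 / (lambda_min delta ^ 2)] entries of [beta] and [beta0] differ by
    [delta] or more ([moved_le]). With [delta = q / 2 ^ L], of the order of [q]
    times the width of a leaf, the noise cutoff is exactly the condition
    [s ^ 2 / lambda_min <= c delta ^ 3] ([level_noise_le]), so the number of such
    entries is of order [n delta], that is, [q] times the count of a leaf.

    From the counts of [beta0] to [g0]. The entries of [beta0] in a cell widened or
    narrowed by [delta] are counted by binomial variables, and Chernoff's bound gives
    a deviation of order [n q / 2 ^ L] for all cells at once ([hits_mgf]). The mass of
    a cell differs from its width times the value of [g0] at its left end by at most
    its width times the oscillation of [g0], which is the bias term of the rate.

    What remains is that [q] tends to 0, which follows from the other cutoff once
    [L] tends to infinity ([cell_ratio_le]). *)

(** * Integration over product spaces *)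

Section monotone.
Context d (T : measurableType d) (R : realType).
Variable mu : {measure set T -> \bar R}.
Import HBNNSimple.
Local Open Scope ereal_scope.

(** The integral of a nonnegative function is the supremum of the integrals of
    the simple functions below it, so it is monotone without measurability. The
    posterior probability of an arbitrary set of densities is such a function of
    the data. *)
Lemma ge0_le_integral_nonmeas (f g : T -> \bar R) :
  (forall x, 0 <= f x) -> (forall x, f x <= g x) ->
  \int[mu]_x f x <= \int[mu]_x g x.
Proof.
move=> f0 fg.
have g0 x : 0 <= g x by exact: le_trans (f0 x) (fg x).
rewrite !ge0_integralTE//; apply: ereal_sup_le => _ [h hf <-].
by exists h => // x; exact: le_trans (hf x) (fg x).
Qed.

Lemma ge0_integral_scale (c : R) (f : T -> R) : (0 <= c)%R ->
  measurable_fun setT f -> (forall x, 0 <= f x)%R ->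
  \int[mu]_x (c * f x)%:E = c%:E * \int[mu]_x (f x)%:E.
Proof.
move=> c0 mf f0; under eq_integral do rewrite EFinM.
apply: ge0_integralZl => //; first exact/measurable_EFinP.
by move=> x _; rewrite lee_fin.
Qed.

End monotone.

Section tuple_integral.
Context d (T : measurableType d) (R : realType).
Variable mu : {sigma_finite_measure set T -> \bar R}.
Local Open Scope ereal_scope.

Lemma integral_tuple_measureS n (f : n.+1.-tuple T -> \bar R) :
  measurable_fun [set: n.+1.-tuple T] f -> (forall t, 0 <= f t) ->
  \int[tuple_measure mu n.+1]_t f t =
  \int[mu]_x \int[tuple_measure mu n]_t f [tuple of x :: t].
Proof.
move=> mf f0.
rewrite (_ : \int[_]_t f t =
  \int[pushforward (mu \x tuple_measure mu n) (@cons_pair _ T n)]_t f t)//.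
rewrite ge0_integral_pushforward//; last exact: measurable_cons_pair.
rewrite preimage_setT fubini_tonelli1//.
- by apply: measurableT_comp => //; exact: measurable_cons_pair.
- by move=> x; exact: f0.
Qed.

Lemma integral_tuple_measure0 (f : 0.-tuple T -> \bar R) :
  measurable_fun [set: 0.-tuple T] f -> \int[tuple_measure mu 0]_t f t = f [tuple].
Proof. by move=> mf; rewrite /= integral_dirac// diracT mul1e. Qed.

Lemma integral_tuple_prod n (f : 'I_n -> T -> R) :
  (forall i, measurable_fun setT (f i)) -> (forall i x, (0 <= f i x)%R) ->
  \int[tuple_measure mu n]_t (\prod_(i < n) f i (tnth t i))%:E =
  \prod_(i < n) \int[mu]_x (f i x)%:E.
Proof.
elim: n f => [|n IH] f mf f0.
  rewrite integral_tuple_measure0; first by rewrite !big_ord0.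
  by under eq_fun do rewrite big_ord0; exact: measurable_cst.
have mprod k (g : 'I_k -> T -> R) : (forall i, measurable_fun setT (g i)) ->
    measurable_fun [set: k.-tuple T] (fun t => (\prod_(i < k) g i (tnth t i))%:E).
  move=> mg; apply/measurable_EFinP; apply: measurable_prod => i _.
  by apply: measurableT_comp (mg i) _; exact: measurable_tnth.
rewrite integral_tuple_measureS; last 2 first.
  exact: mprod.
  by move=> t; rewrite lee_fin prodr_ge0.
under eq_integral => x _.
  under eq_integral => t _.
    rewrite big_ord_recl tnth0.
    under eq_bigr => i _ do rewrite tnthS.
    rewrite EFinM; over.
  rewrite ge0_integralZl//; last 3 first.
    by apply: (mprod _ (fun i => f (lift ord0 i))) => i; exact: mf.
    by move=> t _; rewrite lee_fin prodr_ge0.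
    by rewrite lee_fin.
  rewrite (IH (fun i => f (lift ord0 i)))//.
  over.
rewrite ge0_integralZr//.
- by rewrite big_ord_recl.
- exact/measurable_EFinP.
- by move=> x _; rewrite lee_fin.
- by apply: prode_ge0 => i _; apply: integral_ge0 => x _; rewrite lee_fin.
Qed.

End tuple_integral.

Lemma integral_lebesgue_prod (R : realType) n (f : 'I_n -> R -> R) (v : 'I_n -> R) :
  (forall i, measurable_fun setT (f i)) -> (forall i x, 0 <= f i x) ->
  (forall i, \int[@lebesgue_measure R]_x (f i x)%:E = (v i)%:E)%E ->
  (\int[lebesgue_tuple R n]_t (\prod_(i < n) f i (tnth t i))%:E =
   (\prod_(i < n) v i)%:E)%E.
Proof.
move=> mf f0 fv; rewrite -prodEFin.
under [RHS]eq_bigr do rewrite -fv.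
exact: (integral_tuple_prod lebesgue_measure).
Qed.

Lemma tonelli_swap d1 d2 (T1 : measurableType d1) (T2 : measurableType d2)
    (R : realType) (m1 : {sigma_finite_measure set T1 -> \bar R})
    (m2 : {sigma_finite_measure set T2 -> \bar R}) (f : T1 -> T2 -> \bar R) :
  measurable_fun [set: T1 * T2] (fun z => f z.1 z.2) ->
  (forall x y, 0 <= f x y)%E ->
  (\int[m1]_x \int[m2]_y f x y = \int[m2]_y \int[m1]_x f x y)%E.
Proof.
move=> mf f0; apply: (fubini_tonelli (fun z : T1 * T2 => f z.1 z.2)) => //.
Qed.

Section measurable_indicators.
Context d (T : measurableType d) (R : realType).

Lemma measurable_ltr_indic (t : R) (f : T -> R) : measurable_fun [set: T] f ->
  measurable_fun [set: T] (fun x => (t < f x)%R%:R : R).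
Proof.
move=> mf; rewrite (_ : (fun _ => _) = \1_(f @^-1` `]t, +oo[%classic)).
  apply: measurable_indic; rewrite -[X in measurable X]setTI.
  by apply: mf => //; exact: measurable_itv.
apply/funext => x; rewrite indicE; congr (nat_of_bool _)%:R.
by apply/idP/idP => [h|/set_mem]; [apply/mem_set|]; rewrite /= in_itv/= andbT.
Qed.

Lemma measurable_exists_indic (I : finType) (P : I -> T -> bool) :
  (forall k, measurable_fun [set: T] (fun x => (P k x)%:R : R)) ->
  measurable_fun [set: T] (fun x => [exists k, P k x]%:R : R).
Proof.
move=> mP; rewrite (_ : (fun _ => _) = fun x => 1 - \prod_k (1 - (P k x)%:R)).
  apply: measurable_funB => //; apply: measurable_prod => k _.
  exact: measurable_funB.
apply/funext => x; have [/existsP[k kx]|/existsPn h] := boolP [exists k, P k x].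
  by rewrite (bigD1 k)//= kx subrr mul0r subr0.
by rewrite big1 ?subrr// => k _; rewrite (negbTE (h k)) subr0.
Qed.

End measurable_indicators.

(** * Gaussian moments *)

Section gaussian.
Context (R : realType).
Local Open Scope ereal_scope.
Notation mu := (@lebesgue_measure R).

Lemma integral_normal_pdf_expR (m s c : R) : s != 0%R ->
  \int[mu]_x (normal_pdf m s x * expR (c * (x - m)))%:E =
  (expR (c ^+ 2 * s ^+ 2 / 2))%:E.
Proof.
move=> s0.
transitivity (\int[mu]_x
    (expR (c ^+ 2 * s ^+ 2 / 2) * normal_pdf (m + c * s ^+ 2) s x)%:E).
  apply: eq_integral => x _; rewrite !normal_pdfE// /normal_fun.
  congr EFin; rewrite -[LHS]mulrA -expRD [RHS]mulrCA -expRD.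
  by congr (_ * expR _)%R; field.
rewrite ge0_integral_scale ?expR_ge0//; last 2 first.
- exact: measurable_normal_pdf.
- exact: normal_pdf_ge0.
by rewrite integral_normal_pdf mule1.
Qed.

(** The density of a standard Gaussian reweighted by [exp (3 x ^ 2 / 8)] is
    twice the centred Gaussian density of standard deviation 2. *)
Lemma integral_normal_pdf_expR_sqr :
  \int[mu]_x (normal_pdf 0 1 x * expR (3 / 8 * x ^+ 2))%:E = 2%:E.
Proof.
transitivity (\int[mu]_x (2 * normal_pdf 0 2 x)%:E).
  apply: eq_integral => x _; rewrite !normal_pdfE ?oner_neq0//.
  rewrite /normal_fun /normal_peak; congr EFin.
  have -> : Num.sqrt (2 ^+ 2 * pi *+ 2 : R) = (2 * Num.sqrt (1 ^+ 2 * pi *+ 2))%R.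
    rewrite expr1n mul1r -mulrnAr sqrtrM ?exprn_ge0//.
    by rewrite sqrtr_sqr ger0_norm.
  rewrite invfM -[LHS]mulrA [RHS]mulrA [X in _ = (X * _)%R]mulrA divff// mul1r.
  rewrite -expRD.
  by congr (_ * expR _)%R; field.
rewrite ge0_integral_scale//; last 2 first.
- exact: measurable_normal_pdf.
- exact: normal_pdf_ge0.
by rewrite integral_normal_pdf mule1.
Qed.

Lemma measurable_tnth_comp d (T : measurableType d) n (f : T -> n.-tuple (measurableTypeR R)) i :
  measurable_fun [set: T] f -> measurable_fun [set: T] (fun x => tnth (f x) i).
Proof. by move=> mf; apply: (measurableT_comp (measurable_tnth i)). Qed.

Definition gauss_prod m (mean : 'I_m -> R) (s : R) (y : m.-tuple R) : R :=
  (\prod_(k < m) normal_pdf (mean k) s (tnth y k))%R.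

Lemma gauss_prod_ge0 m (mean : 'I_m -> R) s y : (0 <= gauss_prod mean s y)%R.
Proof. by apply: prodr_ge0 => k _; exact: normal_pdf_ge0. Qed.

Lemma measurable_gauss_prod d (T : measurableType d) m (mean : T -> 'I_m -> R) s
    (y : T -> m.-tuple (measurableTypeR R)) : s != 0%R ->
  (forall k, measurable_fun [set: T] (fun x => mean x k)) ->
  measurable_fun [set: T] y ->
  measurable_fun [set: T] (fun x => gauss_prod (mean x) s (y x)).
Proof.
move=> s0 mmean my; apply: measurable_prod => k _.
under eq_fun do rewrite normal_pdfE//.
apply: measurable_funM => //; apply: measurableT_comp => //.
apply: measurable_funM => //; apply: measurableT_comp => //.
apply: measurable_funX; apply: measurable_funB => //.
exact: measurable_tnth_comp.
Qed.

Lemma integral_gauss_prod m (mean : 'I_m -> R) (s : R) :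
  \int[lebesgue_tuple R m]_y (gauss_prod mean s y)%:E = 1.
Proof.
rewrite (@integral_lebesgue_prod _ _ (fun k => normal_pdf (mean k) s) (fun=> 1%R)).
- by rewrite big1.
- by move=> i; exact: measurable_normal_pdf.
- by move=> i x; exact: normal_pdf_ge0.
- by move=> i; exact: integral_normal_pdf.
Qed.

(** Hubbard-Stratonovich linearisation: [exp (3 c w ^ 2 / 8)] is the expectation of
    [exp (r eta w)] for [eta] standard Gaussian and [r ^ 2 = 3 c / 4]. After
    exchanging the integrals, the integral over [y] is that of the exponential of a
    linear form, and the hypothesis on [M] bounds it by the exponential of
    [3 / 8 * sum eta_i ^ 2], which contributes a factor 2 per coordinate. *)
Lemma gauss_square_mgf n m (M : 'M[R]_(n, m)) (mean : 'I_m -> R) (s c : R) :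
  (0 < s)%R -> (0 <= c)%R ->
  (forall eta : 'I_n -> R, c * s ^+ 2 * \sum_k (\sum_i eta i * M i k) ^+ 2 <=
     \sum_i eta i ^+ 2)%R ->
  \int[lebesgue_tuple R m]_y
    (gauss_prod mean s y *
     expR (3 / 8 * c * \sum_i (\sum_k M i k * (tnth y k - mean k)) ^+ 2))%:E
  <= (2 ^+ n)%:E.
Proof.
move=> s0 c0 hM.
have sn0 : s != 0%R by rewrite gt_eqF.
set r := Num.sqrt (3 / 4 * c).
have r2 : (r ^+ 2 = 3 / 4 * c)%R by rewrite sqr_sqrtr// mulr_ge0.
pose w (y : m.-tuple R) i := (\sum_k M i k * (tnth y k - mean k))%R.
pose F (y : m.-tuple R) (eta : n.-tuple R) : R :=
  (gauss_prod mean s y *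
   \prod_(i < n) (normal_pdf 0 1 (tnth eta i) *
                  expR ((r * w y i) * (tnth eta i - 0))))%R.
have F0 y eta : (0 <= F y eta)%R.
  rewrite mulr_ge0 ?gauss_prod_ge0//; apply: prodr_ge0 => i _.
  by rewrite mulr_ge0 ?normal_pdf_ge0 ?expR_ge0.
have mw d (T : measurableType d) (y : T -> m.-tuple (measurableTypeR R)) i :
    measurable_fun [set: T] y -> measurable_fun [set: T] (fun x => w (y x) i).
  move=> my; apply: measurable_sum => k.
  apply: measurable_funM => //; apply: measurable_funB => //.
  exact: measurable_tnth_comp.
have mF : measurable_fun [set: m.-tuple (measurableTypeR R) *
    n.-tuple (measurableTypeR R)] (fun z => (F z.1 z.2)%:E).
  apply/measurable_EFinP; apply: measurable_funM.
    by apply: (measurable_gauss_prod (mean := fun _ => mean)) => //; exact: measurable_fst.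
  apply: measurable_prod => i _; apply: measurable_funM.
    apply: measurableT_comp; first exact: measurable_normal_pdf.
    by apply: measurable_tnth_comp; exact: measurable_snd.
  apply: measurableT_comp => //; apply: measurable_funM.
    by apply: measurable_funM => //; apply: mw; exact: measurable_fst.
  by apply: measurable_funB => //; apply: measurable_tnth_comp; exact: measurable_snd.
have -> : \int[lebesgue_tuple R m]_y (gauss_prod mean s y *
     expR (3 / 8 * c * \sum_i (\sum_k M i k * (tnth y k - mean k)) ^+ 2))%:E =
  \int[lebesgue_tuple R m]_y \int[lebesgue_tuple R n]_eta (F y eta)%:E.
  apply: eq_integral => y _; rewrite ge0_integral_scale ?gauss_prod_ge0//; last 2 first.
  - apply: measurable_prod => i _.
    apply: measurable_funM.
      apply: measurableT_comp; first exact: measurable_normal_pdf.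
      exact: measurable_tnth.
    apply: measurableT_comp => //; apply: measurable_funM => //.
    by apply: measurable_funB => //; exact: measurable_tnth.
  - move=> eta; apply: prodr_ge0 => i _.
    by rewrite mulr_ge0 ?normal_pdf_ge0 ?expR_ge0.
  rewrite (@integral_lebesgue_prod _ _
    (fun i x => normal_pdf 0 1 x * expR ((r * w y i) * (x - 0)))%R
    (fun i => expR ((r * w y i) ^+ 2 * 1 ^+ 2 / 2)%R)); last 3 first.
  - move=> i; apply: measurable_funM; first exact: measurable_normal_pdf.
    apply: measurableT_comp => //; apply: measurable_funM => //.
    exact: measurable_funB.
  - by move=> i x; rewrite mulr_ge0 ?normal_pdf_ge0 ?expR_ge0.
  - by move=> i; rewrite integral_normal_pdf_expR ?oner_neq0.
  rewrite -EFinM -expR_sum; congr (_ * expR _)%:E%R.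
  rewrite mulr_sumr; apply: eq_bigr => i _.
  by rewrite expr1n mulr1 exprMn r2 /w; field.
rewrite tonelli_swap//.
pose d (eta : n.-tuple R) k := (r * \sum_i tnth eta i * M i k)%R.
apply: (@le_trans _ _ (\int[lebesgue_tuple R n]_eta
   (\prod_(i < n) (normal_pdf 0 1 (tnth eta i) * expR (3 / 8 * tnth eta i ^+ 2)))%:E)).
  apply: ge0_le_integral_nonmeas => [eta|eta].
    by apply: integral_ge0 => y _; rewrite lee_fin.
  have -> : \int[lebesgue_tuple R m]_y (F y eta)%:E =
      (\prod_(i < n) (normal_pdf 0 1 (tnth eta i)) *
       expR (\sum_k (d eta k ^+ 2 * s ^+ 2 / 2)))%:E.
    transitivity (\int[lebesgue_tuple R m]_y
      (\prod_(i < n) (normal_pdf 0 1 (tnth eta i)) *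
      \prod_(k < m) (normal_pdf (mean k) s (tnth y k) *
          expR (d eta k * (tnth y k - mean k))))%:E).
      apply: eq_integral => y _; congr EFin; rewrite /F !big_split/=.
      rewrite mulrCA; congr (_ * (_ * _))%R.
      rewrite -!expR_sum; congr expR.
      under eq_bigr => i _ do rewrite subr0 /w mulr_sumr mulr_suml.
      rewrite exchange_big; apply: eq_bigr => k _.
      rewrite /d mulr_sumr mulr_suml; apply: eq_bigr => i _.
      by ring.
    rewrite ge0_integral_scale; last 3 first.
    - by apply: prodr_ge0 => i _; exact: normal_pdf_ge0.
    - apply: measurable_prod => i _.
      apply: measurable_funM.
        apply: measurableT_comp; first exact: measurable_normal_pdf.
        exact: measurable_tnth.
      apply: measurableT_comp => //; apply: measurable_funM => //.
      by apply: measurable_funB => //; exact: measurable_tnth.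
    - move=> y; apply: prodr_ge0 => i _.
      by rewrite mulr_ge0 ?normal_pdf_ge0 ?expR_ge0.
    rewrite (@integral_lebesgue_prod _ _
      (fun k x => normal_pdf (mean k) s x * expR (d eta k * (x - mean k)))%R
      (fun k => expR (d eta k ^+ 2 * s ^+ 2 / 2)%R)); last 3 first.
    - move=> i; apply: measurable_funM; first exact: measurable_normal_pdf.
      apply: measurableT_comp => //; apply: measurable_funM => //.
      exact: measurable_funB.
    - by move=> i x; rewrite mulr_ge0 ?normal_pdf_ge0 ?expR_ge0.
    - by move=> i; rewrite integral_normal_pdf_expR.
    by rewrite -EFinM -expR_sum.
  rewrite lee_fin big_split/= ler_wpM2l//.
    by apply: prodr_ge0 => i _; exact: normal_pdf_ge0.
  rewrite -expR_sum ler_expR -mulr_sumr.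
  apply: (@le_trans _ _ (3 / 8 * (c * s ^+ 2 * \sum_k (\sum_i tnth eta i * M i k) ^+ 2))%R).
    rewrite le_eqVlt; apply/orP; left; apply/eqP.
    rewrite !mulr_sumr; apply: eq_bigr => k _.
    by rewrite /d exprMn r2; field.
  by rewrite ler_wpM2l// (hM (tnth eta)).
rewrite (@integral_lebesgue_prod _ _
  (fun i x => normal_pdf 0 1 x * expR (3 / 8 * x ^+ 2))%R
  (fun=> 2%R)); last 3 first.
- move=> i; apply: measurable_funM; first exact: measurable_normal_pdf.
  by apply: measurableT_comp => //; apply: measurable_funM.
- by move=> i x; rewrite mulr_ge0 ?normal_pdf_ge0 ?expR_ge0.
- by move=> i; exact: integral_normal_pdf_expR_sqr.
by rewrite prodr_const card_ord.
Qed.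

End gaussian.

(** * The smallest eigenvalue of a Gram matrix *)

Section rayleigh.
Context (R : realType).

Definition sqnorm n (v : 'rV[R]_n) : R := \sum_i (v 0 i) ^+ 2.

Definition quad n (A : 'M[R]_n) (v : 'rV[R]_n) : R := (v *m A *m v^T) 0 0.

Lemma sqnormE n (v : 'rV[R]_n) : sqnorm v = (v *m v^T) 0 0.
Proof. by rewrite mxE; apply: eq_bigr => i _; rewrite mxE -expr2. Qed.

Lemma sqnorm_ge0 n (v : 'rV[R]_n) : 0 <= sqnorm v.
Proof. by apply: sumr_ge0 => i _; rewrite sqr_ge0. Qed.

Lemma sqnorm_eq0 n (v : 'rV[R]_n) : (sqnorm v == 0) = (v == 0).
Proof.
apply/eqP/eqP => [v0|->]; last first.
  by rewrite /sqnorm big1// => i _; rewrite mxE expr0n.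
apply/rowP => i; rewrite [RHS]mxE; apply/eqP; rewrite -sqrf_eq0; apply/eqP.
have := psumr_eq0P (fun i _ => sqr_ge0 (v 0 i)) v0.
by apply.
Qed.

Lemma sqnorm0 n : sqnorm (0 : 'rV[R]_n) = 0.
Proof. by apply/eqP; rewrite sqnorm_eq0. Qed.

Lemma sqnormZ n (t : R) (v : 'rV[R]_n) : sqnorm (t *: v) = t ^+ 2 * sqnorm v.
Proof. by rewrite /sqnorm mulr_sumr; apply: eq_bigr => i _; rewrite mxE exprMn. Qed.

Lemma quadZ n (A : 'M[R]_n) (t : R) v : quad A (t *: v) = t ^+ 2 * quad A v.
Proof.
by rewrite /quad linearZ/= -!scalemxAl -!scalemxAr scalerA mxE -expr2.
Qed.

Lemma quad_gram m n (X : 'M[R]_(m, n)) v : quad (X^T *m X) v = sqnorm (v *m X^T).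
Proof. by rewrite sqnormE /quad trmx_mul trmxK !mulmxA. Qed.

Lemma continuous_quad n (A : 'M[R]_n) : continuous (quad A).
Proof.
have -> : quad A = fun v => \sum_j (\sum_i v 0 i * A i j) * v 0 j.
  apply/funext => v; rewrite /quad mxE; apply: eq_bigr => j _.
  by rewrite !mxE.
have ce i : continuous (fun v : 'rV[R]_n => v 0 i) by exact: coord_continuous.
have cs j : continuous (fun v : 'rV[R]_n => \sum_i v 0 i * A i j).
  apply: continuous_big => [|i _ v]; first exact: add_continuous.
  exact: (continuousM (ce i v) (@cst_continuous _ _ (A i j) v)).
apply: continuous_big => [|j _ v]; first exact: add_continuous.
exact: (continuousM (cs j v) (ce j v)).
Qed.

Lemma quad1 n (v : 'rV[R]_n) : quad 1%:M v = sqnorm v.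
Proof. by rewrite /quad mulmx1 sqnormE. Qed.

Lemma compact_unit_sphere n : compact [set v : 'rV[R]_n | sqnorm v = 1].
Proof.
apply: (@subclosed_compact _ _ [set v : 'rV[R]_n | forall i, `[-1, 1]%classic (v ord0 i)]).
- have -> : [set v : 'rV[R]_n | sqnorm v = 1] = quad 1%:M @^-1` [set 1].
    by apply/seteqP; split => v /=; rewrite quad1.
  by apply: closed_comp => [v _|]; [exact: continuous_quad|exact: closed_eq].
- exact: (@rV_compact R n (fun=> `[-1, 1]%classic) (fun i => @segment_compact R (-1) 1)).
- move=> v /= v1 i; rewrite in_itv/= -ler_norml -(@expr_le1 _ 2)// real_normK ?num_real// -v1.
  by rewrite /sqnorm (bigD1 i)//= lerDl sumr_ge0// => j _; exact: sqr_ge0.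
Qed.

(** The minimum of the Rayleigh quotient is attained on the unit sphere by
    compactness; at a minimiser the form [A - mu] is nonnegative and vanishes, so
    its derivative vanishes there and the minimiser is an eigenvector. *)
Lemma rayleigh_min n (A : 'M[R]_n.+1) : A^T = A ->
  exists2 mu, eigenvalue A mu & forall v, mu * sqnorm v <= quad A v.
Proof.
move=> sA; pose S := [set v : 'rV[R]_n.+1 | sqnorm v = 1].
have S0 : S !=set0.
  exists (delta_mx 0 0); rewrite /S /= /sqnorm (bigD1 0)//= mxE !eqxx expr1n.
  rewrite big1 ?addr0// => i i0; rewrite mxE eqxx/= (negbTE i0) expr0n//.
have [v0 /set_mem v01 vmin] := @compact_EVT_min _ R (quad A) S S0
  (@compact_unit_sphere _) (continuous_subspaceT (@continuous_quad _ A)).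
pose mu := quad A v0.
have le_mu v : mu * sqnorm v <= quad A v.
  have [->|v0n] := eqVneq v 0.
    by rewrite /quad !mul0mx mxE sqnorm0 mulr0.
  have vp : 0 < sqnorm v by rewrite lt_def sqnorm_eq0 v0n sqnorm_ge0.
  have svp : 0 < Num.sqrt (sqnorm v) by rewrite sqrtr_gt0.
  pose t := (Num.sqrt (sqnorm v))^-1.
  have t2 : t ^+ 2 = (sqnorm v)^-1 by rewrite exprVn sqr_sqrtr// ltW.
  have : quad A v0 <= quad A (t *: v).
    by apply: vmin; apply/mem_set; rewrite /S /= sqnormZ t2 mulVf ?gt_eqF.
  by rewrite quadZ t2 mulrC ler_pdivlMr.
exists mu => //; apply/eigenvalueP; exists v0; last first.
  by rewrite -sqnorm_eq0 v01 oner_neq0.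
have [M ME] : exists M, M = A - mu%:M by eexists.
have sM : M^T = M by rewrite ME linearB/= sA tr_scalar_mx.
have quadM v : quad M v = quad A v - mu * sqnorm v.
  by rewrite ME /quad mulmxBr mulmxBl mul_mx_scalar -scalemxAl mxE [X in _ + X]mxE
    [X in _ - X]mxE -sqnormE.
have M0 : quad M v0 = 0 by rewrite quadM v01 mulr1 subrr.
have quad0 v : 0 <= quad M v by rewrite quadM subr_ge0.
pose u := v0 *m M.
have quadD t : quad M (v0 + t *: u) = 2 * t * sqnorm u + t ^+ 2 * quad M u.
  have uE : (u *m M *m v0^T) 0 0 = sqnorm u.
    by rewrite sqnormE {3}/u trmx_mul sM mulmxA.
  have uE' : (v0 *m M *m u^T) 0 0 = sqnorm u by rewrite sqnormE.
  transitivity (quad M v0 + t * (v0 *m M *m u^T) 0 0 +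
     t * (u *m M *m v0^T) 0 0 + t ^+ 2 * quad M u).
    have addE (B C : 'M[R]_1) : (B + C) 0 0 = B 0 0 + C 0 0 by rewrite mxE.
    have scaleE c (B : 'M[R]_1) : (c *: B) 0 0 = c * B 0 0 by rewrite mxE.
    rewrite -quadZ /quad [(v0 + _)^T]linearD/= !mulmxDl !mulmxDr !addE.
    rewrite [(t *: u)^T]linearZ/= -!scalemxAl -!scalemxAr !scaleE.
    by ring.
  by rewrite M0 uE uE'; ring.
have u0 : sqnorm u = 0.
  apply/eqP; rewrite eq_le sqnorm_ge0 andbT leNgt; apply/negP => up.
  have q0 := quad0 u.
  pose q := quad M u + 1.
  have qp : 0 < q by rewrite ltr_wpDl.
  have := quad0 (v0 + (- (sqnorm u / q)) *: u).
  rewrite quadD; apply/negP; rewrite -ltNge.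
  have -> : 2 * - (sqnorm u / q) * sqnorm u + (- (sqnorm u / q)) ^+ 2 * quad M u =
     - (sqnorm u ^+ 2 / q ^+ 2) * (2 * q - quad M u) by field; rewrite gt_eqF.
  rewrite mulNr oppr_lt0 mulr_gt0 ?divr_gt0 ?exprn_gt0//.
  by rewrite /q; lra.
have : v0 *m M = 0 by apply/eqP; rewrite -sqnorm_eq0 u0.
by rewrite ME mulmxBr mul_mx_scalar => /subr0_eq.
Qed.

Lemma lambda_min_le m n (X : 'M[R]_(m, n)) (v : 'rV[R]_n) :
  lambda_min (X^T *m X) * sqnorm v <= quad (X^T *m X) v.
Proof.
case: n => [|n] in X v *.
  rewrite [v](_ : _ = 0); last by apply/rowP => -[].
  by rewrite quad_gram mul0mx !sqnorm0 mulr0.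
have [|mu emu hmu] := @rayleigh_min n (X^T *m X); first by rewrite trmx_mul trmxK.
apply: le_trans (hmu v); rewrite ler_wpM2r ?sqnorm_ge0//.
apply: ge_inf => //; exists 0 => e /= /eigenvalueP[w wE w0].
have wp : 0 < sqnorm w by rewrite lt_def sqnorm_eq0 w0 sqnorm_ge0.
have := sqnorm_ge0 (w *m X^T); rewrite -quad_gram /quad wE -scalemxAl mxE -sqnormE.
by rewrite pmulr_lge0.
Qed.

End rayleigh.

(** * The least squares estimator *)

Section least_squares.
Context (R : realType) (m n : nat) (X : 'M[R]_(m, n)).
Let A := X^T *m X.

Definition lse_mx : 'M[R]_(n, m) := invmx A *m X^T.

Definition lse_dist (y : m.-tuple R) (beta : n.-tuple R) : R :=
  \sum_i (\sum_k lse_mx i k * tnth y k - tnth beta i) ^+ 2.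

Lemma measurable_lse_dist d (T : measurableType d)
    (y : T -> m.-tuple (measurableTypeR R)) (beta : T -> n.-tuple (measurableTypeR R)) :
  measurable_fun [set: T] y -> measurable_fun [set: T] beta ->
  measurable_fun [set: T] (fun x => lse_dist (y x) (beta x)).
Proof.
move=> my mb; apply: measurable_sum => i; apply: measurable_funX.
apply: measurable_funB; last exact: measurable_tnth_comp.
apply: measurable_sum => k; apply: measurable_funM => //.
exact: measurable_tnth_comp.
Qed.

Hypothesis lambda_gt0 : 0 < lambda_min A.

Let unitA : A \in unitmx.
Proof.
rewrite -row_free_unit -kermx_eq0; apply/rowV0P => v; rewrite sub_kermx => /eqP vA.
have := lambda_min_le X v; rewrite -/A /quad vA mul0mx mxE.
by rewrite pmulr_rle0// => v0; apply/eqP; rewrite -sqnorm_eq0 eq_le v0 sqnorm_ge0.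
Qed.

Let lse_mxK : lse_mx *m X = 1%:M.
Proof. by rewrite /lse_mx -mulmxA mulVmx. Qed.

Let lse_residual (beta : n.-tuple R) y i :
  \sum_k lse_mx i k * (y k - (X *m \col_i tnth beta i) k 0) =
  \sum_k lse_mx i k * y k - tnth beta i.
Proof.
under eq_bigr do rewrite mulrBr.
rewrite sumrB; congr (_ - _).
have : (lse_mx *m (X *m \col_i tnth beta i)) i 0 = tnth beta i.
  by rewrite mulmxA lse_mxK mul1mx mxE.
by rewrite mxE.
Qed.

(** The covariance of the least squares estimator is dominated by the identity
    over [lambda_min]. With [v = eta A ^ -1] one has [v A v ^ T = v eta ^ T], and
    the bound follows from expanding [0 <= |eta - lambda v| ^ 2]. *)
Let lse_contraction (eta : 'rV[R]_n) :
  lambda_min A * sqnorm (eta *m lse_mx) <= sqnorm eta.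
Proof.
set l := lambda_min A.
pose v := eta *m invmx A.
have vA : v *m A = eta by rewrite /v mulmxKV.
have -> : eta *m lse_mx = v *m X^T by rewrite /lse_mx mulmxA.
rewrite -quad_gram -/A.
have hv := lambda_min_le X v; rewrite -/A -/l in hv.
set q := quad A v in hv *.
have qE : q = \sum_i eta 0 i * v 0 i.
  by rewrite /q /quad vA mxE; apply: eq_bigr => i _; rewrite mxE.
have := sqnorm_ge0 (eta - l *: v).
have -> : sqnorm (eta - l *: v) = sqnorm eta - 2 * l * q + l ^+ 2 * sqnorm v.
  rewrite qE /sqnorm !mulr_sumr -sumrB -big_split/=.
  by apply: eq_bigr => i _; rewrite !mxE; ring.
have : l * (l * sqnorm v) <= l * q by rewrite ler_wpM2l// ltW.
by lra.
Qed.

(** A chi-square bound: around [beta] the least squares estimator has squared error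
    of order [n s ^ 2 / lambda_min], with exponential tails uniform in [beta]. *)
Lemma lse_dist_mgf (s : R) (beta : n.-tuple R) : 0 < s ->
  (\int[lebesgue_tuple R m]_y
     (gauss_prod (fun k => (X *m \col_i tnth beta i) k 0) s y *
      expR (3 / 8 * (lambda_min A / s ^+ 2) * lse_dist y beta))%:E
   <= (2 ^+ n)%:E)%E.
Proof.
move=> s0.
apply: le_trans; last first.
  apply: (@gauss_square_mgf R n m lse_mx (fun k => (X *m \col_i tnth beta i) k 0) s
    (lambda_min A / s ^+ 2) s0).
  by rewrite divr_ge0 ?ltW// exprn_gt0.
  move=> eta; rewrite divfK ?gt_eqF ?exprn_gt0//.
  have := lse_contraction (\row_i eta i); rewrite /sqnorm.
  under [X in _ <= X]eq_bigr do rewrite mxE.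
  move=> h; apply: le_trans h; rewrite ler_wpM2l ?(ltW lambda_gt0)//.
  rewrite le_eqVlt; apply/orP; left; apply/eqP.
  apply: eq_bigr => k _; rewrite [in RHS]mxE; congr (_ ^+ 2).
  by apply: eq_bigr => i _; rewrite [X in _ = X * _]mxE.
rewrite le_eqVlt; apply/orP; left; apply/eqP; apply: eq_integral => y _.
do 4 congr (_ _); apply: eq_bigr => i _.
by rewrite (lse_residual beta (tnth y)).
Qed.

End least_squares.

(** * Tails of Beta kernels *)

Section beta_tail.
Context (R : realType).
Notation mu := (@lebesgue_measure R).

Lemma ge0_integral_shift (s : R) (f : R -> \bar R) :
  measurable_fun setT f -> (forall x, 0 <= f x)%E ->
  (\int[mu]_x f (x + s)%R = \int[mu]_x f x)%E.
Proof.
move=> mf f0; pose h (x : R) : measurableTypeR R := x + s.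
have mh : measurable_fun [set: R] h by exact: measurable_funD.
transitivity (\int[pushforward mu h]_x f x)%E.
  by rewrite ge0_integral_pushforward.
apply: eq_measure_integral => A mA _; apply/esym/lebesgue_measure_unique => //= _ [[u v]] _ <-.
rewrite /pushforward (_ : h @^-1` _ = `]u - s, v - s]%classic).
  by rewrite !lebesgue_measure_itv/= !lte_fin ltrD2r -!EFinB; case: ifPn => // _; congr EFin; ring.
by apply/seteqP; split => x /=; rewrite !in_itv/= ltrBlDr lerBrDr.
Qed.

Definition beta_kernel (i j : nat) (x : R) : R :=
  x ^+ i * (1 - x) ^+ j * (x \in `[0, 1])%:R.

Lemma beta_kernel_ge0 i j x : 0 <= beta_kernel i j x.
Proof.
rewrite /beta_kernel; have [|_] := boolP (x \in `[0, 1]); last by rewrite mulr0.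
rewrite mulr1 in_itv/= => /andP[x0 x1].
by rewrite mulr_ge0// exprn_ge0// subr_ge0.
Qed.

Lemma measurable_beta_kernel i j : measurable_fun setT (beta_kernel i j).
Proof.
apply: measurable_funM.
  apply: measurable_funM => //; apply: measurable_funX.
  exact: measurable_funB.
rewrite (_ : (fun _ => _) = \1_(`[0, 1]%classic : set R)).
  by apply: measurable_indic.
by apply/funext => x; rewrite indicE mem_setE.
Qed.

Lemma beta_kernelC i j x : beta_kernel i j (1 - x) = beta_kernel j i x.
Proof.
rewrite /beta_kernel subKr [(1 - x) ^+ i * _]mulrC; congr (_ * _%:R).
by rewrite !in_itv/= subr_ge0 andbC; congr (_ && _); lra.
Qed.

(** Moving a point that is more than [t] above the mode [i / (i + j)] down by [t / 2]
    multiplies the kernel by at least [exp ((i + j) t ^ 2)], because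
    [w (1 - w) <= 1 / 4] in the derivative of the log-kernel. *)
Lemma beta_kernel_decay i j (t x : R) : (0 < i + j)%N -> 0 < t ->
  i%:R / (i + j)%:R + t < x ->
  beta_kernel i j x <= expR (- ((i + j)%:R * t ^+ 2)) * beta_kernel i j (x - t / 2).
Proof.
set N := (i + j)%N; set p := _ / _ => N0 t0 px.
have N0' : 0 < N%:R :> R by rewrite ltr0n.
have p0 : 0 <= p by rewrite divr_ge0.
have [|xn] := boolP (x \in `[0, 1]); last first.
  by rewrite {1}/beta_kernel (negbTE xn) mulr0 mulr_ge0 ?expR_ge0 ?beta_kernel_ge0.
rewrite in_itv/= => /andP[x0 x1].
set w := x - t / 2.
have w0 : 0 < w by rewrite /w; lra.
have w1 : w < 1 by rewrite /w; lra.
have w1' : 0 < 1 - w by rewrite subr_gt0.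
have -> : beta_kernel i j x = x ^+ i * (1 - x) ^+ j.
  by rewrite /beta_kernel in_itv/= x0 x1 mulr1.
have -> : beta_kernel i j w = w ^+ i * (1 - w) ^+ j.
  by rewrite /beta_kernel in_itv/= !ltW// mulr1.
set s := t / 2.
have xw : x <= w * expR (s / w).
  have := expR_ge1Dx (s / w); rewrite -(ler_pM2l w0); apply: le_trans.
  by rewrite mulrDr mulr1 mulrC divfK ?gt_eqF// /w /s; lra.
have xw' : 1 - x <= (1 - w) * expR (- (s / (1 - w))).
  have := expR_ge1Dx (- (s / (1 - w))); rewrite -(ler_pM2l w1'); apply: le_trans.
  by rewrite mulrDr mulr1 mulrN mulrC divfK ?gt_eqF// /w /s; lra.
have h1 : x ^+ i <= (w * expR (s / w)) ^+ i by rewrite lerXn2r ?nnegrE// mulr_ge0 ?expR_ge0 ?ltW.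
have h2 : (1 - x) ^+ j <= ((1 - w) * expR (- (s / (1 - w)))) ^+ j.
  by rewrite lerXn2r ?nnegrE ?subr_ge0// mulr_ge0 ?expR_ge0 ?ltW.
apply: (@le_trans _ _ ((w * expR (s / w)) ^+ i * ((1 - w) * expR (- (s / (1 - w)))) ^+ j)).
  by rewrite ler_pM// exprn_ge0// subr_ge0.
rewrite !exprMn -!expRM_natl mulrACA -expRD mulrC ler_wpM2r//.
  by rewrite mulr_ge0// exprn_ge0// ltW.
rewrite ler_expR.
have iE : i%:R = p * N%:R by rewrite /p divfK ?gt_eqF.
have jE : j%:R = (1 - p) * N%:R by rewrite mulrBl mul1r -iE /N natrD; ring.
rewrite iE jE.
have -> : p * N%:R * (s / w) + (1 - p) * N%:R * - (s / (1 - w)) =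
    - (N%:R * s * ((w - p) / (w * (1 - w)))).
  by field; rewrite !gt_eqF.
rewrite lerN2.
have h3 : 4 * s <= (w - p) / (w * (1 - w)).
  rewrite ler_pdivlMr ?mulr_gt0//.
  have : w * (1 - w) <= 1 / 4 by have := sqr_ge0 (w - 1 / 2); lra.
  have s0 : 0 < s by rewrite /s; lra.
  have : s <= w - p by rewrite /w /s; lra.
  by move=> h4 h5; have := ler_wpM2l (ltW s0) h5; lra.
have -> : N%:R * t ^+ 2 = N%:R * s * (4 * s) by rewrite /s; field.
by rewrite ler_wpM2l// mulr_ge0 ?ltW// /s; lra.
Qed.

(** Integrating the decay of the kernel: the part of the kernel beyond the window
    is a translate of the kernel times [exp (- (i + j) t ^ 2)], on either side. *)
Lemma beta_tail i j (t : R) : (0 < i + j)%N -> 0 < t ->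
  (\int[mu]_x (beta_kernel i j x * (t < `|x - i%:R / (i + j)%:R|)%R%:R)%:E <=
   (2 * expR (- ((i + j)%:R * t ^+ 2)))%:E * \int[mu]_x (beta_kernel i j x)%:E)%E.
Proof.
move=> ij0 t0; set p := i%:R / _; set e := expR _.
have mk (s : R) : measurable_fun [set: R] (fun x : R => beta_kernel i j (x + s)).
  by apply: measurableT_comp; [exact: measurable_beta_kernel|exact: measurable_funD].
apply: (@le_trans _ _ (\int[mu]_x (e * beta_kernel i j (x - t / 2) +
    e * beta_kernel i j (x + t / 2))%:E)%E).
  apply: ge0_le_integral_nonmeas => x.
    by rewrite lee_fin mulr_ge0 ?beta_kernel_ge0.
  rewrite lee_fin; have [|_] := ltP t `|x - p|; last first.
    by rewrite mulr0 addr_ge0// mulr_ge0 ?expR_ge0 ?beta_kernel_ge0.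
  rewrite mulr1 lter_normr => /orP[h|h].
    apply: (@le_trans _ _ (e * beta_kernel i j (x - t / 2))).
      by apply: beta_kernel_decay => //; rewrite -/p; lra.
    by rewrite lerDl mulr_ge0 ?expR_ge0 ?beta_kernel_ge0.
  apply: (@le_trans _ _ (e * beta_kernel i j (x + t / 2))).
    have jE : j%:R / (j + i)%:R = 1 - p.
      have Nn0 : (i + j)%:R != 0 :> R by rewrite pnatr_eq0 -lt0n.
      rewrite /p (addnC j i); apply: (mulIf Nn0); rewrite mulrBl !divfK// natrD.
      by ring.
    have ji0 : (0 < j + i)%N by rewrite addnC.
    have xlt : j%:R / (j + i)%:R + t < 1 - x by rewrite jE; lra.
    have D := @beta_kernel_decay j i t (1 - x) ji0 t0 xlt.
    rewrite (addnC j i) -/e beta_kernelC in D.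
    have xE : 1 - x - t / 2 = 1 - (x + t / 2) by ring.
    by rewrite xE beta_kernelC in D.
  by rewrite lerDr mulr_ge0 ?expR_ge0 ?beta_kernel_ge0.
under eq_integral do rewrite EFinD.
rewrite ge0_integralD//; last 4 first.
- by move=> x _; rewrite lee_fin mulr_ge0 ?expR_ge0 ?beta_kernel_ge0.
- by apply/measurable_EFinP/measurable_funM => //; exact: mk.
- by move=> x _; rewrite lee_fin mulr_ge0 ?expR_ge0 ?beta_kernel_ge0.
- by apply/measurable_EFinP/measurable_funM => //; exact: mk.
have sc s : (\int[mu]_x (e * beta_kernel i j (x + s))%:E =
    e%:E * \int[mu]_x (beta_kernel i j x)%:E)%E.
  rewrite ge0_integral_scale; last 3 first.
  - exact: expR_ge0.
  - exact: mk.
  - by move=> x; exact: beta_kernel_ge0.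
  congr (_ * _)%E.
  apply: (@ge0_integral_shift s (fun x => (beta_kernel i j x)%:E)).
    by apply/measurable_EFinP; exact: measurable_beta_kernel.
  by move=> x; rewrite lee_fin beta_kernel_ge0.
rewrite !sc -ge0_muleDl ?lee_fin ?expR_ge0//.
by rewrite -EFinD (_ : e + e = 2 * e)//; ring.
Qed.

End beta_tail.

(** * Independent uniform splits *)

Section uniform_splits.
Context (R : realType).
Notation mu := (@lebesgue_measure R).

Lemma integral_beta11 (f : R -> R) : measurable_fun setT f ->
  (forall x, 0 <= f x) -> (forall x, x \notin `[0, 1] -> f x = 0) ->
  (\int[beta_prob 1 1]_x (f x)%:E = \int[mu]_x (f x)%:E)%E.
Proof.
move=> mf f0 fout.
transitivity (\int[uniform_prob (@ltr01 R)]_x (f x)%:E)%E.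
  by apply: eq_measure_integral => A mA _; exact: (congr1 (fun f => f A) (@beta_prob_uniform R)).
rewrite integral_uniform; [|exact/measurable_EFinP|by move=> x; rewrite lee_fin].
rewrite subr0 invr1 mul1e integral_mkcond; apply: eq_integral => x _.
rewrite patchE; case: ifPn => //; rewrite mem_setE => xn.
by rewrite fout.
Qed.

Lemma beta_kernel_out i j (x : R) : x \notin `[0, 1] -> beta_kernel i j x = 0.
Proof. by rewrite /beta_kernel => /negbTE ->; rewrite mulr0. Qed.

(** Only a window of length [e] centred at one half is used, where both [x] and
    [1 - x] are at least [(1 - e) / 2]. *)
Lemma integral_beta_kernel_ge i j (e : R) : 0 < e -> e <= 1 ->
  ((e * (2^-1 * (1 - e)) ^+ (i + j))%:E <= \int[mu]_x (beta_kernel i j x)%:E)%E.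
Proof.
move=> e0 e1; set u := 2^-1 * (1 - e).
have u0 : 0 <= u by rewrite /u; lra.
pose I : set R := `[u, u + e]%classic.
have mI : measurable I by exact: measurable_itv.
have -> : (e * u ^+ (i + j))%:E = (\int[mu]_x (u ^+ (i + j) * \1_I x)%:E)%E.
  rewrite ge0_integral_scale ?exprn_ge0//.
  rewrite integral_indic//= setIT lebesgue_measure_itv/= lte_fin ltrDl e0.
  by rewrite -EFinB -EFinM; congr EFin; ring.
apply: ge0_le_integral_nonmeas => x; first by rewrite lee_fin mulr_ge0 ?exprn_ge0 ?indicE.
rewrite lee_fin indicE mem_setE; have [|_] := boolP (x \in _); last first.
  by rewrite mulr0 beta_kernel_ge0.
rewrite in_itv/= => /andP[ux xu].
have x1 : x <= 1 - u by apply: le_trans xu _; rewrite /u; lra.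
rewrite mulr1 /beta_kernel in_itv/= (le_trans u0 ux) (_ : x <= 1) ?mulr1; last by lra.
by rewrite exprD ler_pM ?exprn_ge0// lerXn2r ?nnegrE//; lra.
Qed.

(** The likelihood of the splits, where [i k] and [j k] observations go left and
    right at node [k]. *)
Definition tree_lik N (i j : 'I_N -> nat) (V : N.-tuple R) : R :=
  \prod_(k < N) beta_kernel (i k) (j k) (tnth V k).

Lemma tree_lik_ge0 N i j (V : N.-tuple R) : 0 <= tree_lik i j V.
Proof. by apply: prodr_ge0 => k _; exact: beta_kernel_ge0. Qed.

Lemma measurable_tree_lik N i j :
  measurable_fun [set: N.-tuple (measurableTypeR R)] (tree_lik i j).
Proof.
apply: measurable_prod => k _; apply: measurableT_comp.
  exact: measurable_beta_kernel.
exact: measurable_tnth.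
Qed.

Lemma integral_tree_prod N (f : 'I_N -> R -> R) :
  (forall k, measurable_fun setT (f k)) -> (forall k x, 0 <= f k x) ->
  (forall k x, x \notin `[0, 1] -> f k x = 0) ->
  (\int[tuple_measure (beta_prob 1 1) N]_V (\prod_(k < N) f k (tnth V k))%:E =
   \prod_(k < N) \int[mu]_x (f k x)%:E)%E.
Proof.
move=> mf f0 fout.
rewrite (integral_tuple_prod (T := measurableTypeR R))//.
by apply: eq_bigr => k _; apply: integral_beta11 => //; exact: fout.
Qed.

(** A node visited by no observation has no empirical proportion, hence the first
    condition. *)
Definition split_off N (i j : 'I_N -> nat) (D : R) (V : N.-tuple R) (k : 'I_N) : bool :=
  (0 < i k + j k)%N &&
  (Num.sqrt (D / (i k + j k)%:R) < `|tnth V k - (i k)%:R / (i k + j k)%:R|).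

Lemma measurable_split_off N (i j : 'I_N -> nat) (D : R) :
  measurable_fun [set: N.-tuple (measurableTypeR R)]
    (fun V => [exists k, split_off i j D V k]%:R : R).
Proof.
apply: measurable_exists_indic => k; rewrite /split_off.
case: (0 < i k + j k)%N => //=; apply: measurable_ltr_indic.
apply: measurableT_comp => //; apply: measurable_funB => //.
exact: measurable_tnth.
Qed.

(** The splits are independent under the posterior, so one bad split is
    controlled by its own Beta tail. *)
Lemma split_concentration N (i j : 'I_N -> nat) (D : R) : 0 < D ->
  (\int[tuple_measure (beta_prob 1 1) N]_V
     (tree_lik i j V * [exists k, split_off i j D V k]%:R)%:E <=
   (2 * N%:R * expR (- D))%:E *
   \int[tuple_measure (beta_prob 1 1) N]_V (tree_lik i j V)%:E)%E.
Proof.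
move=> D0.
pose c k : R := Num.sqrt (D / (i k + j k)%:R).
pose p k : R := (i k)%:R / (i k + j k)%:R.
pose f (k l : 'I_N) (x : R) : R := beta_kernel (i l) (j l) x *
  (if l == k then ((0 < i k + j k)%N && (c k < `|x - p k|))%:R else 1).
have mb l : measurable_fun setT (@beta_kernel R (i l) (j l)) by exact: measurable_beta_kernel.
have mf k l : measurable_fun setT (f k l).
  rewrite /f; case: (l == k); apply: measurable_funM => //.
  case: (0 < i k + j k)%N => //=.
  apply: measurable_ltr_indic; apply: measurableT_comp => //.
  exact: measurable_funB.
have f0 k l x : 0 <= f k l x.
  by rewrite mulr_ge0 ?beta_kernel_ge0//; case: ifP.
have fout k l x : x \notin `[0, 1] -> f k l x = 0.
  by move=> x01; rewrite /f beta_kernel_out// mul0r.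
have fE k V : \prod_(l < N) f k l (tnth V l) = tree_lik i j V * (split_off i j D V k)%:R.
  rewrite big_split/=; congr (_ * _).
  by rewrite (bigD1 k)//= eqxx big1 ?mulr1// => l /negbTE ->.
apply: (@le_trans _ _ (\int[tuple_measure (beta_prob 1 1) N]_V
    (\sum_(k < N) (\prod_(l < N) f k l (tnth V l))%:E))%E).
  apply: ge0_le_integral_nonmeas => V; first by rewrite lee_fin mulr_ge0 ?tree_lik_ge0.
  rewrite sumEFin lee_fin; under eq_bigr do rewrite fE.
  have [/existsP[k kV]|_] := boolP [exists k, split_off i j D V k]; last first.
    by rewrite mulr0 sumr_ge0// => k _; rewrite mulr_ge0 ?tree_lik_ge0.
  rewrite (bigD1 k)//= kV lerDl sumr_ge0// => l _.
  by rewrite mulr_ge0 ?tree_lik_ge0.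
rewrite ge0_integral_sum//; last 2 first.
- move=> k; apply/measurable_EFinP.
  apply: (@measurable_prod _ _ _ _ _ _ (fun l (V : N.-tuple R) => f k l (tnth V l))) => l _.
  exact: (measurableT_comp (mf k l) (measurable_tnth l)).
- by move=> k V _; rewrite lee_fin prodr_ge0.
have Elik : (\int[tuple_measure (beta_prob 1 1) N]_V (tree_lik i j V)%:E =
   \prod_(l < N) \int[mu]_x (beta_kernel (i l) (j l) x)%:E)%E.
  by apply: integral_tree_prod => //; [move=> k x; exact: beta_kernel_ge0|
    move=> k x; exact: beta_kernel_out].
set I := (\int[tuple_measure (beta_prob 1 1) N]_V (tree_lik i j V)%:E)%E in Elik *.
have I0 : (0 <= I)%E by apply: integral_ge0 => V _; rewrite lee_fin tree_lik_ge0.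
apply: (@le_trans _ _ (\sum_(k < N) (2 * expR (- D))%:E * I)%E); last first.
  rewrite -ge0_sume_distrl; last by move=> k _; rewrite lee_fin mulr_ge0 ?expR_ge0.
  rewrite sumEFin sumr_const card_ord.
  have -> : 2 * N%:R * expR (- D) = (2 * expR (- D)) *+ N.
    by rewrite -[RHS]mulr_natr mulrAC.
  by [].
apply: lee_sum => k _; rewrite integral_tree_prod//; last exact: fout.
rewrite (bigD1 k)//=.
have -> : (\prod_(l < N | l != k) \int[mu]_x (f k l x)%:E =
   \prod_(l < N | l != k) \int[mu]_x (beta_kernel (i l) (j l) x)%:E)%E.
  apply: eq_bigr => l /negbTE lk; apply: eq_integral => x _.
  by rewrite /f lk mulr1.
rewrite Elik [X in (_ <= _ * X)%E](bigD1 k)//= muleA; apply: lee_wpmul2r.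
  by apply: prode_ge0 => l _; apply: integral_ge0 => x _; rewrite lee_fin beta_kernel_ge0.
have [N0|] := ltnP 0 (i k + j k); last first.
  rewrite leqn0 => /eqP N0.
  under eq_integral do rewrite /f eqxx N0 ltnn /= mulr0.
  rewrite integral0 mule_ge0 ?lee_fin ?mulr_ge0 ?expR_ge0//.
  by apply: integral_ge0 => x _; rewrite lee_fin beta_kernel_ge0.
have N0' : (0 : R) < (i k + j k)%:R by rewrite ltr0n.
have ck0 : 0 < c k by rewrite sqrtr_gt0 divr_gt0.
have c2 : (i k + j k)%:R * c k ^+ 2 = D.
  by rewrite sqr_sqrtr ?ltW ?divr_gt0// mulrC divfK ?gt_eqF.
have := beta_tail N0 ck0; rewrite c2.
apply: le_trans; rewrite le_eqVlt; apply/orP; left; apply/eqP.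
by apply: eq_integral => x _; rewrite /f eqxx N0.
Qed.

End uniform_splits.

(** * The dyadic tree *)

Local Open Scope nat_scope.

Lemma half_lt_exp k l : k < 2 ^ l.+1 -> k./2 < 2 ^ l.
Proof. by rewrite expnS; lia. Qed.

Lemma node_lt L l k : l < L -> k < 2 ^ l -> 2 ^ l - 1 + k < 2 ^ L - 1.
Proof.
move=> lL kl; have le2 : 2 ^ l.+1 <= 2 ^ L by rewrite leq_exp2l.
by move: le2; rewrite expnS; lia.
Qed.

Section dyadic_exponents.

(** Whether the path from the root to cell [k] of level [l] goes left (resp.
    right) at the node with breadth-first index [j]; as a natural number, so that
    it can serve as an exponent and be summed over observations. *)
Fixpoint left_turn (l k j : nat) : nat :=
  if l is l'.+1 then ((j == 2 ^ l' - 1 + k./2) && ~~ odd k) + left_turn l' k./2 j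
  else 0.

Fixpoint right_turn (l k j : nat) : nat :=
  if l is l'.+1 then ((j == 2 ^ l' - 1 + k./2) && odd k) + right_turn l' k./2 j
  else 0.

Lemma turn_sum l k N : k < 2 ^ l -> 2 ^ l - 1 <= N ->
  \sum_(j < N) (left_turn l k j + right_turn l k j) = l.
Proof.
elim: l k => [|l IH] k kl lN; first by rewrite big1.
have k2 : k./2 < 2 ^ l by move: kl; rewrite expnS; lia.
have pl : 0 < 2 ^ l by rewrite expn_gt0.
have e2 : 2 ^ l.+1 = 2 * 2 ^ l by rewrite expnS.
have jN : 2 ^ l - 1 + k./2 < N by lia.
rewrite (eq_bigr (fun j : 'I_N => (j == Ordinal jN : nat) +
    (left_turn l k./2 j + right_turn l k./2 j))); last first.
  move=> j _ /=; rewrite -val_eqE /=.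
  by case: (_ == _); case: (odd k); lia.
rewrite big_split/= IH//; last by lia.
rewrite (bigD1 (Ordinal jN))//= eqxx big1 ?addn0//.
by move=> i /negbTE ->.
Qed.

Lemma turn_eq0 l k j : k < 2 ^ l -> 2 ^ l - 1 <= j ->
  (left_turn l k j = 0) * (right_turn l k j = 0).
Proof.
elim: l k => [//|l IH] k kl lj /=.
have e2 : 2 ^ l.+1 = 2 * 2 ^ l by rewrite expnS.
have pl : 0 < 2 ^ l by rewrite expn_gt0.
have [-> ->] : (left_turn l k./2 j = 0) * (right_turn l k./2 j = 0) by apply: IH; lia.
by case: eqP => //; lia.
Qed.

(** The cell [k] of level [L] lies in the cell [k %/ 2 ^ (L - l)] of level [l], so
    its path is read off the binary expansion of [k]. *)
Lemma turnE L k l q : k < 2 ^ L -> l < L -> q < 2 ^ l ->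
  (left_turn L k (2 ^ l - 1 + q) = (k %/ 2 ^ (L - l.+1) == 2 * q)) *
  (right_turn L k (2 ^ l - 1 + q) = (k %/ 2 ^ (L - l.+1) == (2 * q).+1)).
Proof.
elim: L k => [//|L IH] k kL lL ql.
have e2 : 2 ^ L.+1 = 2 * 2 ^ L by rewrite expnS.
have pl : 0 < 2 ^ l by rewrite expn_gt0.
have [lE|lL'] := eqVneq l L.
  subst l.
  rewrite subnn expn0 divn1 /= !turn_eq0; try lia.
  by rewrite eqn_add2l !addn0; split; congr nat_of_bool; lia.
have lL2 : l < L by lia.
have le2 : 2 * 2 ^ l <= 2 ^ L by rewrite -expnS leq_exp2l.
have -> : L.+1 - l.+1 = (L - l.+1).+1 by lia.
rewrite /= (_ : (_ == _) = false); last by apply/eqP; lia.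
rewrite !add0n expnS divnMA divn2.
by apply: IH => //; lia.
Qed.

Context (R : realType).

Lemma cell_massE N (V : N.-tuple R) l k : k < 2 ^ l -> 2 ^ l - 1 <= N ->
  cell_mass V l k = (\prod_(j < N)
    (tnth V j ^+ left_turn l k j * (1 - tnth V j) ^+ right_turn l k j))%R.
Proof.
elim: l k => [|l IH] k kl lN; first by rewrite big1// => j _; rewrite !expr0 mulr1.
have k2 : k./2 < 2 ^ l by move: kl; rewrite expnS; lia.
have pl : 0 < 2 ^ l by rewrite expn_gt0.
have e2 : 2 ^ l.+1 = 2 * 2 ^ l by rewrite expnS.
have jN : 2 ^ l - 1 + k./2 < N by lia.
rewrite /= IH; [|lia|lia].
under [in RHS]eq_bigr do rewrite !exprD mulrACA.
rewrite [in RHS]big_split/=; congr (_ * _)%R.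
rewrite (bigD1 (Ordinal jN))//= eqxx/= big1 ?mulr1; last first.
  by move=> i; rewrite -val_eqE/= => /negbTE ->; rewrite !expr0 mulr1.
rewrite /split_var (tnth_nth 0%R)/=.
by case: (odd k); rewrite /= ?expr1 ?expr0 ?mul1r ?mulr1.
Qed.

End dyadic_exponents.

Section cell_counts.
Context (n : nat) (kappa : 'I_n -> nat) (L : nat).

(** Observation [i] lies in cell [kappa i] of level [L], hence in the cell
    [kappa i %/ 2 ^ (L - l)] of level [l]. *)
Definition cell_count (l q : nat) : nat :=
  \sum_(i < n) (kappa i %/ 2 ^ (L - l) == q).

Definition left_count (j : nat) : nat := \sum_(i < n) left_turn L (kappa i) j.
Definition right_count (j : nat) : nat := \sum_(i < n) right_turn L (kappa i) j.

Lemma cell_count_split l q : l < L ->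
  cell_count l q = cell_count l.+1 (2 * q) + cell_count l.+1 (2 * q).+1.
Proof.
move=> lL; rewrite -big_split/=; apply: eq_bigr => i _.
have -> : L - l = (L - l.+1).+1 by lia.
rewrite expnSr divnMA; set x := _ %/ 2 ^ _.
by rewrite divn2; case: eqP; case: eqP; case: eqP; lia.
Qed.

Hypothesis kappaL : forall i, kappa i < 2 ^ L.

Lemma left_countE l q : l < L -> q < 2 ^ l ->
  left_count (2 ^ l - 1 + q) = cell_count l.+1 (2 * q).
Proof. by move=> lL ql; apply: eq_bigr => i _; rewrite turnE. Qed.

Lemma right_countE l q : l < L -> q < 2 ^ l ->
  right_count (2 ^ l - 1 + q) = cell_count l.+1 (2 * q).+1.
Proof. by move=> lL ql; apply: eq_bigr => i _; rewrite turnE. Qed.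

Lemma cell_count_root : cell_count 0 0 = n.
Proof.
rewrite /cell_count (eq_bigr (fun=> 1)) ?sum1_card ?card_ord// => i _.
by rewrite subn0 divn_small.
Qed.

(** Each observation passes through exactly one node of each level. *)
Lemma turn_count : \sum_(j < 2 ^ L - 1) (left_count j + right_count j) = n * L.
Proof.
rewrite /left_count /right_count.
under eq_bigr do rewrite -big_split/=.
rewrite exchange_big/= (eq_bigr (fun=> L)) => [|i _]; last by rewrite turn_sum.
by rewrite sum_nat_const card_ord.
Qed.

End cell_counts.
Local Open Scope ring_scope.

Section split_cube.
Context (R : realType).

Definition in_cube N (W : N.-tuple R) : bool := [forall j, tnth W j \in `[0, 1]].

Lemma cell_mass_ge0 N (W : N.-tuple R) l k : in_cube W -> (k < 2 ^ l)%N ->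
  (2 ^ l - 1 <= N)%N -> 0 <= cell_mass W l k.
Proof.
move=> /forallP cW kl lN; rewrite cell_massE//; apply: prodr_ge0 => j _.
have := cW j; rewrite in_itv/= => /andP[w0 w1].
by rewrite mulr_ge0 ?exprn_ge0 ?subr_ge0.
Qed.

Lemma measurable_cell_mass d (T : measurableType d) N
    (W : T -> N.-tuple (measurableTypeR R)) l k : (k < 2 ^ l)%N -> (2 ^ l - 1 <= N)%N ->
  measurable_fun [set: T] W -> measurable_fun [set: T] (fun t => cell_mass (W t) l k).
Proof.
move=> kl lN mW; under eq_fun do rewrite cell_massE//.
apply: measurable_prod => j _; have mt := measurable_tnth_comp j mW.
by apply: measurable_funM; apply: measurable_funX => //; exact: measurable_funB.
Qed.

Lemma sum_cell_mass N (W : N.-tuple R) l : \sum_(k < 2 ^ l) cell_mass W l k = 1.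
Proof.
elim: l => [|l IH]; first by rewrite expn0 big_ord_recl big_ord0 addr0.
have pairs (F : nat -> R) p : \sum_(k < 2 * p) F k = \sum_(q < p) (F (2 * q)%N + F (2 * q).+1).
  elim: p => [|p IHp]; first by rewrite muln0 !big_ord0.
  by rewrite mulnS add2n !big_ord_recr/= IHp addrA.
rewrite expnS (pairs (fun k => cell_mass W l.+1 k)) -[RHS]IH.
apply: eq_bigr => q _.
rewrite /= (_ : (2 * q)./2 = q); last by lia.
rewrite (_ : uphalf (2 * q) = q); last by lia.
rewrite (_ : odd (2 * q) = false); last by lia.
by rewrite /=; ring.
Qed.

Lemma measurable_in_cube d (T : measurableType d) N
    (W : T -> N.-tuple (measurableTypeR R)) : measurable_fun [set: T] W ->
  measurable_fun [set: T] (fun t => (in_cube (W t))%:R : R).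
Proof.
move=> mW; rewrite (_ : (fun _ => _) = fun t =>
    \prod_(j < N) \1_(`[0, 1]%classic : set R) (tnth (W t) j)).
  apply: measurable_prod => j _; apply: measurableT_comp; last exact: measurable_tnth_comp.
  by apply: measurable_indic; exact: measurable_itv.
apply/funext => t; have [/forallP h|/forallPn[j hj]] := boolP (in_cube (W t)).
  by rewrite big1// => j _; rewrite indicE mem_setE h.
by rewrite (bigD1 j)//= indicE mem_setE (negbTE hj) mul0r.
Qed.

End split_cube.

(** * Dyadic cells of an interval *)

Section dyadic_cells.
Context (R : realType) (a b : R).
Hypothesis ab : a < b.

Definition cell_left (L k : nat) : R := a + (b - a) * k%:R / 2 ^+ L.

Definition cell_width (L : nat) : R := (b - a) / 2 ^+ L.

Let pow2_gt0 L : (0 : R) < 2 ^+ L. Proof. by rewrite exprn_gt0. Qed.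

Let ba0 : 0 < b - a. Proof. by rewrite subr_gt0. Qed.

Lemma cell_width_gt0 L : 0 < cell_width L.
Proof. by rewrite divr_gt0. Qed.

Lemma cell_leftS L k : cell_left L k.+1 = cell_left L k + cell_width L.
Proof. by rewrite /cell_left /cell_width -natr1; ring. Qed.

Lemma cell_left_last L k : k.+1 = (2 ^ L)%N -> cell_left L k + cell_width L = b.
Proof.
move=> kL; rewrite -cell_leftS /cell_left kL natrX; field.
by rewrite expf_neq0.
Qed.

Lemma cell_leftE L k : cell_left L k = a + cell_width L * k%:R.
Proof. by rewrite /cell_left /cell_width mulrAC. Qed.

Lemma dyadic_cellE L k : dyadic_cell a b L k =
  if k.+1 == (2 ^ L)%N then `[cell_left L k, cell_left L k + cell_width L]
  else `[cell_left L k, cell_left L k + cell_width L[.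
Proof.
rewrite /dyadic_cell; case: eqP => kL.
  have h : b - (b - a) / 2 ^+ L = cell_left L k.
    by apply: (addIr (cell_width L)); rewrite subrK cell_left_last.
  by rewrite cell_left_last// h.
by rewrite -/(cell_left L k) -/(cell_left L k.+1) cell_leftS.
Qed.

Lemma mem_dyadic_cell L k x : x \in dyadic_cell a b L k ->
  cell_left L k <= x <= cell_left L k + cell_width L.
Proof.
by rewrite dyadic_cellE; case: ifP => _; rewrite in_itv/= => /andP[-> h]//=; exact: ltW.
Qed.

Lemma interior_dyadic_cell L k x :
  cell_left L k < x -> x < cell_left L k + cell_width L -> x \in dyadic_cell a b L k.
Proof.
by move=> h1 h2; rewrite dyadic_cellE; case: ifP => _; rewrite in_itv/= !ltW.
Qed.

Lemma cell_left_ge L k : a <= cell_left L k.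
Proof. by rewrite cell_leftE lerDl mulr_ge0// ltW// cell_width_gt0. Qed.

Lemma cell_right_le L k : (k < 2 ^ L)%N -> cell_left L k + cell_width L <= b.
Proof.
move=> kL; have pL : (0 < 2 ^ L)%N by rewrite expn_gt0.
have h : (2 ^ L).-1.+1 = (2 ^ L)%N by rewrite prednK.
rewrite -(cell_left_last h) lerD2r !cell_leftE lerD2l ler_pM2l ?cell_width_gt0//.
by rewrite ler_nat -ltnS h.
Qed.

Lemma cell_left_in L k : (k < 2 ^ L)%N -> cell_left L k \in `[a, b].
Proof.
move=> kL; rewrite in_itv/= cell_left_ge/= (le_trans _ (cell_right_le kL))//.
by rewrite lerDl ltW// cell_width_gt0.
Qed.

Lemma dyadic_cell_sub L k x : (k < 2 ^ L)%N -> x \in dyadic_cell a b L k -> x \in `[a, b].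
Proof.
move=> kL /mem_dyadic_cell/andP[x1 x2]; rewrite in_itv/= (le_trans (cell_left_ge L k) x1)/=.
exact: le_trans x2 (cell_right_le kL).
Qed.

Lemma dyadic_cell_inj L k k' x : (k < 2 ^ L)%N -> (k' < 2 ^ L)%N ->
  x \in dyadic_cell a b L k -> x \in dyadic_cell a b L k' -> k = k'.
Proof.
wlog kk : k k' / (k <= k')%N.
  move=> W kL kL' x1 x2; have [h|/ltnW h] := leqP k k'; first exact: W.
  by apply/esym; exact: W.
move=> kL kL' x1 x2; apply/eqP; rewrite eqn_leq kk/= leqNgt; apply/negP => lt.
move: x1; rewrite dyadic_cellE ifF; last by apply/eqP; lia.
rewrite in_itv/= => /andP[_]; rewrite -cell_leftS ltNge => /negP; apply.
have /andP[x3 _] := mem_dyadic_cell x2; apply: le_trans x3.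
by rewrite !cell_leftE lerD2l ler_pM2l ?ler_nat// cell_width_gt0.
Qed.

Lemma dyadic_cell_cover L x : x \in `[a, b] ->
  exists2 k, (k < 2 ^ L)%N & x \in dyadic_cell a b L k.
Proof.
rewrite in_itv/= => /andP[ax xb].
have pL : (0 < 2 ^ L)%N by rewrite expn_gt0.
have w0 := cell_width_gt0 L.
pose t := (x - a) / cell_width L.
have t0 : 0 <= t by rewrite divr_ge0 ?subr_ge0// ltW.
have xt : x = a + cell_width L * t by rewrite /t mulrC divfK ?gt_eqF// addrC subrK.
have [tl tu] : (Num.truncn t)%:R <= t /\ t < (Num.truncn t).+1%:R.
  by have /andP[-> ->] := truncn_itv t0.
have [h|h] := ltnP (Num.truncn t).+1 (2 ^ L).
  exists (Num.truncn t); first exact: ltnW.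
  rewrite dyadic_cellE ifF; last by apply/eqP; lia.
  rewrite in_itv/= -cell_leftS !cell_leftE xt lerD2l ltrD2l.
  by rewrite ler_pM2l// ltr_pM2l// tl tu.
have h1 : (2 ^ L).-1.+1 = (2 ^ L)%N by rewrite prednK.
exists (2 ^ L).-1; first by rewrite h1.
rewrite dyadic_cellE h1 eqxx in_itv/= cell_left_last// xb andbT cell_leftE xt lerD2l.
rewrite ler_pM2l//; apply: le_trans tl; rewrite ler_nat; lia.
Qed.

Definition cell_index (L : nat) (x : R) : nat :=
  if [pick k : 'I_(2 ^ L) | x \in dyadic_cell a b L k] is Some k then k else 0.

Lemma cell_indexP L x : x \in `[a, b] ->
  (cell_index L x < 2 ^ L)%N /\ x \in dyadic_cell a b L (cell_index L x).
Proof.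
move=> /(@dyadic_cell_cover L)[k kL xk]; rewrite /cell_index.
case: pickP => [//|/(_ (Ordinal kL))/=]; by rewrite xk.
Qed.

Lemma cell_index_eq L k x : (k < 2 ^ L)%N -> x \in dyadic_cell a b L k ->
  cell_index L x = k.
Proof.
move=> kL xk; have [h1 h2] := cell_indexP L (dyadic_cell_sub kL xk).
exact: dyadic_cell_inj h1 kL h2 xk.
Qed.

Section density.
Context (L : nat) (V : (2 ^ L - 1).-tuple R).

Lemma polya_density_in x : x \in `[a, b] ->
  polya_density a b V x = 2 ^+ L / (b - a) * cell_mass V L (cell_index L x).
Proof.
move=> /(cell_indexP L)[kL xk]; rewrite /polya_density (bigD1 (Ordinal kL))//=.
rewrite xk mulr1 big1 ?addr0// => k kn.
have [xk'|_] := boolP (x \in dyadic_cell a b L k); last by rewrite mulr0.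
by case/eqP: kn; apply: val_inj => /=; rewrite (cell_index_eq (ltn_ord k) xk').
Qed.

Lemma polya_density_out x : x \notin `[a, b] -> polya_density a b V x = 0.
Proof.
move=> xn; rewrite /polya_density big1// => k _.
have [xk'|_] := boolP (x \in dyadic_cell a b L k); last by rewrite mulr0.
by move: xn; rewrite (dyadic_cell_sub (ltn_ord k) xk').
Qed.

Lemma polya_density_ge0 x : in_cube V -> 0 <= polya_density a b V x.
Proof.
move=> cV; have [xin|xout] := boolP (x \in `[a, b]); last by rewrite polya_density_out.
have [kL _] := cell_indexP L xin.
rewrite polya_density_in//; apply: mulr_ge0; first by rewrite divr_ge0 ?ltW.
exact: cell_mass_ge0.
Qed.

Lemma measurable_polya_density d (T : measurableType d)
    (W : T -> (2 ^ L - 1).-tuple (measurableTypeR R)) (x : T -> R) :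
  measurable_fun [set: T] W -> measurable_fun [set: T] x ->
  measurable_fun [set: T] (fun t => polya_density a b (W t) (x t)).
Proof.
move=> mW mx; apply: measurable_sum => k; apply: measurable_funM.
  by apply: measurable_funM => //; exact: measurable_cell_mass.
rewrite (_ : (fun _ => _) = \1_([set` dyadic_cell a b L k] : set R) \o x).
  by apply: measurableT_comp => //; apply: measurable_indic; exact: measurable_itv.
by apply/funext => t /=; rewrite indicE mem_setE.
Qed.

End density.
End dyadic_cells.

(** * The working model *)

Section almost_everywhere.
Context d (T : measurableType d) (R : realType).
Variable mu : {measure set T -> \bar R}.
Import HBNNSimple.
Local Open Scope ereal_scope.

(** The simple functions below [f] may be set to 0 on a null set without changing
    their integrals. *)
Lemma ge0_ae_le_integral (N : set T) (f g : T -> \bar R) :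
  measurable N -> mu N = 0 ->
  (forall x, 0 <= f x) -> (forall x, 0 <= g x) -> (forall x, ~ N x -> f x <= g x) ->
  \int[mu]_x f x <= \int[mu]_x g x.
Proof.
move=> mN N0 f0 g0 fg; rewrite [leLHS]ge0_integralTE//.
apply: ge_ereal_sup => _ [h hf <-].
rewrite -(@integralT_nnsfun _ _ _ mu h).
have mh : measurable_fun setT (EFin \o h) by exact/measurable_EFinP.
have h0 x : setT x -> 0 <= (EFin \o h) x by move=> _; rewrite lee_fin.
rewrite (ge0_negligible_integral mN measurableT mh h0 N0).
rewrite integral_mkcond; apply: ge0_le_integral_nonmeas => x.
  by apply: erestrict_ge0 => y _; rewrite lee_fin.
rewrite patchE; case: ifPn => // /set_mem[_ xN].
exact: le_trans (hf x) (fg x xN).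
Qed.

Lemma ae_eq_integral_nonmeas (N : set T) (f g : T -> \bar R) :
  measurable N -> mu N = 0 -> (forall x, ~ N x -> f x = g x) ->
  \int[mu]_x f x = \int[mu]_x g x.
Proof.
move=> mN N0 fg.
have nneg (u v : T -> \bar R) : (forall x, 0 <= u x) -> (forall x, 0 <= v x) ->
    (forall x, ~ N x -> u x = v x) -> \int[mu]_x u x = \int[mu]_x v x.
  move=> u0 v0 uv; apply/eqP; rewrite eq_le; apply/andP; split.
    by apply: (ge0_ae_le_integral mN N0) => // x /uv ->.
  by apply: (ge0_ae_le_integral mN N0) => // x /uv ->.
rewrite integralE [RHS]integralE; congr (_ - _).
  apply: nneg; [exact: funepos_ge0|exact: funepos_ge0|].
  by move=> x /fg h; rewrite !funeposE h.
apply: nneg; [exact: funeneg_ge0|exact: funeneg_ge0|].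
by move=> x /fg h; rewrite !funenegE h.
Qed.

End almost_everywhere.

Section working_model.
Context (R : realType) (a b : R) (L n : nat).
Hypothesis ab : a < b.
Notation N := (2 ^ L - 1)%N.
Notation splits := (N.-tuple (measurableTypeR R)).
Notation obs := (n.-tuple (measurableTypeR R)).

Lemma split_prior_setT : split_prior R L [set: splits] = 1%E.
Proof.
have := tuple_measure_box (beta_prob 1 1) (fun _ : 'I_N => @measurableT _ (measurableTypeR R)).
rewrite big1 => [<-|i _]; last exact: probability_setT.
by congr (tuple_measure _ _ _); apply/seteqP; split.
Qed.

Let cube : set splits := [set V | in_cube V].

Let measurable_cube : measurable cube.
Proof.
have -> : cube = (fun V : splits => (in_cube V)%:R : R) @^-1` [set 1].
  apply/seteqP; split => V /=; rewrite /cube /=; first by move=> ->.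
  by case: in_cube => // /esym/eqP; rewrite oner_eq0.
by rewrite -[X in measurable X]setTI; apply: measurable_in_cube.
Qed.

Lemma split_prior_cubeC : measurable (~` cube) /\ split_prior R L (~` cube) = 0%E.
Proof.
split; first exact: measurableC.
have c1 : split_prior R L cube = 1%E.
  have mI (i : 'I_N) : measurable (`[0, 1]%classic : set (measurableTypeR R)).
    exact: measurable_itv.
  have := tuple_measure_box (beta_prob 1 1) mI.
  rewrite big1 => [<-|i _]; last exact: beta_prob01.
  congr (tuple_measure _ _ _); apply/seteqP; split => V /=.
    by move=> /forallP h i; exact: h.
  by move=> h; apply/forallP => i; exact: h.
have h := @measureU _ _ _ (split_prior R L) cube (~` cube) measurable_cube
  (measurableC measurable_cube) (setICr cube).
rewrite setUCr in h.
have {h} : (1 = 1 + split_prior R L (~` cube))%E := etrans (esym split_prior_setT)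
  (etrans h (congr1 (fun x => x + split_prior R L (~` cube))%E c1)).
case: (split_prior R L (~` cube)) => [r| |]//.
by move=> /(congr1 fine) /= h; congr EFin; lra.
Qed.

(** The likelihood of the observations given the splits, set to 0 outside the
    support of the prior so as to be nonnegative everywhere. *)
Definition lik (V : splits) (beta : obs) : R :=
  (in_cube V)%:R * \prod_(i < n) polya_density a b V (tnth beta i).

Lemma lik_ge0 V beta : 0 <= lik V beta.
Proof.
rewrite /lik; have [cV|_] := boolP (in_cube V); last by rewrite mul0r.
by rewrite mul1r prodr_ge0// => i _; exact: polya_density_ge0.
Qed.

Lemma measurable_lik d (T : measurableType d) (V : T -> splits) (beta : T -> obs) :
  measurable_fun [set: T] V -> measurable_fun [set: T] beta ->
  measurable_fun [set: T] (fun t => lik (V t) (beta t)).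
Proof.
move=> mV mb; apply: measurable_funM; first exact: measurable_in_cube.
apply: measurable_prod => i _; apply: measurable_polya_density => //.
exact: measurable_tnth_comp.
Qed.

Definition in_box (beta : obs) : bool := [forall i, tnth beta i \in `[a, b]].

Definition index_of (beta : obs) (i : 'I_n) : nat := cell_index a b L (tnth beta i).

Lemma index_of_lt beta i : in_box beta -> (index_of beta i < 2 ^ L)%N.
Proof. by move=> /forallP h; have [] := cell_indexP ab L (h i). Qed.

Lemma lik_out V beta : ~~ in_box beta -> lik V beta = 0.
Proof.
move=> /forallPn[i hi].
by rewrite /lik (bigD1 i)//= polya_density_out// mul0r mulr0.
Qed.

(** Given the observations, the likelihood is a product of Beta kernels whose
    exponents are the numbers of left and right turns: this is the conjugacy of
    the prior. *)
Lemma lik_in V beta : in_box beta -> lik V beta = (2 ^+ L / (b - a)) ^+ n *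
  tree_lik (fun j : 'I_N => left_count (index_of beta) L j)
           (fun j : 'I_N => right_count (index_of beta) L j) V.
Proof.
move=> bb; rewrite /lik /tree_lik.
have [cV|/forallPn[j hj]] := boolP (in_cube V); last first.
  by rewrite mul0r (bigD1 j)//= beta_kernel_out// mul0r mulr0.
rewrite mul1r.
under eq_bigr => i _.
  rewrite polya_density_in//; last by move/forallP: bb.
  rewrite (@cell_massE _ N)//; last exact: index_of_lt.
  over.
rewrite big_split/= prodr_const card_ord; congr (_ * _).
rewrite exchange_big/=; apply: eq_bigr => j _.
rewrite /beta_kernel (forallP cV j) mulr1 big_split/=.
by rewrite !prodrXr.
Qed.

Notation prior := (split_prior R L).

(** For [chi = 1] the density of the observations under the working model. *)
Definition marginal (chi : splits -> R) (beta : obs) : \bar R :=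
  (\int[prior]_V (lik V beta * chi V)%:E)%E.

Section marginal.
Context (chi : splits -> R).
Hypothesis mchi : measurable_fun [set: splits] chi.
Hypothesis chi0 : forall V, 0 <= chi V.

Let mlc : measurable_fun [set: splits * obs] (fun z => (lik z.1 z.2 * chi z.1)%:E).
Proof.
apply/measurable_EFinP; apply: measurable_funM.
  by apply: measurable_lik; [exact: measurable_fst|exact: measurable_snd].
by apply: measurableT_comp => //; exact: measurable_fst.
Qed.

Lemma marginal_ge0 beta : (0 <= marginal chi beta)%E.
Proof. by apply: integral_ge0 => V _; rewrite lee_fin mulr_ge0 ?lik_ge0. Qed.

Lemma measurable_marginal : measurable_fun [set: obs] (marginal chi).
Proof.
apply: (@measurable_fun_fubini_tonelli_G _ _ _ _ _ prior
  (fun z : splits * obs => (lik z.1 z.2 * chi z.1)%:E)) => //.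
by move=> z; rewrite lee_fin mulr_ge0 ?lik_ge0.
Qed.

Lemma integral_marginal (G : obs -> R) : measurable_fun [set: obs] G ->
  (forall beta, 0 <= G beta) ->
  (\int[prior]_V ((chi V)%:E * \int[lebesgue_tuple R n]_beta (lik V beta * G beta)%:E) =
   \int[lebesgue_tuple R n]_beta ((G beta)%:E * marginal chi beta))%E.
Proof.
move=> mG G0.
have ml (V : splits) : measurable_fun [set: obs] (lik V).
  by apply: (measurable_lik (V := fun=> V)) => //; exact: measurable_id.
transitivity (\int[prior]_V \int[lebesgue_tuple R n]_beta
    (chi V * (lik V beta * G beta))%:E)%E.
  apply: eq_integral => V _; rewrite ge0_integral_scale//.
    by apply: measurable_funM; [exact: ml|exact: mG].
  by move=> beta; rewrite mulr_ge0 ?lik_ge0.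
rewrite tonelli_swap; last 2 first.
- apply/measurable_EFinP; apply: measurable_funM.
    by apply: measurableT_comp => //; exact: measurable_fst.
  apply: measurable_funM; last by apply: measurableT_comp => //; exact: measurable_snd.
  by apply: measurable_lik; [exact: measurable_fst|exact: measurable_snd].
- by move=> V beta; rewrite lee_fin mulr_ge0// mulr_ge0 ?lik_ge0.
apply: eq_integral => beta _; rewrite /marginal -ge0_integral_scale//.
- by apply: eq_integral => V _; congr EFin; ring.
- apply: measurable_funM => //.
  by apply: (measurable_lik (beta := fun=> beta)) => //; exact: measurable_id.
- by move=> V; rewrite mulr_ge0 ?lik_ge0.
Qed.

End marginal.

End working_model.

(** * Bounds on the marginal density of the observations *)

Section marginal_bounds.
Context (R : realType) (a b : R) (L n : nat).
Hypothesis ab : a < b.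
Notation N := (2 ^ L - 1)%N.
Notation splits := (N.-tuple (measurableTypeR R)).
Notation obs := (n.-tuple (measurableTypeR R)).
Notation prior := (split_prior R L).

Notation mixture := (@marginal R a b L n (fun=> 1)).

Let ba0 : 0 < b - a. Proof. by rewrite subr_gt0. Qed.

Lemma integral_polya_density (V : N.-tuple R) : in_cube V ->
  (\int[@lebesgue_measure R]_x (polya_density a b V x)%:E = 1)%E.
Proof.
move=> cV; rewrite /polya_density.
under eq_integral do rewrite -sumEFin.
have c0 k : (k < 2 ^ L)%N -> 0 <= 2 ^+ L / (b - a) * cell_mass V L k.
  by move=> kL; apply: mulr_ge0; [rewrite divr_ge0 ?ltW|exact: cell_mass_ge0].
have mI (k : nat) : measurable ([set` dyadic_cell a b L k] : set R) by exact: measurable_itv.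
have iE (k : nat) : (fun x : R => (x \in dyadic_cell a b L k)%:R : R) =
    \1_([set` dyadic_cell a b L k] : set R).
  by apply/funext => x; rewrite indicE mem_setE.
rewrite ge0_integral_sum//; last 2 first.
- move=> k; apply/measurable_EFinP; apply: measurable_funM => //.
  by rewrite iE; exact: measurable_indic.
- by move=> k x _; rewrite lee_fin mulr_ge0 ?c0.
rewrite -[RHS](congr1 EFin (sum_cell_mass V L)) -sumEFin; apply: eq_bigr => k _.
rewrite ge0_integral_scale ?c0//; last by rewrite iE; exact: measurable_indic.
have -> : (\int[@lebesgue_measure R]_x ((x \in dyadic_cell a b L k)%:R)%:E =
    (cell_width a b L)%:E)%E.
  transitivity (\int[@lebesgue_measure R]_x (\1_([set` dyadic_cell a b L k] : set R) x)%:E)%E.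
    by apply: eq_integral => x _; rewrite indicE mem_setE.
  rewrite integral_indic//= setIT dyadic_cellE//.
  by case: ifP => _; rewrite lebesgue_measure_itv/= lte_fin ltrDl cell_width_gt0//
    -EFinB; congr EFin; ring.
rewrite -EFinM; congr EFin; rewrite /cell_width; field.
by rewrite (gt_eqF ba0) expf_neq0.
Qed.

Lemma integral_marginal_le1 :
  (\int[lebesgue_tuple R n]_beta mixture beta <= 1)%E.
Proof.
have -> : (\int[lebesgue_tuple R n]_beta mixture beta = \int[prior]_V
    ((1 : R)%:E * \int[lebesgue_tuple R n]_beta (lik a b V beta * 1)%:E))%E.
  rewrite (@integral_marginal R a b L n ab (fun=> 1) _ _ (fun=> 1))//.
  by apply: eq_integral => beta _; rewrite mul1e.
apply: (@le_trans _ _ (\int[prior]_V cst 1 V)%E); last first.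
  rewrite integral_cst// mul1e le_eqVlt; apply/orP; left; apply/eqP.
  exact: split_prior_setT.
apply: ge0_le_integral_nonmeas => V.
  by rewrite mul1e; apply: integral_ge0 => beta _; rewrite mulr1 lee_fin lik_ge0.
rewrite mul1e; under eq_integral do rewrite mulr1.
have [cV|cV] := boolP (in_cube V); last first.
  by under eq_integral do rewrite /lik (negbTE cV) mul0r; rewrite integral0 lee_fin.
under eq_integral do rewrite /lik cV mul1r.
rewrite (@integral_lebesgue_prod _ _ (fun=> polya_density a b V) (fun=> 1)) ?big1//.
- by move=> _; apply: (@measurable_polya_density R a b L _ _ (fun=> V) id) => //;
    exact: measurable_id.
- by move=> _ x; exact: polya_density_ge0.
- by move=> _; exact: integral_polya_density.
Qed.

Lemma marginal_in (chi : splits -> R) (beta : obs) : in_box a b beta ->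
  measurable_fun [set: splits] chi -> (forall V, 0 <= chi V) ->
  marginal a b chi beta = (((2 ^+ L / (b - a)) ^+ n)%:E *
    \int[prior]_V (tree_lik (fun j : 'I_N => left_count (index_of a b L beta) L j)
       (fun j : 'I_N => right_count (index_of a b L beta) L j) V * chi V)%:E)%E.
Proof.
move=> bb mchi chi0; rewrite /marginal -ge0_integral_scale//.
- by apply: eq_integral => V _; rewrite lik_in// mulrA.
- by rewrite exprn_ge0// divr_ge0// ltW.
- by apply: measurable_funM => //; exact: measurable_tree_lik.
- by move=> V; rewrite mulr_ge0 ?tree_lik_ge0.
Qed.

(** With [e = 1 / (2 L)], the splits within [e / 2] of one half have prior mass at
    least [e ^ (2 ^ L) >= 2 ^ (- L 2 ^ L) >= 2 ^ - n], and under each of them the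
    density is at least [(1 - e) ^ L / (b - a) >= 1 / (2 (b - a))]. *)
Lemma marginal_ge (beta : obs) : in_box a b beta -> (0 < L)%N -> (L * 2 ^ L <= n)%N ->
  (((4 * (b - a)) ^- n)%:E <= mixture beta)%E.
Proof.
move=> bb L0 Ln; rewrite marginal_in//.
under eq_integral do rewrite mulr1.
set kap := index_of a b L beta.
have -> : (\int[prior]_V (tree_lik (fun j : 'I_N => left_count kap L j)
      (fun j : 'I_N => right_count kap L j) V)%:E =
    \prod_(j < N) \int[@lebesgue_measure R]_x
      (beta_kernel (left_count kap L j) (right_count kap L j) x)%:E)%E.
  apply: integral_tree_prod.
  - by move=> k; exact: measurable_beta_kernel.
  - by move=> k x; exact: beta_kernel_ge0.
  - by move=> k x; exact: beta_kernel_out.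
pose e : R := (2 * L%:R)^-1.
have L1 : 1 <= L%:R :> R by rewrite ler1n.
have e0 : 0 < e by rewrite invr_gt0; lra.
have e1 : e <= 1 by rewrite invf_le1; lra.
have eL : L%:R * e = 2^-1 by rewrite /e; field; rewrite gt_eqF//; lra.
set u := 2^-1 * (1 - e).
have u0 : 0 <= u by rewrite /u; lra.
apply: (@le_trans _ _ (((2 ^+ L / (b - a)) ^+ n)%:E *
   \prod_(j < N) (e * u ^+ (left_count kap L j + right_count kap L j))%:E)%E); last first.
  apply: lee_wpmul2l; first by rewrite lee_fin exprn_ge0// divr_ge0// ltW.
  suff : (0 <= \prod_(j < N) (e * u ^+ (left_count kap L j + right_count kap L j))%:E /\
      \prod_(j < N) (e * u ^+ (left_count kap L j + right_count kap L j))%:E <=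
      \prod_(j < N) \int[@lebesgue_measure R]_x
        (beta_kernel (left_count kap L j) (right_count kap L j) x)%:E)%E by case.
  elim/big_ind2: _ => //.
    by move=> x1 x2 y1 y2 [x0 xy] [y0 xy']; split; [exact: mule_ge0|exact: lee_pmul].
  move=> j _; split; first by rewrite lee_fin mulr_ge0 ?exprn_ge0// ltW.
  exact: integral_beta_kernel_ge.
rewrite prodEFin -EFinM lee_fin big_split/= prodr_const card_ord prodrXr turn_count; last first.
  by move=> i; exact: index_of_lt.
have eN : 2 ^- n <= e ^+ N.
  apply: (@le_trans _ _ (e ^+ (2 ^ L))); last first.
    by apply: ler_wiXn2l; [exact: ltW|exact: e1|exact: leq_subr].
  have -> : e ^+ (2 ^ L) = ((2 * L%:R) ^+ (2 ^ L))^-1 by rewrite exprVn.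
  rewrite lef_pV2 ?posrE ?exprn_gt0//; last by lra.
  apply: (@le_trans _ _ ((2 ^+ L) ^+ (2 ^ L))); last by rewrite -exprM ler_eXn2l// ltr1n.
  rewrite lerXn2r ?nnegrE ?mulr_ge0//.
  rewrite -natrX -natrM ler_nat.
  by case: (L) L0 => // l _; elim: l => // l IH; rewrite mulnS expnS; lia.
have uL : (2 ^- L) * 2^-1 <= u ^+ L.
  rewrite /u exprMn exprVn ler_wpM2l ?invr_ge0 ?exprn_ge0//.
  have bern k : 1 - k%:R * e <= (1 - e) ^+ k.
    elim: k => [|k IH]; first by rewrite mul0r subr0.
    have k0 : 0 <= k%:R * e by rewrite mulr_ge0 ?ler0n ?ltW.
    rewrite exprS; apply: (@le_trans _ _ ((1 - e) * (1 - k%:R * e))).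
      by rewrite -natr1; nra.
    by rewrite ler_wpM2l// subr_ge0.
  by have := bern L; rewrite eL; lra.
rewrite mulnC exprM.
apply: (@le_trans _ _ ((2 ^+ L / (b - a)) ^+ n * (2 ^- n * (2 ^- L * 2^-1) ^+ n))); last first.
  have h0 k : (0 : R) <= 2 ^- k by rewrite invr_ge0 exprn_ge0.
  have h1 : (0 : R) <= 2 ^- L * 2^-1 by rewrite mulr_ge0// invr_ge0.
  apply: ler_wpM2l; first by rewrite exprn_ge0// divr_ge0// ltW.
  apply: ler_pM; [exact: h0|exact: exprn_ge0|exact: eN|].
  by apply: lerXn2r => //; rewrite nnegrE// exprn_ge0.
rewrite -!exprVn -!exprMn le_eqVlt; apply/orP; left; apply/eqP; congr (_ ^+ _).
rewrite exprVn; field.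
by rewrite (gt_eqF ba0) expf_neq0.
Qed.

(** By conjugacy, the concentration of the splits given the counts is a bound on the
    working posterior given the observations. *)
Lemma marginal_split_off (beta : obs) (D : R) : in_box a b beta -> 0 < D ->
  (marginal a b (fun V => [exists k, split_off
     (fun j : 'I_N => left_count (index_of a b L beta) L j)
     (fun j : 'I_N => right_count (index_of a b L beta) L j) D V k]%:R) beta <=
   (2 * N%:R * expR (- D))%:E * mixture beta)%E.
Proof.
move=> bb D0.
have c0 : (0 <= ((2 ^+ L / (b - a)) ^+ n)%:E :> \bar R)%E.
  by rewrite lee_fin exprn_ge0// divr_ge0// ltW.
rewrite !marginal_in//; last exact: measurable_split_off.
under [X in (_ <= _ * (_ * X))%E]eq_integral do rewrite mulr1.
by rewrite muleCA; apply: lee_wpmul2l => //; exact: split_concentration.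
Qed.

End marginal_bounds.

(** * Evidence and posterior *)

Section evidence.
Context (R : realType) (a b : R) (L m n : nat) (X : 'M[R]_(m, n)) (s : R).
Hypothesis ab : a < b.
Hypothesis s0 : 0 < s.
Notation N := (2 ^ L - 1)%N.
Notation splits := (N.-tuple (measurableTypeR R)).
Notation obs := (n.-tuple (measurableTypeR R)).
Notation data := (m.-tuple (measurableTypeR R)).
Notation prior := (split_prior R L).
Notation mixture := (@marginal R a b L n (fun=> 1)).

Definition noise_density (beta : obs) (y : data) : R :=
  gauss_prod (fun k => (X *m \col_i tnth beta i) k 0) s y.

Lemma joint_densityE g beta y :
  joint_density X s g beta y = (\prod_(i < n) g (tnth beta i)) * noise_density beta y.
Proof. by []. Qed.

Lemma noise_density_ge0 beta y : 0 <= noise_density beta y.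
Proof. exact: gauss_prod_ge0. Qed.

Lemma measurable_noise_density d (T : measurableType d) (beta : T -> obs) (y : T -> data) :
  measurable_fun [set: T] beta -> measurable_fun [set: T] y ->
  measurable_fun [set: T] (fun t => noise_density (beta t) (y t)).
Proof.
move=> mb my; apply: (measurable_gauss_prod
  (mean := fun t k => (X *m \col_i tnth (beta t) i) k 0)) => //.
  by rewrite gt_eqF.
move=> k; rewrite (_ : (fun _ => _) = fun t => \sum_i X k i * tnth (beta t) i).
  apply: measurable_sum => i; apply: measurable_funM => //.
  exact: measurable_tnth_comp.
by apply/funext => t; rewrite mxE; apply: eq_bigr => i _; rewrite mxE.
Qed.

Let lik_noise (V : splits) (y : data) : \bar R :=
  (\int[lebesgue_tuple R n]_beta (lik a b V beta * noise_density beta y)%:E)%E.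

Let lik_noise_ge0 V y : (0 <= lik_noise V y)%E.
Proof.
by apply: integral_ge0 => beta _; rewrite lee_fin mulr_ge0 ?lik_ge0 ?noise_density_ge0.
Qed.

Let working_evidenceE (B : set (R -> R)) (y : data) :
  working_evidence X s a b L B y =
  (\int[prior]_V (fun V => lik_noise V y) \_ [set V | B (polya_density a b V)] V)%E.
Proof.
rewrite /working_evidence integral_mkcond.
have [mC C0] := split_prior_cubeC R L.
apply: (ae_eq_integral_nonmeas mC C0).
move=> V /contrapT /= cV; rewrite !patchE; case: ifPn => // _.
apply: eq_integral => beta _; rewrite joint_densityE /lik.
by rewrite (cV : in_cube V) mul1r.
Qed.

Let mnoise y : measurable_fun [set: obs] (noise_density ^~ y).
Proof. by apply: (@measurable_noise_density _ _ id (fun=> y)) => //; exact: measurable_id. Qed.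

(** The set [B] of densities need not give a measurable set of splits; a measurable
    [chi] dominating its indicator takes its place before the integrals are
    exchanged. *)
Lemma working_evidence_le (B : set (R -> R)) (chi : splits -> R) (y : data) :
  measurable_fun [set: splits] chi -> (forall V, 0 <= chi V) ->
  (forall V : splits, B (polya_density a b V) -> 1 <= chi V) ->
  (working_evidence X s a b L B y <= \int[lebesgue_tuple R n]_beta
     ((noise_density beta y)%:E * marginal a b chi beta))%E.
Proof.
move=> mchi chi0 Bchi; rewrite working_evidenceE.
rewrite -(integral_marginal ab mchi chi0 (mnoise y) (fun beta => noise_density_ge0 beta y)).
apply: ge0_le_integral_nonmeas => V.
  by rewrite patchE; case: ifP => // _; exact: lik_noise_ge0.
rewrite patchE; case: ifPn => [/set_mem/= BV|_].
  by rewrite -[leLHS]mul1e; apply: lee_wpmul2r; [exact: lik_noise_ge0|rewrite lee_fin Bchi].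
by rewrite mule_ge0 ?lee_fin//; exact: lik_noise_ge0.
Qed.

Lemma working_evidence_setT (y : data) :
  working_evidence X s a b L setT y = (\int[lebesgue_tuple R n]_beta
     ((noise_density beta y)%:E * mixture beta))%E.
Proof.
rewrite working_evidenceE.
rewrite -(@integral_marginal R a b L n ab (fun=> 1) _ _ _ (mnoise y)
  (fun beta => noise_density_ge0 beta y))//.
by apply: eq_integral => V _; rewrite patchE mem_set// mul1e.
Qed.

Lemma working_evidence_ge0 B y : (0 <= working_evidence X s a b L B y)%E.
Proof.
rewrite working_evidenceE; apply: integral_ge0 => V _.
by rewrite patchE; case: ifP => // _; exact: lik_noise_ge0.
Qed.

Lemma working_evidence_setT_ge B y :
  (working_evidence X s a b L B y <= working_evidence X s a b L setT y)%E.
Proof.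
by rewrite working_evidence_setT; exact: working_evidence_le.
Qed.

(** When the evidence is zero or infinite the quotient defining the posterior is 0. *)
Lemma posterior_le B y (r : R) : 0 <= r ->
  (working_evidence X s a b L B y <= r%:E * working_evidence X s a b L setT y)%E ->
  posterior X s a b L B y <= r.
Proof.
move=> r0; rewrite /posterior.
have := working_evidence_ge0 B y; have := working_evidence_ge0 setT y.
case: (working_evidence X s a b L setT y) => [D| |]//=; last by rewrite invr0 mulr0.
case: (working_evidence X s a b L B y) => [E| |]//=.
rewrite !lee_fin => D0 E0 h.
have [->|Dn] := eqVneq D 0; first by rewrite invr0 mulr0.
by rewrite ler_pdivrMr// lt_def Dn.
Qed.

Lemma posterior_ge0 B y : 0 <= posterior X s a b L B y.
Proof. by rewrite divr_ge0// fine_ge0// working_evidence_ge0. Qed.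

End evidence.

(** * Change of measure *)

Section change_of_measure.
Context (R : realType) (a b : R) (L m n : nat) (X : 'M[R]_(m, n)) (s : R).
Hypothesis ab : a < b.
Hypothesis s0 : 0 < s.
Notation N := (2 ^ L - 1)%N.
Notation splits := (N.-tuple (measurableTypeR R)).
Notation obs := (n.-tuple (measurableTypeR R)).
Notation data := (m.-tuple (measurableTypeR R)).
Notation mixture := (@marginal R a b L n (fun=> 1)).
Notation noise := (noise_density X s).

Context (g0 : R -> R).
Hypothesis mg0 : measurable_fun [set: R] g0.
Hypothesis g0_ge0 : forall x, 0 <= g0 x.
Hypothesis g0_out : forall x, x \notin `[a, b] -> g0 x = 0.
Hypothesis g0_int : (\int[@lebesgue_measure R]_x (g0 x)%:E = 1)%E.

Definition iid_density (beta : obs) : R := \prod_(i < n) g0 (tnth beta i).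

Lemma iid_density_ge0 beta : 0 <= iid_density beta.
Proof. by apply: prodr_ge0 => i _. Qed.

Lemma iid_density_out beta : ~~ in_box a b beta -> iid_density beta = 0.
Proof.
by move=> /forallPn[i hi]; rewrite /iid_density (bigD1 i)//= g0_out// mul0r.
Qed.

Lemma measurable_iid_density d (T : measurableType d) (beta : T -> obs) :
  measurable_fun [set: T] beta ->
  measurable_fun [set: T] (fun t => iid_density (beta t)).
Proof.
move=> mb; apply: measurable_prod => i _.
by apply: measurableT_comp => //; exact: measurable_tnth_comp.
Qed.

Lemma integral_iid_density :
  (\int[lebesgue_tuple R n]_beta (iid_density beta)%:E = 1)%E.
Proof.
rewrite (@integral_lebesgue_prod _ _ (fun=> g0) (fun=> 1)) ?big1//.
Qed.

Let mnoise d (T : measurableType d) (beta : T -> obs) (y : T -> data) :=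
  @measurable_noise_density R m n X s s0 d T beta y.

Lemma integral_noise_density beta :
  (\int[lebesgue_tuple R m]_y (noise beta y)%:E = 1)%E.
Proof. exact: integral_gauss_prod. Qed.

Lemma true_expectation_ge0_le (f : obs -> data -> \bar R) (h : obs -> data -> R) :
  (forall beta y, 0 <= f beta y)%E ->
  (forall beta y, in_box a b beta -> (f beta y <= (h beta y)%:E)%E) ->
  (true_expectation X s g0 f <=
   \int[lebesgue_tuple R n \x lebesgue_tuple R m]_z
     (iid_density z.1 * noise z.1 z.2 * h z.1 z.2)%:E)%E.
Proof.
move=> f0 fh; rewrite /true_expectation.
apply: ge0_le_integral_nonmeas => -[beta y] /=; rewrite joint_densityE -/(iid_density beta).
  by rewrite mule_ge0 ?lee_fin ?mulr_ge0 ?iid_density_ge0 ?noise_density_ge0.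
have [bb|bb] := boolP (in_box a b beta); last first.
  by rewrite iid_density_out// !mul0r mul0e.
rewrite [leRHS]EFinM; apply: lee_wpmul2l; last exact: fh.
by rewrite lee_fin mulr_ge0 ?iid_density_ge0 ?noise_density_ge0.
Qed.

(** [E beta y] is near 1 when [beta] is far from the least squares estimate of [y],
    and [Psi beta0 y] is at least 1 when the true [beta0] is atypical. Bounding
    probabilities of bad events by the integrals of [E] and [Psi] instead of using
    the events keeps every integrand an explicit measurable function. *)
Context (E : obs -> data -> R) (A tau eta psi : R) (Psi : obs -> data -> R).
Context (chi : splits -> R) (B : set (R -> R)).
Hypothesis mE : measurable_fun [set: obs * data] (fun z => E z.1 z.2).
Hypothesis E01 : forall beta y, 0 <= E beta y <= 1.
Hypothesis tau_ge0 : 0 <= tau.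
Hypothesis E_tau : forall beta,
  (\int[lebesgue_tuple R m]_y (noise beta y * E beta y)%:E <= tau%:E)%E.
Hypothesis A_ge0 : 0 <= A.
Hypothesis dominated : forall beta, ((iid_density beta)%:E <= A%:E * mixture beta)%E.
Hypothesis eta_ge0 : 0 <= eta.
Hypothesis Psi_ge0 : forall beta y, 0 <= Psi beta y.
Hypothesis mPsi : measurable_fun [set: obs * data] (fun z => Psi z.1 z.2).
Hypothesis Psi_psi : (\int[lebesgue_tuple R n]_beta \int[lebesgue_tuple R m]_y
  (iid_density beta * noise beta y * Psi beta y)%:E <= psi%:E)%E.
Hypothesis mchi : measurable_fun [set: splits] chi.
Hypothesis chi01 : forall V, 0 <= chi V.
Hypothesis B_chi : forall V : splits, B (polya_density a b V) -> 1 <= chi V.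
Hypothesis good : forall beta0 y, in_box a b beta0 -> Psi beta0 y < 1 ->
  forall beta, in_box a b beta ->
  (marginal a b chi beta <= (eta + E beta y)%:E * mixture beta)%E.

Let mixture_ge0 beta : (0 <= mixture beta)%E.
Proof. by apply: marginal_ge0. Qed.

Let E0 beta y : 0 <= E beta y. Proof. by case/andP: (E01 beta y). Qed.

Let mmix d (T : measurableType d) (beta : T -> obs) : measurable_fun [set: T] beta ->
  measurable_fun [set: T] (fun t => mixture (beta t)).
Proof. by move=> mb; apply: measurableT_comp => //; exact: measurable_marginal. Qed.

(* The evidence, and the working joint mass of the bad observations. *)
Let den (y : data) := (\int[lebesgue_tuple R n]_beta ((noise beta y)%:E * mixture beta))%E.

Let num (y : data) := (\int[lebesgue_tuple R n]_beta
  ((noise beta y * E beta y)%:E * mixture beta))%E.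

Let den_ge0 y : (0 <= den y)%E.
Proof. by apply: integral_ge0 => beta _; rewrite mule_ge0 ?lee_fin ?noise_density_ge0. Qed.

Let num_ge0 y : (0 <= num y)%E.
Proof.
by apply: integral_ge0 => beta _; rewrite mule_ge0 ?lee_fin ?mulr_ge0 ?noise_density_ge0.
Qed.

Let mnoise12 : measurable_fun [set: obs * data] (fun z => noise z.1 z.2).
Proof. by apply: mnoise; [exact: measurable_fst|exact: measurable_snd]. Qed.

Let mnumf : measurable_fun [set: obs * data]
  (fun z => ((noise z.1 z.2 * E z.1 z.2)%:E * mixture z.1)%E).
Proof.
apply: emeasurable_funM; last by apply: mmix; exact: measurable_fst.
by apply/measurable_EFinP; exact: measurable_funM.
Qed.

Let mdenf : measurable_fun [set: obs * data] (fun z => ((noise z.1 z.2)%:E * mixture z.1)%E).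
Proof.
apply: emeasurable_funM; last by apply: mmix; exact: measurable_fst.
exact/measurable_EFinP.
Qed.

Let mden : measurable_fun [set: data] den.
Proof.
apply: (@measurable_fun_fubini_tonelli_G _ _ _ _ _ (lebesgue_tuple R n)
  (fun z : obs * data => ((noise z.1 z.2)%:E * mixture z.1)%E)) => //.
by move=> z; rewrite mule_ge0 ?lee_fin ?noise_density_ge0.
Qed.

Let mnum : measurable_fun [set: data] num.
Proof.
apply: (@measurable_fun_fubini_tonelli_G _ _ _ _ _ (lebesgue_tuple R n)
  (fun z : obs * data => ((noise z.1 z.2 * E z.1 z.2)%:E * mixture z.1)%E)) => //.
by move=> z; rewrite mule_ge0 ?lee_fin ?mulr_ge0 ?noise_density_ge0.
Qed.

Let num_den y : (num y <= den y)%E.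
Proof.
apply: ge0_le_integral_nonmeas => beta.
  by rewrite mule_ge0 ?lee_fin ?mulr_ge0 ?noise_density_ge0.
apply: lee_wpmul2r => //; rewrite lee_fin ler_piMr ?noise_density_ge0//.
by case/andP: (E01 beta y).
Qed.

Let Q y : R := fine (num y) / fine (den y).

Let Q_ge0 y : 0 <= Q y. Proof. by rewrite divr_ge0// fine_ge0. Qed.

Let pn0 beta y : 0 <= iid_density beta * noise beta y.
Proof. by rewrite mulr_ge0 ?iid_density_ge0 ?noise_density_ge0. Qed.

Let mQ : measurable_fun [set: data] Q.
Proof.
apply: measurable_funM.
  exact: measurableT_comp.
rewrite (_ : (fun _ => _) = fun y => fine (den y) `^ (-1)).
  have mf : measurable_fun [set: data] (fun y => fine (den y)) by exact: measurableT_comp.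
  exact: (measurableT_comp (@measurable_powR R (-1)) mf).
by apply/funext => y; rewrite powR_inv1// fine_ge0.
Qed.

(** The factor [A] times the evidence dominates the true density of the data, and
    it cancels the denominator of [Q]. The true expectation of the working
    posterior mass of the bad observations is thus at most [A] times their working
    probability. *)
Let integral_Q :
  (\int[lebesgue_tuple R n \x lebesgue_tuple R m]_z
     (iid_density z.1 * noise z.1 z.2 * Q z.2)%:E <= (A * tau)%:E)%E.
Proof.
rewrite fubini_tonelli2; last 2 first.
- apply/measurable_EFinP; apply: measurable_funM; last first.
    by apply: measurableT_comp => //; exact: measurable_snd.
  apply: measurable_funM => //; apply: measurable_iid_density; exact: measurable_fst.
- by move=> z; rewrite lee_fin mulr_ge0 ?pn0.
apply: (@le_trans _ _ (\int[lebesgue_tuple R m]_y (A%:E * num y))%E).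
  apply: ge0_le_integral_nonmeas => y.
    apply: integral_ge0 => beta _.
    by rewrite lee_fin mulr_ge0 ?pn0.
  rewrite /fubini_G /=.
  have miid : measurable_fun [set: obs] (fun beta => iid_density beta * noise beta y).
    apply: measurable_funM; first by apply: measurable_iid_density; exact: measurable_id.
    by apply: (@mnoise _ _ id (fun=> y)) => //; exact: measurable_id.
  under eq_integral do rewrite mulrC.
  rewrite ge0_integral_scale//.
  have h : (\int[lebesgue_tuple R n]_beta (iid_density beta * noise beta y)%:E
      <= A%:E * den y)%E.
    rewrite -ge0_integralZl//; last 2 first.
    - apply: emeasurable_funM; last by apply: mmix; exact: measurable_id.
      by apply/measurable_EFinP; apply: (@mnoise _ _ id (fun=> y)) => //; exact: measurable_id.
    - by move=> beta _; rewrite mule_ge0 ?lee_fin ?noise_density_ge0.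
    apply: ge0_le_integral_nonmeas => beta.
      by rewrite lee_fin mulr_ge0 ?iid_density_ge0 ?noise_density_ge0.
    rewrite EFinM muleC muleCA; apply: lee_wpmul2l => //.
    by rewrite lee_fin noise_density_ge0.
  have nd := num_den y.
  apply: le_trans (lee_wpmul2l _ h) _; first by rewrite lee_fin.
  rewrite muleCA; apply: lee_wpmul2l; first by rewrite lee_fin.
  rewrite /Q; have := den_ge0 y; have := num_ge0 y.
  move: nd; case: (den y) => [D| |]//=; last first.
    by rewrite invr0 mulr0 mul0e.
  case: (num y) => [F| |]//=; rewrite !lee_fin => FD F0 D0.
  have [->|Dn] := eqVneq D 0; first by rewrite invr0 mulr0.
  by rewrite divfK.
rewrite ge0_integralZl//.
rewrite EFinM; apply: lee_wpmul2l; first by rewrite lee_fin.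
have -> : (\int[lebesgue_tuple R m]_y num y = \int[lebesgue_tuple R n]_beta
    \int[lebesgue_tuple R m]_y ((noise beta y * E beta y)%:E * mixture beta))%E.
  apply/esym/tonelli_swap; first exact: mnumf.
  by move=> beta y; rewrite mule_ge0 ?lee_fin ?mulr_ge0 ?noise_density_ge0.
apply: (@le_trans _ _ (\int[lebesgue_tuple R n]_beta (tau%:E * mixture beta))%E).
  apply: ge0_le_integral_nonmeas => beta.
    by apply: integral_ge0 => y _; rewrite mule_ge0 ?lee_fin ?mulr_ge0 ?noise_density_ge0.
  rewrite ge0_integralZr//.
  - exact: lee_wpmul2r.
  - apply/measurable_EFinP; apply: measurable_funM.
      by apply: (@mnoise _ _ (fun=> beta) id) => //; exact: measurable_id.
    exact: (measurableT_comp mE (pair1_measurable beta)).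
  - by move=> y _; rewrite lee_fin mulr_ge0 ?noise_density_ge0.
rewrite ge0_integralZl//; last by apply: mmix; exact: measurable_id.
by rewrite -[leRHS]mule1; apply: lee_wpmul2l; [rewrite lee_fin|exact: integral_marginal_le1].
Qed.

(** On the event that [beta0] is typical, the posterior mass of [B] is at most [eta]
    plus the working posterior expectation [Q] of [E]; on its complement it is at
    most [1 <= Psi]. *)
Lemma expected_posterior_le :
  (true_expectation X s g0 (fun _ y => (posterior X s a b L B y)%:E) <=
   (psi + eta + A * tau)%:E)%E.
Proof.
have post_le beta0 y : in_box a b beta0 ->
    posterior X s a b L B y <= Psi beta0 y + eta + Q y.
  move=> bb0; have [Psi1|Psi1] := ltP (Psi beta0 y) 1; last first.
    apply: (@le_trans _ _ 1); last first.
      by rewrite -addrA (le_trans Psi1)// lerDl addr_ge0.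
    by apply: posterior_le => //; rewrite mul1e; exact: working_evidence_setT_ge.
  apply: (@le_trans _ _ (eta + Q y)); last first.
    by rewrite -addrA lerDr.
  have h : (working_evidence X s a b L B y <= eta%:E * den y + num y)%E.
    apply: le_trans (working_evidence_le X ab s0 y mchi chi01 B_chi) _.
    have mn : measurable_fun [set: obs] (fun beta => noise beta y).
      by apply: (@mnoise _ _ id (fun=> y)) => //; exact: measurable_id.
    have mm : measurable_fun [set: obs] mixture by apply: mmix; exact: measurable_id.
    rewrite -ge0_integralZl//; last 2 first.
    - by apply: emeasurable_funM => //; exact/measurable_EFinP.
    - by move=> beta _; rewrite mule_ge0 ?lee_fin ?noise_density_ge0.
    rewrite -ge0_integralD//; last 4 first.
    - by move=> beta _; rewrite !mule_ge0 ?lee_fin ?noise_density_ge0.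
    - apply: emeasurable_funM => //; apply: emeasurable_funM => //.
      exact/measurable_EFinP.
    - by move=> beta _; rewrite mule_ge0 ?lee_fin ?mulr_ge0 ?noise_density_ge0.
    - apply: emeasurable_funM => //; apply/measurable_EFinP; apply: measurable_funM => //.
      exact: (measurableT_comp mE (pair2_measurable y)).
    apply: ge0_le_integral_nonmeas => beta.
      by rewrite mule_ge0 ?lee_fin ?noise_density_ge0 ?marginal_ge0.
    have [bb|bb] := boolP (in_box a b beta); last first.
      rewrite [marginal a b chi beta](_ : _ = 0%E); last first.
        by rewrite /marginal; under eq_integral do rewrite lik_out// mul0r; rewrite integral0.
      by rewrite mule0 adde_ge0// !mule_ge0 ?lee_fin ?mulr_ge0 ?noise_density_ge0.
    apply: le_trans (lee_wpmul2l _ (good bb0 Psi1 bb)) _.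
      by rewrite lee_fin noise_density_ge0.
    rewrite !muleA -ge0_muleDl ?lee_fin ?mulr_ge0 ?noise_density_ge0//.
    by rewrite -!EFinM -EFinD (_ : _ * _ + _ = noise beta y * (eta + E beta y))//; ring.
  rewrite /posterior working_evidence_setT// -/(den y) /Q.
  have := working_evidence_ge0 L X s ab B y; have := num_den y.
  have := num_ge0 y; have := den_ge0 y; move: h.
  case: (den y) => [D| |]//=; last by rewrite !invr0 !mulr0 addr0.
  case: (num y) => [F| |]//=; case: (working_evidence X s a b L B y) => [W| |]//=.
  rewrite !lee_fin => h D0 F0 FD W0.
  have [->|Dn] := eqVneq D 0; first by rewrite invr0 !mulr0 addr0.
  rewrite ler_pdivrMr ?lt_def ?Dn// mulrDl divfK//.
apply: le_trans (@true_expectation_ge0_le _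
  (fun beta y => Psi beta y + eta + Q y) _ _) _.
- by move=> beta y; rewrite lee_fin posterior_ge0.
- by move=> beta y bb; rewrite lee_fin post_le.
have mpn : measurable_fun [set: obs * data] (fun z => iid_density z.1 * noise z.1 z.2).
  by apply: measurable_funM => //; apply: measurable_iid_density; exact: measurable_fst.
have mQ2 : measurable_fun [set: obs * data] (fun z => Q z.2).
  by apply: measurableT_comp => //; exact: measurable_snd.
under eq_integral do rewrite !mulrDr !EFinD.
rewrite ge0_integralD//; last 4 first.
- by move=> z _; rewrite -EFinD lee_fin addr_ge0// mulr_ge0.
- apply: emeasurable_funD; apply/measurable_EFinP; exact: measurable_funM.
- by move=> z _; rewrite lee_fin mulr_ge0.
- by apply/measurable_EFinP; exact: measurable_funM.
rewrite !EFinD; apply: leeD; last exact: integral_Q.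
rewrite ge0_integralD//; last 4 first.
- by move=> z _; rewrite lee_fin mulr_ge0.
- by apply/measurable_EFinP; exact: measurable_funM.
- by move=> z _; rewrite lee_fin mulr_ge0.
- by apply/measurable_EFinP; exact: measurable_funM.
apply: leeD.
  rewrite fubini_tonelli1//; first by apply/measurable_EFinP; exact: measurable_funM.
  by move=> z; rewrite lee_fin mulr_ge0.
under eq_integral do rewrite mulrC.
rewrite ge0_integral_scale// -[leRHS]mule1; apply: lee_wpmul2l; first by rewrite lee_fin.
rewrite fubini_tonelli1//; last 2 first.
- exact/measurable_EFinP.
- by move=> z; rewrite lee_fin.
rewrite -integral_iid_density le_eqVlt; apply/orP; left; apply/eqP.
apply: eq_integral => beta _; rewrite /fubini_F /=.
rewrite ge0_integral_scale ?iid_density_ge0//.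
- by rewrite integral_noise_density mule1.
- by apply: (@mnoise _ _ (fun=> beta) id) => //; exact: measurable_id.
- by move=> y; exact: noise_density_ge0.
Qed.

End change_of_measure.

(** * From leaf counts to leaf masses *)

Section tree_estimate.
Context (R : realType) (n L : nat) (kappa : 'I_n -> nat).
Hypothesis kappaL : forall i, (kappa i < 2 ^ L)%N.
Notation N := (2 ^ L - 1)%N.
Notation count := (cell_count kappa L).
Context (c1 c2 q : R).
Hypothesis c1_gt0 : 0 < c1.
Hypothesis q_gt0 : 0 < q.
Hypothesis n_gt0 : (0 < n)%N.
Hypothesis qE : q ^+ 2 * n%:R = L%:R * 2 ^+ L.
Hypothesis leaf_lb : forall k, (k < 2 ^ L)%N -> c1 * n%:R / 2 ^+ L <= (count L k)%:R.
Hypothesis leaf_ub : forall k, (k < 2 ^ L)%N -> (count L k)%:R <= c2 * n%:R / 2 ^+ L.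

Let n_gt0R : 0 < n%:R :> R. Proof. by rewrite ltr0n. Qed.

Lemma cell_count_bounds l k : (l <= L)%N -> (k < 2 ^ l)%N ->
  c1 * n%:R / 2 ^+ l <= (count l k)%:R <= c2 * n%:R / 2 ^+ l.
Proof.
move=> lL; have [j ->] : exists j, l = (L - j)%N by exists (L - l)%N; lia.
elim: j k => [|j IH] k; first by rewrite subn0 => kL; rewrite leaf_lb ?leaf_ub.
have [jL|jL] := ltnP j L; last by rewrite (_ : (L - j.+1)%N = (L - j)%N); [exact: IH|lia].
set l' := (L - j.+1)%N in IH *; have e : (L - j)%N = l'.+1 by rewrite /l'; lia.
rewrite e in IH * => kl; rewrite (cell_count_split _ _ (_ : (l' < L)%N)); last by rewrite /l'; lia.
have /andP[h1 h2] : c1 * n%:R / 2 ^+ l'.+1 <= (count l'.+1 (2 * k))%:R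
    <= c2 * n%:R / 2 ^+ l'.+1 by apply: IH; rewrite expnS; lia.
have /andP[h3 h4] : c1 * n%:R / 2 ^+ l'.+1 <= (count l'.+1 (2 * k).+1)%:R
    <= c2 * n%:R / 2 ^+ l'.+1 by apply: IH; rewrite expnS; lia.
have half (c : R) : c * n%:R / 2 ^+ l' = c * n%:R / 2 ^+ l'.+1 + c * n%:R / 2 ^+ l'.+1.
  by rewrite exprS; field; rewrite expf_neq0.
by rewrite !half natrD !lerD.
Qed.

(* Up to a constant, [z l] is the relative error of a split of level [l]: the counts
   halve from one level to the next, so it grows by a factor [sqrt 2]. *)
Let x : R := Num.sqrt 2.
Let z (l : nat) : R := q * x ^+ l / x ^+ L.
Let Theta : R := 2 * c2 / c1 * Num.sqrt (2 / c1).

Let x_gt0 : 0 < x. Proof. by rewrite sqrtr_gt0. Qed.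
Let x_ge : 7 / 5 <= x.
Proof.
rewrite -[7 / 5]ger0_norm// -sqrtr_sqr ler_wsqrtr//.
by rewrite expr2; lra.
Qed.
Let x2 : x ^+ 2 = 2. Proof. by rewrite sqr_sqrtr. Qed.

Let z_gt0 l : 0 < z l. Proof. by rewrite divr_gt0 ?mulr_gt0 ?exprn_gt0. Qed.

Let zS l : z l.+1 = x * z l. Proof. by rewrite /z exprS; ring. Qed.

Let z2 l : z l ^+ 2 = L%:R * 2 ^+ l / n%:R.
Proof.
rewrite /z !exprMn exprVn -!exprM ![(_ * 2)%N]mulnC !exprM x2.
have -> : q ^+ 2 = L%:R * 2 ^+ L / n%:R by rewrite -qE mulfK ?gt_eqF.
by field; rewrite gt_eqF// expf_neq0.
Qed.

Let c12 : c1 <= c2.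
Proof.
have /andP[h1 h2] := cell_count_bounds (leq0n L) (ltn0Sn 0 : (0 < 2 ^ 0)%N).
have := le_trans h1 h2; rewrite expr0 !divr1.
by rewrite ler_pM2r.
Qed.

Let Theta_gt0 : 0 < Theta.
Proof.
have c2_gt0 : 0 < c2 by exact: lt_le_trans c12.
by rewrite mulr_gt0 ?divr_gt0 ?mulr_gt0 ?sqrtr_gt0 ?divr_gt0.
Qed.

Let Tz_gt0 l : 0 < Theta * z l.
Proof. exact: mulr_gt0 Theta_gt0 (z_gt0 l). Qed.

Context (V : N.-tuple R).
Hypothesis small : 5 * Theta * q <= 1.
Hypothesis not_off : ~~ [exists k, split_off (fun j : 'I_N => left_count kappa L j)
  (fun j : 'I_N => right_count kappa L j) (2 * L%:R) V k].

Let count_gt0 l k : (l <= L)%N -> (k < 2 ^ l)%N -> 0 < (count l k)%:R :> R.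
Proof.
move=> lL kl; have /andP[h _] := cell_count_bounds lL kl.
by apply: lt_le_trans h; rewrite divr_gt0 ?mulr_gt0 ?exprn_gt0.
Qed.

(** The relative error of one split; its absolute error is at most
    [sqrt (2 L / count)] and the proportion being estimated is at least
    [c1 / (2 c2)]. *)
Let split_error l k : (l < L)%N -> (k < 2 ^ l)%N ->
  `|split_var V l k - (count l.+1 (2 * k))%:R / (count l k)%:R| <=
  Theta * z l * (c1 / (2 * c2)).
Proof.
move=> lL kl; have jN : (2 ^ l - 1 + k < N)%N := node_lt lL kl.
move/existsPn: not_off => /(_ (Ordinal jN)); rewrite /split_off /=.
rewrite left_countE// right_countE// -cell_count_split//.
have cp := count_gt0 (ltnW lL) kl.
rewrite -(ltr0n R) cp /= -leNgt (tnth_nth 0)/=.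
rewrite -/(split_var V l k) => h; apply: le_trans h _.
have c2_gt0 : 0 < c2 by exact: lt_le_trans c12.
have -> : Theta * z l * (c1 / (2 * c2)) = Num.sqrt (2 / c1) * z l.
  by rewrite /Theta; field; rewrite !gt_eqF.
have zl0 := z_gt0 l.
rewrite -[z l](ger0_norm (ltW zl0)) -sqrtr_sqr -sqrtrM; last by rewrite divr_ge0// ltW.
apply: ler_wsqrtr; rewrite z2.
have /andP[h _] := cell_count_bounds (ltnW lL) kl.
rewrite ler_pdivrMr//.
have : 0 <= (2 * L%:R) / (c1 * n%:R / 2 ^+ l).
  by rewrite divr_ge0 ?mulr_ge0 ?invr_ge0 ?exprn_ge0// ?ltW// mulr_gt0.
move=> h5; have := ler_wpM2l h5 h.
rewrite divfK; last by rewrite gt_eqF// divr_gt0 ?mulr_gt0 ?exprn_gt0.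
move=> h6; apply: le_trans h6 _; rewrite le_eqVlt; apply/orP; left; apply/eqP.
by congr (_ * _); field; rewrite !gt_eqF// ?exprn_gt0.
Qed.

(** The relative errors along a branch add up. They grow geometrically with the
    level, so the sum is of the order of the last term and no logarithmic factor is
    lost. The constant 5 satisfies [5 + 2 <= 5 * sqrt 2]. *)
Lemma cell_mass_estimate l k : (l <= L)%N -> (k < 2 ^ l)%N ->
  `|cell_mass V l k * n%:R / (count l k)%:R - 1| <= 5 * Theta * z l.
Proof.
elim: l k => [|l IH] k lL kl.
  have -> : k = 0%N by move: kl; rewrite expn0 ltnS leqn0 => /eqP.
  rewrite /= mul1r cell_count_root// divff ?gt_eqF// subrr normr0.
  by rewrite -mulrA ltW// pmulr_rgt0.
have k2 : (k./2 < 2 ^ l)%N := half_lt_exp kl.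
have kE : k = (odd k + 2 * k./2)%N by rewrite mul2n odd_double_half.
have h := IH k./2 (ltnW lL) k2.
have sp := cell_count_split kappa k./2 lL.
have cp := count_gt0 (ltnW lL) k2.
have cp1 := count_gt0 lL kl.
set e := _ - 1 in h.
have c2_gt0 : 0 < c2 by exact: lt_le_trans c12.
set p := (count l.+1 k)%:R / (count l k./2)%:R : R.
have pge : c1 / (2 * c2) <= p.
  rewrite /p ler_pdivlMr//.
  have /andP[h1 _] := cell_count_bounds lL kl.
  have /andP[_ h2] := cell_count_bounds (ltnW lL) k2.
  apply: le_trans h1; apply: (@le_trans _ _ (c1 / (2 * c2) * (c2 * n%:R / 2 ^+ l))).
    by rewrite ler_wpM2l// divr_ge0 ?mulr_ge0 ?ltW.
  by rewrite exprS le_eqVlt; apply/orP; left; apply/eqP; field; rewrite expf_neq0 ?gt_eqF.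
have p0 : 0 < p by rewrite divr_gt0.
set v := if odd k then 1 - split_var V l k./2 else split_var V l k./2.
have vp : `|v - p| <= Theta * z l * (c1 / (2 * c2)).
  have := split_error lL k2; rewrite /v /p.
  case: (boolP (odd k)) => ok.
    rewrite ok add1n in kE.
    rewrite -normrN => h'; apply: le_trans h'; rewrite le_eqVlt; apply/orP; left.
    apply/eqP; congr `|_|; rewrite {2}kE.
    have -> : (count l.+1 (2 * k./2).+1)%:R = (count l k./2)%:R - (count l.+1 (2 * k./2))%:R :> R.
      by rewrite sp natrD; ring.
    by field; rewrite gt_eqF.
  rewrite (negbTE ok) add0n in kE.
  by rewrite -kE.
set t := (v - p) / p.
have tb : `|t| <= Theta * z l.
  rewrite /t normrM normfV (gtr0_norm p0) ler_pdivrMr//; apply: le_trans vp _.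
  by rewrite ler_wpM2l// ltW.
have -> : cell_mass V l.+1 k * n%:R / (count l.+1 k)%:R - 1 = e + t * (1 + e).
  rewrite /= -/v /t /e /p; field.
  by rewrite !gt_eqF.
have zq : z l <= q.
  have xl : x ^+ l / x ^+ L <= 1.
    rewrite ler_pdivrMr ?exprn_gt0// mul1r; apply: ler_weXn2l; last exact: ltnW.
    by have := x_ge; lra.
  by rewrite /z -mulrA; apply: ler_piMr => //; exact: ltW.
have e1 : `|e| <= 1.
  apply: le_trans h _; apply: le_trans small; rewrite ler_wpM2l// mulr_ge0// ltW//.
apply: le_trans (ler_normD _ _) _; rewrite normrM.
have : `|1 + e| <= 2 by apply: le_trans (ler_normD _ _) _; rewrite normr1; lra.
move=> h2; have := ler_pM (normr_ge0 _) (normr_ge0 _) tb h2.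
rewrite zS.
have : 7 / 5 * (Theta * z l) <= x * (Theta * z l).
  by rewrite ler_wpM2r// ltW.
by nra.
Qed.

Lemma leaf_mass_estimate k : (k < 2 ^ L)%N ->
  `|cell_mass V L k - (count L k)%:R / n%:R| <= 5 * Theta * q * c2 / 2 ^+ L.
Proof.
move=> kL; have h := cell_mass_estimate (leqnn L) kL.
have cp := count_gt0 (leqnn L) kL.
have zL : z L = q by rewrite /z mulfK// expf_neq0 ?gt_eqF.
have -> : cell_mass V L k - (count L k)%:R / n%:R =
    (cell_mass V L k * n%:R / (count L k)%:R - 1) * ((count L k)%:R / n%:R).
  by field; rewrite !gt_eqF.
rewrite zL in h; rewrite normrM -[leRHS]mulrA; apply: ler_pM => //.
rewrite ger0_norm ?divr_ge0// ler_pdivrMr// mulrAC.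
exact: leaf_ub.
Qed.

End tree_estimate.

(** * Chernoff bounds for counts *)

Section chernoff.
Context (R : realType) (g0 : R -> R).
Hypothesis mg0 : measurable_fun [set: R] g0.
Hypothesis g0_ge0 : forall x, 0 <= g0 x.
Hypothesis g0_int : (\int[@lebesgue_measure R]_x (g0 x)%:E = 1)%E.
Notation mu := (@lebesgue_measure R).

Definition mass (J : set R) : R := fine (\int[mu]_x (g0 x * \1_J x)%:E).

Let g1_ge0 J x : 0 <= g0 x * \1_J x.
Proof. by rewrite mulr_ge0. Qed.

Let mg1 (J : set R) : measurable J -> measurable_fun [set: R] (fun x => g0 x * \1_J x).
Proof. by move=> mJ; apply: measurable_funM => //; exact: measurable_indic. Qed.

Let mass_le1 J : measurable J -> (\int[mu]_x (g0 x * \1_J x)%:E <= 1)%E.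
Proof.
move=> mJ; rewrite -g0_int; apply: ge0_le_integral_nonmeas => x; rewrite lee_fin//.
by rewrite ler_piMr// indicE lern1; case: (_ \in _).
Qed.

Lemma massE J : measurable J -> (\int[mu]_x (g0 x * \1_J x)%:E = (mass J)%:E)%E.
Proof.
move=> mJ; rewrite /mass fineK//; rewrite ge0_fin_numE.
  by apply: le_lt_trans (mass_le1 mJ) _; rewrite ltry.
by apply: integral_ge0 => x _; rewrite lee_fin.
Qed.

Let massC J : measurable J -> (\int[mu]_x (g0 x * \1_(~` J) x)%:E = (1 - mass J)%:E)%E.
Proof.
move=> mJ; have mJC : measurable (~` J) by exact: measurableC.
rewrite massE//; congr EFin.
have : ((mass J)%:E + (mass (~` J))%:E = 1 :> \bar R)%E.
  rewrite -!massE// -ge0_integralD//; last 4 first.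
  - by move=> x _; rewrite lee_fin.
  - by apply/measurable_EFinP; exact: mg1.
  - by move=> x _; rewrite lee_fin.
  - by apply/measurable_EFinP; exact: mg1.
  rewrite -g0_int; apply: eq_integral => x _; rewrite -EFinD !indicE in_setC.
  by congr EFin; case: (x \in J) => /=; ring.
by rewrite -EFinD => -[] /esym ->; ring.
Qed.

Definition hits n (J : set R) (beta : n.-tuple R) : R := \sum_(i < n) \1_J (tnth beta i).

Lemma measurable_hits n J d (T : measurableType d)
    (beta : T -> n.-tuple (measurableTypeR R)) : measurable J ->
  measurable_fun [set: T] beta -> measurable_fun [set: T] (fun t => hits J (beta t)).
Proof.
move=> mJ mb; apply: measurable_sum => i; apply: measurableT_comp.
  exact: measurable_indic.
exact: measurable_tnth_comp.
Qed.

(** [P] is an upper bound of the mass of [J] when [t] is positive and a lower bound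
    when [t] is negative. *)
Lemma hits_mgf n (J : set R) (P t u : R) : measurable J ->
  (expR t - 1) * mass J <= (expR t - 1) * P ->
  (\int[lebesgue_tuple R n]_beta (iid_density g0 beta * expR (t * (hits J beta - u)))%:E
   <= (expR (n%:R * (expR t - 1) * P - t * u))%:E)%E.
Proof.
move=> mJ tP; have mJC : measurable (~` J) by exact: measurableC.
have int1 : (\int[mu]_x (g0 x * expR (t * \1_J x))%:E =
    (1 + (expR t - 1) * mass J)%:E)%E.
  transitivity (\int[mu]_x (expR t * (g0 x * \1_J x))%:E +
      \int[mu]_x (g0 x * \1_(~` J) x)%:E)%E.
    rewrite -ge0_integralD//; last 4 first.
    - by move=> x _; rewrite lee_fin mulr_ge0 ?expR_ge0.
    - apply/measurable_EFinP; apply: measurable_funM => //; exact: mg1.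
    - by move=> x _; rewrite lee_fin.
    - by apply/measurable_EFinP; exact: mg1.
    apply: eq_integral => x _; rewrite -EFinD !indicE in_setC.
    by congr EFin; case: (x \in J) => /=; rewrite ?mulr1 ?mulr0 ?expR0; ring.
  rewrite ge0_integral_scale ?expR_ge0//; last exact: mg1.
  by rewrite massE// massC// -EFinM -EFinD; congr EFin; ring.
have -> : (\int[lebesgue_tuple R n]_beta (iid_density g0 beta * expR (t * (hits J beta - u)))%:E
   = \int[lebesgue_tuple R n]_beta (expR (- (t * u)) *
    \prod_(i < n) (g0 (tnth beta i) * expR (t * \1_J (tnth beta i))))%:E)%E.
  apply: eq_integral => beta _.
  congr EFin; rewrite big_split/= -expR_sum mulrCA -expRD; congr (_ * expR _).
  by rewrite -mulr_sumr /hits; ring.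
have mf : measurable_fun [set: R] (fun x => g0 x * expR (t * \1_J x)).
  apply: measurable_funM => //; apply: measurableT_comp => //.
  by apply: measurable_funM => //; exact: measurable_indic.
have f0 x : 0 <= g0 x * expR (t * \1_J x) by rewrite mulr_ge0 ?expR_ge0.
rewrite ge0_integral_scale ?expR_ge0//; last 2 first.
- apply: measurable_prod => i _; apply: (measurableT_comp mf).
  exact: measurable_tnth.
- by move=> beta; apply: prodr_ge0.
rewrite (@integral_lebesgue_prod _ _ (fun=> fun x => g0 x * expR (t * \1_J x))
  (fun=> 1 + (expR t - 1) * mass J))//.
rewrite prodr_const card_ord -EFinM lee_fin.
have h0 : 0 <= 1 + (expR t - 1) * mass J.
  rewrite -lee_fin -int1; apply: integral_ge0 => x _.
  by rewrite lee_fin.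
have h1 : (1 + (expR t - 1) * mass J) ^+ n <= expR ((expR t - 1) * P) ^+ n.
  rewrite lerXn2r ?nnegrE ?expR_ge0//.
  apply: le_trans (expR_ge1Dx _) _ => //.
  by rewrite ler_expR.
rewrite -expRM_natl in h1.
apply: (@le_trans _ _ (expR (- (t * u)) * expR (n%:R * ((expR t - 1) * P)))).
  by rewrite ler_wpM2l ?expR_ge0.
by rewrite -expRD ler_expR addrC mulrA.
Qed.

End chernoff.

Lemma expR_le_quadratic (R : realType) (s : R) : s <= 2^-1 -> expR s <= 1 + s + 2 * s ^+ 2.
Proof.
move=> s12; have s1 : 0 < 1 - s by lra.
have : 1 - s <= expR (- s) by have := expR_ge1Dx (- s); lra.
rewrite expRN => h.
have e0 := expR_gt0 s.
have h2 : expR s * (1 - s) <= 1.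
  by have := ler_wpM2l (ltW e0) h; rewrite divff ?gt_eqF.
rewrite -(ler_pM2r s1); apply: le_trans h2 _.
have : 0 <= s ^+ 2 * (1 - 2 * s) by rewrite mulr_ge0 ?sqr_ge0//; lra.
by lra.
Qed.

(** * Comparison of counts *)

Section cell_mass_bounds.
Context (R : realType) (g0 : R -> R).
Hypothesis mg0 : measurable_fun [set: R] g0.
Hypothesis g0_ge0 : forall x, 0 <= g0 x.
Hypothesis g0_int : (\int[@lebesgue_measure R]_x (g0 x)%:E = 1)%E.
Notation mu := (@lebesgue_measure R).

Definition outer_cell (lo hi delta : R) : set R := `]lo - delta, hi + delta[%classic.
Definition inner_cell (lo hi delta : R) : set R := `[lo + delta, hi - delta]%classic.

Let integral_itv (c u v : R) : 0 <= c -> u <= v ->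
  (\int[mu]_x (c * \1_(`[u, v]%classic : set R) x)%:E = (c * (v - u))%:E)%E.
Proof.
move=> c0 uv; have mI : measurable (`[u, v]%classic : set R) by exact: measurable_itv.
rewrite ge0_integral_scale//.
rewrite integral_indic//= setIT lebesgue_measure_itv/= lte_fin.
move: uv; rewrite le_eqVlt => /predU1P[->|->]; last by rewrite -EFinB -EFinM.
by rewrite ltxx subrr mulr0 mule0.
Qed.

Let integral_3itv (c1 c2 c3 u1 v1 u2 v2 u3 v3 : R) : 0 <= c1 -> 0 <= c2 -> 0 <= c3 ->
  u1 <= v1 -> u2 <= v2 -> u3 <= v3 ->
  (\int[mu]_x (c1 * \1_(`[u1, v1]%classic : set R) x +
     (c2 * \1_(`[u2, v2]%classic : set R) x + c3 * \1_(`[u3, v3]%classic : set R) x))%:E =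
   (c1 * (v1 - u1) + (c2 * (v2 - u2) + c3 * (v3 - u3)))%:E)%E.
Proof.
move=> h1 h2 h3 h4 h5 h6.
have mI (c u v : R) : measurable_fun [set: R] (fun x => c * \1_(`[u, v]%classic : set R) x).
  by apply: measurable_funM => //; apply: measurable_indic; exact: measurable_itv.
have I0 (c u v x : R) : 0 <= c -> 0 <= c * \1_(`[u, v]%classic : set R) x.
  by move=> c0; rewrite mulr_ge0// indicE.
under eq_integral do rewrite EFinD.
rewrite ge0_integralD//; last 4 first.
- by move=> x _; rewrite lee_fin I0.
- by apply/measurable_EFinP; exact: mI.
- by move=> x _; rewrite lee_fin addr_ge0 ?I0.
- by apply/measurable_EFinP; apply: measurable_funD; exact: mI.
under [X in (_ + X)%E]eq_integral do rewrite EFinD.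
rewrite ge0_integralD//; last 4 first.
- by move=> x _; rewrite lee_fin I0.
- by apply/measurable_EFinP; exact: mI.
- by move=> x _; rewrite lee_fin I0.
- by apply/measurable_EFinP; exact: mI.
by rewrite !integral_itv// -!EFinD.
Qed.

(** On the two margins, of length [delta] each, only the global bound of the density
    is available. *)
Lemma mass_outer_cell (lo w delta G M : R) : 0 <= delta -> 0 <= w ->
  0 <= G -> (forall x, x \in `[lo, lo + w] -> g0 x <= G) ->
  (forall x, g0 x <= M) -> 0 <= M ->
  mass g0 (outer_cell lo (lo + w) delta) <= w * G + 2 * M * delta.
Proof.
move=> d0 w0 G0 gG gM M0.
have mJ : measurable (outer_cell lo (lo + w) delta) by exact: measurable_itv.
rewrite -lee_fin -massE//.
have -> : (w * G + 2 * M * delta)%:E = (\int[mu]_x (G * \1_(`[lo, lo + w]%classic : set R) x +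
    (M * \1_(`[lo - delta, lo]%classic : set R) x +
     M * \1_(`[lo + w, lo + w + delta]%classic : set R) x))%:E)%E.
  rewrite integral_3itv ?lerDl ?gerBl//; first by congr EFin; ring.
apply: ge0_le_integral_nonmeas => x; rewrite lee_fin.
  by rewrite mulr_ge0// indicE.
rewrite !indicE !mem_setE !in_itv/=.
have p0 (c : R) (t : bool) : 0 <= c -> 0 <= c * t%:R by move=> c0; rewrite mulr_ge0.
have [/andP[h1 h2]|] := boolP (lo - delta < x < lo + w + delta); last first.
  by rewrite mulr0 !addr_ge0 ?p0.
rewrite mulr1; have [h3|h3] := ltP x lo.
  rewrite (ltW h1) (ltW h3) mulr1; apply: le_trans (gM x) _.
  by rewrite addrCA lerDl addr_ge0 ?p0.
have [h4|h4] := ltP (lo + w) x.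
  rewrite (ltW h2) (ltW h4) [X in _ <= _ + (_ + X)]mulr1; apply: le_trans (gM x) _.
  by rewrite addrA lerDr addr_ge0 ?p0.
rewrite mulr1; have := gG x; rewrite in_itv/= h3 h4 => /(_ isT) h.
by apply: le_trans h _; rewrite lerDl addr_ge0 ?p0.
Qed.

Lemma mass_inner_cell (lo w delta G M : R) : 0 <= delta -> 0 <= w ->
  0 <= G -> (forall x, x \in `[lo, lo + w] -> G <= g0 x) -> G <= M ->
  w * G - 2 * M * delta <= mass g0 (inner_cell lo (lo + w) delta).
Proof.
move=> d0 w0 G0 gG GM.
have mJ : measurable (inner_cell lo (lo + w) delta) by exact: measurable_itv.
have M0 : 0 <= M by exact: le_trans GM.
rewrite lerBlDr -lee_fin EFinD -massE//.
have -> : (2 * M * delta)%:E = (\int[mu]_x (0 * \1_(`[0, 0]%classic : set R) x +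
    (M * \1_(`[lo, lo + delta]%classic : set R) x +
     M * \1_(`[lo + w - delta, lo + w]%classic : set R) x))%:E)%E.
  rewrite integral_3itv ?lerDl ?gerBl//; first by congr EFin; ring.
have -> : (w * G)%:E = (\int[mu]_x (G * \1_(`[lo, lo + w]%classic : set R) x)%:E)%E.
  by rewrite integral_itv ?lerDl//; congr EFin; ring.
have mI (c u v : R) : measurable_fun [set: R] (fun x => c * \1_(`[u, v]%classic : set R) x).
  by apply: measurable_funM => //; apply: measurable_indic; exact: measurable_itv.
rewrite -ge0_integralD//; last 4 first.
- by move=> x _; rewrite lee_fin mulr_ge0// indicE.
- by apply/measurable_EFinP; apply: measurable_funM => //; exact: measurable_indic.
- by move=> x _; rewrite lee_fin !addr_ge0// mulr_ge0// indicE.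
- by apply/measurable_EFinP; apply: measurable_funD; [|apply: measurable_funD]; exact: mI.
apply: ge0_le_integral_nonmeas => x; first by rewrite lee_fin mulr_ge0// indicE.
rewrite -EFinD lee_fin mul0r add0r !indicE !mem_setE !in_itv/=.
have p0 (c : R) (t : bool) : 0 <= c -> 0 <= c * t%:R by move=> c0; rewrite mulr_ge0.
have [/andP[h1 h2]|_] := boolP (lo <= x <= lo + w); last first.
  by rewrite mulr0 !addr_ge0 ?p0.
rewrite mulr1; have := gG x; rewrite in_itv/= h1 h2 => /(_ isT) h.
have [h3|h3] := ltP x (lo + delta).
  rewrite (ltW h3) mulr1; apply: le_trans GM _.
  by rewrite addrCA lerDl addr_ge0 ?p0.
have [h4|h4] := ltP (lo + w - delta) x.
  rewrite (ltW h4) [X in _ <= _ + (_ + X)]mulr1; apply: le_trans GM _.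
  by rewrite addrA lerDr addr_ge0 ?p0.
by rewrite mulr1; apply: le_trans h _; rewrite lerDl addr_ge0 ?p0.
Qed.

End cell_mass_bounds.

Section transfer_of_counts.
Context (R : realType) (a b : R) (L n : nat).
Hypothesis ab : a < b.
Notation obs := (n.-tuple (measurableTypeR R)).
Context (beta0 beta : obs) (delta : R).
Hypothesis delta_gt0 : 0 < delta.
Hypothesis in_beta : in_box a b beta.

Definition moved : R := \sum_(i < n) (delta <= `|tnth beta i - tnth beta0 i|)%R%:R.

Let leaf_count k : (k < 2 ^ L)%N ->
  (cell_count (index_of a b L beta) L L k)%:R =
  \sum_(i < n) (tnth beta i \in dyadic_cell a b L k)%:R :> R.
Proof.
move=> kL; rewrite /cell_count natr_sum; apply: eq_bigr => i _.
rewrite subnn expn0 divn1; congr (nat_of_bool _)%:R.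
have [h1 h2] := cell_indexP ab L (forallP in_beta i).
by apply/eqP/idP => [<-//|h]; exact: cell_index_eq.
Qed.

Let cellw k := cell_left a b L k + cell_width a b L.

(** An observation lying in the cell comes from a true one in the widened cell
    unless it has moved by at least [delta]. *)
Lemma leaf_count_le k : (k < 2 ^ L)%N ->
  (cell_count (index_of a b L beta) L L k)%:R <=
  hits (outer_cell (cell_left a b L k) (cellw k) delta) beta0 + moved.
Proof.
move=> kL; rewrite leaf_count// /hits /moved -big_split/=; apply: ler_sum => i _.
have [h|_] := boolP (_ \in dyadic_cell _ _ _ _); last by rewrite addr_ge0// indicE.
have [h1|h1] := leP delta `|tnth beta i - tnth beta0 i|.
  by rewrite lerDr indicE.
rewrite addr0 indicE mem_setE in_itv/=.
have /andP[h2 h3] := mem_dyadic_cell h.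
move: h1; rewrite ltr_norml => /andP[h4 h5].
rewrite (_ : (_ < _ < _) = true)//; apply/andP; split; rewrite ?/cellw; lra.
Qed.

Lemma leaf_count_ge k : (k < 2 ^ L)%N ->
  hits (inner_cell (cell_left a b L k) (cellw k) delta) beta0 - moved <=
  (cell_count (index_of a b L beta) L L k)%:R.
Proof.
move=> kL; rewrite lerBlDr leaf_count// /hits /moved -big_split/=; apply: ler_sum => i _.
rewrite indicE mem_setE; have [h|_] := boolP (_ \in `[_, _]); last by rewrite addr_ge0.
have [h1|h1] := leP delta `|tnth beta i - tnth beta0 i|; first by rewrite lerDr.
rewrite addr0 interior_dyadic_cell//; move: h h1;
  rewrite in_itv/= ltr_norml /cellw => /andP[h2 h3] /andP[h4 h5]; lra.
Qed.

(** Both points lie close to the least squares estimator, hence to each other, and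
    Chebyshev's inequality bounds the number of coordinates far apart. *)
Lemma moved_le m (X : 'M[R]_(m, n)) y (Q : R) :
  lse_dist X y beta <= Q -> lse_dist X y beta0 <= Q -> moved <= 4 * Q / delta ^+ 2.
Proof.
move=> h1 h2; rewrite ler_pdivlMr ?exprn_gt0//.
apply: (@le_trans _ _ (2 * lse_dist X y beta + 2 * lse_dist X y beta0)); last by lra.
rewrite /moved mulr_suml /lse_dist !mulr_sumr -big_split/=; apply: ler_sum => i _.
set u := \sum_k _; set v := tnth beta i; set v0 := tnth beta0 i.
have uv : (v - v0) ^+ 2 <= 2 * (u - v) ^+ 2 + 2 * (u - v0) ^+ 2.
  by have := sqr_ge0 ((u - v) + (u - v0)); rewrite !expr2; lra.
apply: le_trans uv; have [h|_] := leP delta `|v - v0|; last by rewrite mul0r sqr_ge0.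
by rewrite mul1r -[leRHS]real_normK ?num_real// lerXn2r ?nnegrE// ltW.
Qed.

End transfer_of_counts.

(** * The bound at a fixed sample size *)

Section finite_sample.
Context (R : realType) (a b : R) (L m n : nat) (X : 'M[R]_(m, n)) (s : R).
Hypothesis ab : a < b.
Hypothesis s_gt0 : 0 < s.
Hypothesis lambda_gt0 : 0 < lambda_min (X^T *m X).
Hypothesis L_gt0 : (0 < L)%N.
Hypothesis n_gt0 : (0 < n)%N.
Notation N := (2 ^ L - 1)%N.
Notation splits := (N.-tuple (measurableTypeR R)).
Notation obs := (n.-tuple (measurableTypeR R)).
Notation data := (m.-tuple (measurableTypeR R)).
Notation mixture := (@marginal R a b L n (fun=> 1)).
Notation noise := (noise_density X s).

Context (g0 : R -> R) (m0 M0 H : R).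
Hypothesis m0_gt0 : 0 < m0.
Hypothesis mg0 : measurable_fun [set: R] g0.
Hypothesis g0_out : forall x, x \notin `[a, b] -> g0 x = 0.
Hypothesis g0_int : (\int[@lebesgue_measure R]_x (g0 x)%:E = 1)%E.
Hypothesis g0_bounds : {in `[a, b], forall x, m0 <= g0 x <= M0}.
Hypothesis g0_osc : {in `[a, b] &, forall x y, `|x - y| <= cell_width a b L ->
  `|g0 x - g0 y| <= H}.

Context (q cN K : R).
Hypothesis q_gt0 : 0 < q.
Hypothesis q_le : q <= 2^-1.
Hypothesis qE : q ^+ 2 * n%:R = L%:R * 2 ^+ L.
Hypothesis K_ge0 : 0 <= K.
Hypothesis noise_small :
  s ^+ 2 / lambda_min (X^T *m X) <= cN * (q ^+ 3 / 8 ^+ L).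

(* In the constants below, the count of a leaf is known up to [count_cst] times
   [n q / 2 ^ L]; [lower_cst] and [upper_cst] bound it relative to [n / 2 ^ L]. *)
Definition chernoff_cst : R := 4 * (b - a) * M0 + 4 * M0 + 2.
Definition count_cst : R := 2 * M0 + chernoff_cst + 4 * K * cN.
Definition lower_cst : R := (b - a) * m0 / 2.
Definition upper_cst : R := 2 * (b - a) * M0.
Definition split_cst : R :=
  2 * upper_cst / lower_cst * Num.sqrt (2 / lower_cst).
Definition error_cst : R := (count_cst + 5 * split_cst * upper_cst) / (b - a).

Hypothesis H_small : H <= m0 / 4.
Hypothesis q_small : count_cst * q <= (b - a) * m0 / 4.
Hypothesis q_small' : 5 * split_cst * q <= 1.

Let ba0 : 0 < b - a. Proof. by rewrite subr_gt0. Qed.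
Let n_gt0R : 0 < n%:R :> R. Proof. by rewrite ltr0n. Qed.
Let pow_gt0 : 0 < 2 ^+ L :> R. Proof. by rewrite exprn_gt0. Qed.
Let mM0 : m0 <= M0.
Proof.
have /andP[h1 h2] : m0 <= g0 a <= M0 by apply: g0_bounds; rewrite in_itv/= lexx ltW.
exact: le_trans h2.
Qed.
Let M0_gt0 : 0 < M0. Proof. exact: lt_le_trans mM0. Qed.
Let H_ge0 : 0 <= H.
Proof.
apply: le_trans (normr_ge0 (g0 a - g0 a)) _.
have aab : a \in `[a, b] by rewrite in_itv/= lexx ltW.
by apply: g0_osc => //; rewrite subrr normr0 ltW// cell_width_gt0.
Qed.
Let g0_ge0 x : 0 <= g0 x.
Proof.
have [/g0_bounds/andP[h _]|/g0_out->//] := boolP (x \in `[a, b]).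
exact: le_trans (ltW m0_gt0) h.
Qed.
Let g0_le x : g0 x <= M0.
Proof.
have [/g0_bounds/andP[_ h]//|/g0_out->] := boolP (x \in `[a, b]).
exact: ltW.
Qed.

(* The window [delta] is of the order of [q] times the width of a cell, and [r] is the
   order of magnitude of every error made on the count of a leaf. *)
Let delta : R := q / 2 ^+ L.
Let r : R := n%:R * q / 2 ^+ L.
Let w : R := cell_width a b L.
Let lo k : R := cell_left a b L k.

Let delta_gt0 : 0 < delta. Proof. by rewrite divr_gt0. Qed.
Let r_gt0 : 0 < r. Proof. by rewrite divr_gt0// mulr_gt0. Qed.
Let w_gt0 : 0 < w. Proof. exact: cell_width_gt0. Qed.
Let qr : q * r = L%:R.
Proof.
have -> : q * r = q ^+ 2 * n%:R / 2 ^+ L by rewrite /r; ring.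
by rewrite qE mulfK// gt_eqF.
Qed.

Let osc k x : (k < 2 ^ L)%N -> x \in `[lo k, lo k + w] -> `|g0 x - g0 (lo k)| <= H.
Proof.
move=> kL; rewrite in_itv/= => /andP[h1 h2].
have lk := cell_left_in ab kL.
have xab : x \in `[a, b].
  rewrite in_itv/= (le_trans _ h1) ?cell_left_ge//=.
  exact: le_trans h2 (cell_right_le ab kL).
apply: g0_osc => //; rewrite ger0_norm ?subr_ge0//.
by rewrite lerBlDl.
Qed.

(* Bounds of the true mass of the widened and narrowed cells, and the counts beyond
   which the sample is atypical. *)
Let Pup k : R := w * (g0 (lo k) + H) + 2 * M0 * delta.
Let Pdn k : R := w * (g0 (lo k) - H) - 2 * M0 * delta.
Let up_level k : R := n%:R * Pup k + chernoff_cst * r.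
Let dn_level k : R := n%:R * Pdn k - chernoff_cst * r.
Let outer k := outer_cell (lo k) (lo k + w) delta.
Let inner k := inner_cell (lo k) (lo k + w) delta.

Let g0_lo k : (k < 2 ^ L)%N -> m0 <= g0 (lo k) <= M0.
Proof. by move=> kL; apply: g0_bounds; exact: cell_left_in. Qed.

Let C_gt0 : 0 < chernoff_cst.
Proof. by rewrite /chernoff_cst !addr_gt0 ?mulr_gt0. Qed.

(** The variance term of the Chernoff bound at [t = q] is of order
    [n q ^ 2 / 2 ^ L = L], like the gain [q r = L]. *)
Let q_upper (E : R) : E <= 2 * q ^+ 2 ->  0 <= E -> forall P : R,
  P <= (2 * (b - a) * M0 + 2 * M0) / 2 ^+ L ->
  n%:R * E * P - q * (chernoff_cst * r) <= - (2 * L%:R).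
Proof.
move=> E1 E0 P PM.
have -> : q * (chernoff_cst * r) = chernoff_cst * L%:R by rewrite -qr; ring.
have c0 : 0 <= (2 * (b - a) * M0 + 2 * M0) / 2 ^+ L.
  by rewrite divr_ge0 ?addr_ge0 ?mulr_ge0// ltW.
have nE0 : 0 <= n%:R * E by rewrite mulr_ge0// ltW.
have h1 := ler_wpM2l nE0 PM.
have h2 : n%:R * E <= 2 * (L%:R * 2 ^+ L).
  by rewrite -qE; have := ler_wpM2l (ltW n_gt0R) E1; lra.
have h3 := ler_wpM2r c0 h2.
have h4 : 2 * (L%:R * 2 ^+ L) * ((2 * (b - a) * M0 + 2 * M0) / 2 ^+ L) =
    (chernoff_cst - 2) * L%:R.
  by rewrite /chernoff_cst; field; rewrite gt_eqF.
by rewrite h4 in h3; lra.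
Qed.

Let P_bound (G : R) : G <= 2 * M0 ->
  w * G + 2 * M0 * delta <= (2 * (b - a) * M0 + 2 * M0) / 2 ^+ L.
Proof.
move=> GM; rewrite /w /cell_width /delta ler_pdivlMr// mulrDl.
have -> : (b - a) / 2 ^+ L * G * 2 ^+ L = (b - a) * G by field; rewrite gt_eqF.
have -> : 2 * M0 * (q / 2 ^+ L) * 2 ^+ L = 2 * M0 * q by field; rewrite gt_eqF.
have h1 := ler_wpM2l (ltW ba0) GM.
have q1 : q <= 1 by apply: le_trans q_le _; lra.
have h2 := ler_wpM2l (ltW M0_gt0) q1.
by lra.
Qed.

Let hits_up_mgf k : (k < 2 ^ L)%N ->
  (\int[lebesgue_tuple R n]_beta
    (iid_density g0 beta * expR (q * (hits (outer k) beta - up_level k)))%:E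
   <= (expR (- (2 * L%:R)))%:E)%E.
Proof.
move=> kL; have /andP[gl gu] := g0_lo kL.
have q0 := q_gt0; have hs := H_small; have m00 := m0_gt0; have mM := mM0.
have qh := q_le; have h0 := H_ge0.
have eq1 : 0 <= expR q - 1 by have := expR_ge1Dx q; lra.
have mJ : measurable (outer k) by exact: measurable_itv.
have mass_le : mass g0 (outer k) <= Pup k.
  apply: mass_outer_cell => //; try exact: ltW.
    by rewrite addr_ge0.
  by move=> x xin; have := osc kL xin; rewrite ler_norml => /andP[_ h]; lra.
apply: le_trans (hits_mgf mg0 g0_ge0 g0_int n (up_level k) mJ
  (ler_wpM2l eq1 mass_le)) _.
rewrite lee_fin ler_expR /up_level.
have -> : n%:R * (expR q - 1) * Pup k - q * (n%:R * Pup k + chernoff_cst * r) =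
  n%:R * (expR q - 1 - q) * Pup k - q * (chernoff_cst * r) by ring.
apply: q_upper.
- by have := expR_le_quadratic q_le; lra.
- by have := expR_ge1Dx q; lra.
- by apply: P_bound; lra.
Qed.

Let hits_dn_mgf k : (k < 2 ^ L)%N ->
  (\int[lebesgue_tuple R n]_beta
    (iid_density g0 beta * expR (- q * (hits (inner k) beta - dn_level k)))%:E
   <= (expR (- (2 * L%:R)))%:E)%E.
Proof.
move=> kL; have /andP[gl gu] := g0_lo kL.
have q0 := q_gt0; have hs := H_small; have m00 := m0_gt0; have mM := mM0.
have qh := q_le; have h0 := H_ge0.
have eq1 : 0 <= 1 - expR (- q).
  by rewrite subr_ge0 -[leRHS]expR0 ler_expR; lra.
have mJ : measurable (inner k) by exact: measurable_itv.
have mass_ge : Pdn k <= mass g0 (inner k).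
  apply: mass_inner_cell => //; try exact: ltW; try lra.
  by move=> x xin; have := osc kL xin; rewrite ler_norml => /andP[h _]; lra.
have hP : (expR (- q) - 1) * mass g0 (inner k) <= (expR (- q) - 1) * Pdn k.
  by have := ler_wpM2l eq1 mass_ge; lra.
apply: le_trans (hits_mgf mg0 g0_ge0 g0_int n (dn_level k) mJ hP) _.
rewrite lee_fin ler_expR /dn_level.
have -> : n%:R * (expR (- q) - 1) * Pdn k - - q * (n%:R * Pdn k - chernoff_cst * r) =
  n%:R * (expR (- q) - 1 - - q) * Pdn k - q * (chernoff_cst * r) by ring.
apply: q_upper.
- have := @expR_le_quadratic R (- q); rewrite sqrrN => h.
  have q' : - q <= 2^-1 by lra.
  by have := h q'; lra.
- by have := expR_ge1Dx (- q); lra.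
- apply: (@le_trans _ _ (w * (g0 (lo k) - H) + 2 * M0 * delta)).
    rewrite /Pdn lerD2l; have : 0 <= 2 * M0 * delta; last by lra.
    by rewrite -mulrA mulr_ge0// mulr_ge0// ltW.
  by apply: P_bound; lra.
Qed.

Let S : R := s ^+ 2 / lambda_min (X^T *m X).
Let Qd : R := K * n%:R * S.

(** A truncated exponential of the excess of the squared distance over its typical
    size: equal to 1 exactly when that distance is atypical, and integrable with an
    exponentially small bound. *)
Definition lse_excess (beta : obs) (y : data) : R :=
  Num.min 1 (expR (3 / 8 * (lambda_min (X^T *m X) / s ^+ 2 * lse_dist X y beta - K * n%:R))).

Definition lse_tail : R := 2 ^+ n * expR (- (3 / 8 * (K * n%:R))).

Lemma lse_excess01 beta y : 0 <= lse_excess beta y <= 1.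
Proof. by rewrite /lse_excess le_min ler01 expR_ge0/= ge_min lexx. Qed.

Lemma measurable_lse_excess :
  measurable_fun [set: obs * data] (fun z => lse_excess z.1 z.2).
Proof.
apply: measurable_minr => //; apply: measurableT_comp => //.
apply: measurable_funM => //; apply: measurable_funB => //.
apply: measurable_funM => //.
by apply: measurable_lse_dist; [exact: measurable_snd|exact: measurable_fst].
Qed.

Let mnoise_y beta : measurable_fun [set: data] (noise beta).
Proof.
by apply: (@measurable_noise_density R m n X s s_gt0 _ _ (fun=> beta) id) => //;
  exact: measurable_id.
Qed.

Lemma integral_lse_excess beta :
  (\int[lebesgue_tuple R m]_y (noise beta y * lse_excess beta y)%:E <= lse_tail%:E)%E.
Proof.
set e := expR (- (3 / 8 * (K * n%:R))).
apply: (@le_trans _ _ (\int[lebesgue_tuple R m]_y (e * (noise beta y *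
    expR (3 / 8 * (lambda_min (X^T *m X) / s ^+ 2) * lse_dist X y beta)))%:E)%E).
  apply: ge0_le_integral_nonmeas => y.
    by rewrite lee_fin mulr_ge0 ?noise_density_ge0//; have /andP[] := lse_excess01 beta y.
  rewrite lee_fin mulrCA ler_wpM2l ?noise_density_ge0// /lse_excess ge_min; apply/orP; right.
  by rewrite -expRD ler_expR le_eqVlt; apply/orP; left; apply/eqP; ring.
rewrite ge0_integral_scale ?expR_ge0//; last 2 first.
- apply: measurable_funM => //; apply: measurableT_comp => //.
  apply: measurable_funM => //.
  by apply: (@measurable_lse_dist _ _ _ _ _ _ id (fun=> beta)) => //; exact: measurable_id.
- by move=> y; rewrite mulr_ge0 ?noise_density_ge0 ?expR_ge0.
rewrite /lse_tail [2 ^+ n * _]mulrC EFinM; apply: lee_wpmul2l.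
  by rewrite lee_fin expR_ge0.
exact: lse_dist_mgf.
Qed.

Let lse_close beta y : lse_excess beta y < 1 -> lse_dist X y beta <= Qd.
Proof.
rewrite /lse_excess gt_min ltxx/= -[ltRHS]expR0 ltr_expR => h.
have h1 : lambda_min (X^T *m X) / s ^+ 2 * lse_dist X y beta <= K * n%:R by lra.
have S0 : 0 < S by rewrite divr_gt0// exprn_gt0.
have -> : Qd = S * (K * n%:R) by rewrite /Qd; ring.
have e : S * (lambda_min (X^T *m X) / s ^+ 2 * lse_dist X y beta) = lse_dist X y beta.
  by rewrite /S; field; rewrite !gt_eqF.
by have := ler_wpM2l (ltW S0) h1; rewrite e.
Qed.

(** The bound on the noise level is used here: it makes the number of moved
    observations at most of order [r]. *)
Let moved_small beta0 beta y : lse_excess beta0 y < 1 -> lse_excess beta y < 1 ->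
  moved beta0 beta delta <= 4 * K * cN * r.
Proof.
move=> /lse_close h1 /lse_close h2.
apply: le_trans (moved_le delta_gt0 h2 h1) _.
have h3 := noise_small; rewrite -/S in h3.
apply: (@le_trans _ _ (4 * (K * n%:R * (cN * (q ^+ 3 / 8 ^+ L))) / delta ^+ 2)).
  rewrite ler_wpM2r ?invr_ge0 ?sqr_ge0// ler_wpM2l//.
  by rewrite ler_wpM2l// mulr_ge0.
have -> : 8 ^+ L = (2 ^+ L) ^+ 3 :> R.
  by rewrite -exprM mulnC exprM; congr (_ ^+ _); ring.
rewrite /delta /r le_eqVlt; apply/orP; left; apply/eqP; field.
by rewrite !gt_eqF.
Qed.

Let leaf_counts beta0 beta y k : in_box a b beta -> (k < 2 ^ L)%N ->
  hits (outer k) beta0 <= up_level k -> dn_level k <= hits (inner k) beta0 ->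
  lse_excess beta0 y < 1 -> lse_excess beta y < 1 ->
  `|(cell_count (index_of a b L beta) L L k)%:R - n%:R * w * g0 (lo k)| <=
  n%:R * w * H + count_cst * r.
Proof.
move=> bb kL hup hdn e0 e1.
have hm := moved_small e0 e1.
have h1 := leaf_count_le ab beta0 delta bb kL.
have h2 := leaf_count_ge ab beta0 delta bb kL.
have dr : n%:R * delta = r by rewrite /delta /r; ring.
rewrite ler_norml; apply/andP; split.
  have : hits (inner k) beta0 - moved beta0 beta delta <=
    (cell_count (index_of a b L beta) L L k)%:R by exact: h2.
  have -> : count_cst * r = 2 * M0 * r + chernoff_cst * r + 4 * K * cN * r.
    by rewrite /count_cst; ring.
  move: hdn hm; rewrite /dn_level /Pdn -dr; lra.
have : (cell_count (index_of a b L beta) L L k)%:R <=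
    hits (outer k) beta0 + moved beta0 beta delta by exact: h1.
have -> : count_cst * r = 2 * M0 * r + chernoff_cst * r + 4 * K * cN * r.
  by rewrite /count_cst; ring.
by move: hup hm; rewrite /up_level /Pup -dr; lra.
Qed.

Definition threshold : R := H + error_cst * q.

Let leaf_density_error beta0 beta y (V : N.-tuple R) k : in_box a b beta ->
  (forall k, (k < 2 ^ L)%N -> hits (outer k) beta0 <= up_level k) ->
  (forall k, (k < 2 ^ L)%N -> dn_level k <= hits (inner k) beta0) ->
  lse_excess beta0 y < 1 -> lse_excess beta y < 1 ->
  ~~ [exists j, split_off (fun j : 'I_N => left_count (index_of a b L beta) L j)
       (fun j : 'I_N => right_count (index_of a b L beta) L j) (2 * L%:R) V j] ->
  (k < 2 ^ L)%N ->
  `|2 ^+ L / (b - a) * cell_mass V L k - g0 (lo k)| <= threshold.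
Proof.
move=> bb hup hdn e0 e1 hV kL.
pose count k : R := (cell_count (index_of a b L beta) L L k)%:R.
have hc k' (kL' : (k' < 2 ^ L)%N) : `|count k' - n%:R * w * g0 (lo k')| <=
    n%:R * w * H + count_cst * r by exact: leaf_counts (hup _ kL') (hdn _ kL') e0 e1.
have nw0 : 0 < n%:R * w by rewrite mulr_gt0.
have nwE : n%:R * w = (b - a) * (n%:R / 2 ^+ L) by rewrite /w /cell_width; ring.
have n2 : 0 < n%:R / 2 ^+ L :> R by rewrite divr_gt0.
have cr : count_cst * r <= n%:R * w * (m0 / 4).
  have -> : count_cst * r = count_cst * q * (n%:R / 2 ^+ L) by rewrite /r; ring.
  have := ler_wpM2r (ltW n2) q_small; rewrite nwE; lra.
have wH : n%:R * w * H <= n%:R * w * (m0 / 4) by rewrite ler_wpM2l// ltW.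
have lb k' : (k' < 2 ^ L)%N -> lower_cst * n%:R / 2 ^+ L <= count k'.
  move=> kL'; have := hc k' kL'; rewrite ler_norml => /andP[h _].
  have /andP[gl _] := g0_lo kL'.
  have := ler_wpM2l (ltW nw0) gl.
  have -> : lower_cst * n%:R / 2 ^+ L = n%:R * w * (m0 / 2).
    by rewrite nwE /lower_cst; field; rewrite gt_eqF.
  lra.
have ub k' : (k' < 2 ^ L)%N -> count k' <= upper_cst * n%:R / 2 ^+ L.
  move=> kL'; have := hc k' kL'; rewrite ler_norml => /andP[_ h].
  have /andP[_ gu] := g0_lo kL'.
  have := ler_wpM2l (ltW nw0) gu; have := ler_wpM2l (ltW nw0) mM0.
  have -> : upper_cst * n%:R / 2 ^+ L = n%:R * w * (2 * M0).
    by rewrite nwE /upper_cst; ring.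
  have : 0 <= n%:R * w * M0 by rewrite mulr_ge0 ?ltW.
  lra.
have lower_gt0 : 0 < lower_cst by rewrite divr_gt0 ?mulr_gt0.
have h := leaf_mass_estimate (fun i => index_of_lt L ab i bb) lower_gt0 q_gt0 n_gt0 qE
  lb ub q_small' hV kL.
set c := 2 ^+ L / (b - a).
have c0 : 0 < c by rewrite divr_gt0.
have -> : c * cell_mass V L k - g0 (lo k) =
  c * (cell_mass V L k - count k / n%:R) +
  (count k - n%:R * w * g0 (lo k)) / (n%:R * w).
  rewrite /c /w /cell_width; field.
  by rewrite !gt_eqF.
apply: le_trans (ler_normD _ _) _.
have -> : `|c * (cell_mass V L k - count k / n%:R)| =
  c * `|cell_mass V L k - count k / n%:R| by rewrite normrM (gtr0_norm c0).
have -> : `|(count k - n%:R * w * g0 (lo k)) / (n%:R * w)| =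
  `|count k - n%:R * w * g0 (lo k)| / (n%:R * w).
  by rewrite normrM normfV (gtr0_norm nw0).
have h1 := ler_wpM2l (ltW c0) h.
have h2 : `|count k - n%:R * w * g0 (lo k)| / (n%:R * w) <= H + count_cst * q / (b - a).
  rewrite ler_pdivrMr//; apply: le_trans (hc k kL) _.
  rewrite le_eqVlt; apply/orP; left; apply/eqP.
  rewrite /r /w /cell_width; field.
  by rewrite !gt_eqF.
have -> : threshold = 5 * split_cst * upper_cst * q / (b - a) +
    (H + count_cst * q / (b - a)).
  by rewrite /threshold /error_cst; field; rewrite gt_eqF.
apply: lerD h2; apply: le_trans h1 _; rewrite le_eqVlt; apply/orP; left; apply/eqP.
by rewrite /c /split_cst; field; rewrite !gt_eqF.
Qed.

Let chi (V : splits) : R :=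
  [exists k : 'I_(2 ^ L), (threshold < `|2 ^+ L / (b - a) * cell_mass V L k - g0 (lo k)|)%R]%:R.

Let measurable_chi : measurable_fun [set: splits] chi.
Proof.
apply: measurable_exists_indic => k; apply: measurable_ltr_indic.
apply: measurableT_comp => //; apply: measurable_funB => //; apply: measurable_funM => //.
by apply: (@measurable_cell_mass _ _ _ _ id) => //; exact: measurable_id.
Qed.

Let chi_ge0 V : 0 <= chi V. Proof. by []. Qed.

Let eta : R := 2 * N%:R * expR (- (2 * L%:R)).

(* The events that a true count is atypical enter through their exponential moments,
   added over all cells. *)
Let hits_sum (beta : obs) : R :=
  \sum_(k < 2 ^ L) (expR (q * (hits (outer k) beta - up_level k)) +
                    expR (- q * (hits (inner k) beta - dn_level k))).

Let hits_sum_ge0 beta : 0 <= hits_sum beta.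
Proof. by apply: sumr_ge0 => k _; rewrite addr_ge0 ?expR_ge0. Qed.

Let measurable_hits_sum d (T : measurableType d) (beta : T -> obs) :
  measurable_fun [set: T] beta -> measurable_fun [set: T] (fun t => hits_sum (beta t)).
Proof.
move=> mb; apply: measurable_sum => k; apply: measurable_funD;
  apply: measurableT_comp => //; apply: measurable_funM => //;
  apply: measurable_funB => //; apply: measurable_hits => //; exact: measurable_itv.
Qed.

Let good beta0 y : in_box a b beta0 -> hits_sum beta0 + lse_excess beta0 y < 1 ->
  forall beta, in_box a b beta ->
  (marginal a b chi beta <= (eta + lse_excess beta y)%:E * mixture beta)%E.
Proof.
move=> bb0 lt1 beta bb.
have E0 b' : 0 <= lse_excess b' y by have /andP[] := lse_excess01 b' y.
have mix0 : (0 <= mixture beta)%E by exact: marginal_ge0.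
have eta0 : 0 <= eta by rewrite !mulr_ge0 ?expR_ge0.
have e0 : lse_excess beta0 y < 1.
  by apply: le_lt_trans lt1; rewrite lerDr.
have hs1 : hits_sum beta0 < 1 by apply: le_lt_trans lt1; rewrite lerDl.
have [e1|e1] := ltP (lse_excess beta y) 1; last first.
  apply: (@le_trans _ _ (1%:E * mixture beta)%E); last first.
    by apply: lee_wpmul2r => //; rewrite lee_fin (le_trans e1)// lerDr.
  rewrite mul1e; apply: ge0_le_integral_nonmeas => V.
    by rewrite lee_fin mulr_ge0// lik_ge0.
  by rewrite lee_fin ler_wpM2l ?lik_ge0// lern1 leq_b1.
have term k : (k < 2 ^ L)%N -> expR (q * (hits (outer k) beta0 - up_level k)) < 1 /\
    expR (- q * (hits (inner k) beta0 - dn_level k)) < 1.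
  move=> kL; suff h : expR (q * (hits (outer k) beta0 - up_level k)) +
      expR (- q * (hits (inner k) beta0 - dn_level k)) < 1.
    by split; apply: le_lt_trans h; rewrite ?lerDl ?lerDr expR_ge0.
  apply: le_lt_trans hs1; rewrite /hits_sum (bigD1 (Ordinal kL))//= lerDl.
  by apply: sumr_ge0 => i _; rewrite addr_ge0 ?expR_ge0.
have hup k : (k < 2 ^ L)%N -> hits (outer k) beta0 <= up_level k.
  move=> /term[h _]; move: h; rewrite -[ltRHS]expR0 ltr_expR pmulr_rlt0// subr_lt0.
  exact: ltW.
have hdn k : (k < 2 ^ L)%N -> dn_level k <= hits (inner k) beta0.
  move=> /term[_ h]; move: h; rewrite -[ltRHS]expR0 ltr_expR mulNr oppr_lt0 pmulr_rgt0//.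
  by rewrite subr_gt0; exact: ltW.
have D0 : 0 < 2 * L%:R :> R by rewrite mulr_gt0// ltr0n.
apply: (@le_trans _ _ (eta%:E * mixture beta)%E); last first.
  by apply: lee_wpmul2r => //; rewrite lee_fin lerDl.
apply: le_trans (marginal_split_off L ab bb D0).
apply: ge0_le_integral_nonmeas => V; first by rewrite lee_fin mulr_ge0// lik_ge0.
rewrite lee_fin ler_wpM2l ?lik_ge0// ler_nat /chi.
have [//|hV] := boolP [exists j, split_off _ _ _ V j]; first by case: (X in (nat_of_bool X <= _)%N).
rewrite leqn0 eqb0; apply/existsPn => k; rewrite -leNgt.
exact: leaf_density_error hup hdn e0 e1 hV (ltn_ord k).
Qed.

(** The true density of the observations is at most [M0 ^ n], and their working
    density at least [(4 (b - a)) ^ - n]. *)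
Let dominated (Ln : (L * 2 ^ L <= n)%N) beta :
  ((iid_density g0 beta)%:E <= ((4 * (b - a) * M0) ^+ n)%:E * mixture beta)%E.
Proof.
have [bb|bb] := boolP (in_box a b beta); last first.
  rewrite (iid_density_out g0_out bb) mule_ge0//; last exact: marginal_ge0.
  by rewrite lee_fin exprn_ge0// !mulr_ge0// ltW.
have A0 : 0 <= (4 * (b - a) * M0) ^+ n by rewrite exprn_ge0// !mulr_ge0// ltW.
have h := lee_wpmul2l (x := ((4 * (b - a) * M0) ^+ n)%:E) _ (marginal_ge ab bb L_gt0 Ln).
apply: le_trans (h _); last by rewrite lee_fin.
rewrite -EFinM lee_fin exprMn mulrAC divff ?mul1r; last first.
  by rewrite expf_neq0// mulf_neq0// gt_eqF.
rewrite /iid_density -[n in leRHS]card_ord -prodr_const.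
by apply: ler_prod => i _; rewrite g0_ge0 g0_le.
Qed.

Let expected_hits_sum :
  (\int[lebesgue_tuple R n]_beta (iid_density g0 beta * hits_sum beta)%:E <=
   (2 * 2 ^+ L * expR (- (2 * L%:R)))%:E)%E.
Proof.
pose f k (beta : obs) : R := iid_density g0 beta * expR (q * (hits (outer k) beta - up_level k)).
pose f' k (beta : obs) : R := iid_density g0 beta * expR (- q * (hits (inner k) beta - dn_level k)).
have f0 k beta : 0 <= f k beta by rewrite mulr_ge0 ?iid_density_ge0 ?expR_ge0.
have f0' k beta : 0 <= f' k beta by rewrite mulr_ge0 ?iid_density_ge0 ?expR_ge0.
have miid : measurable_fun [set: obs] (iid_density g0).
  by apply: (@measurable_iid_density _ _ _ mg0 _ _ id); exact: measurable_id.
have mh t (J : set R) u : measurable J ->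
    measurable_fun [set: obs] (fun beta => iid_density g0 beta * expR (t * (hits J beta - u))).
  move=> mJ; apply: measurable_funM => //; apply: measurableT_comp => //.
  apply: measurable_funM => //; apply: measurable_funB => //.
  by apply: (@measurable_hits _ _ _ _ _ id) => //; exact: measurable_id.
have -> : (\int[lebesgue_tuple R n]_beta (iid_density g0 beta * hits_sum beta)%:E =
    \int[lebesgue_tuple R n]_beta \sum_(k < 2 ^ L) ((f k beta)%:E + (f' k beta)%:E))%E.
  apply: eq_integral => beta _; rewrite /hits_sum mulr_sumr -sumEFin.
  by apply: eq_bigr => k _; rewrite mulrDr EFinD.
rewrite ge0_integral_sum//; last 2 first.
- move=> k; apply: emeasurable_funD; apply/measurable_EFinP; apply: mh; exact: measurable_itv.
- by move=> k beta _; rewrite adde_ge0 ?lee_fin.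
apply: (@le_trans _ _ (\sum_(k < 2 ^ L) (2 * expR (- (2 * L%:R)))%:E)%E); last first.
  rewrite sumEFin sumr_const card_ord lee_fin le_eqVlt; apply/orP; left; apply/eqP.
  by rewrite -[LHS]mulr_natr natrX; ring.
apply: lee_sum => k _; rewrite ge0_integralD//; last 4 first.
- by move=> beta _; rewrite lee_fin.
- by apply/measurable_EFinP; apply: mh; exact: measurable_itv.
- by move=> beta _; rewrite lee_fin.
- by apply/measurable_EFinP; apply: mh; exact: measurable_itv.
have -> : 2 * expR (- (2 * L%:R)) = expR (- (2 * L%:R)) + expR (- (2 * L%:R)) :> R by ring.
by rewrite EFinD; apply: leeD; [exact: hits_up_mgf|exact: hits_dn_mgf].
Qed.

Let expected_bad_event :
  (\int[lebesgue_tuple R n]_beta \int[lebesgue_tuple R m]_y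
    (iid_density g0 beta * noise beta y * (hits_sum beta + lse_excess beta y))%:E
  <= (2 * 2 ^+ L * expR (- (2 * L%:R)) + lse_tail)%:E)%E.
Proof.
have E0 beta y : 0 <= lse_excess beta y by have /andP[] := lse_excess01 beta y.
have iid0 beta : 0 <= iid_density g0 beta by exact: iid_density_ge0.
have tail0 : 0 <= lse_tail by rewrite mulr_ge0 ?exprn_ge0 ?expR_ge0.
have miid : measurable_fun [set: obs] (iid_density g0).
  by apply: (@measurable_iid_density _ _ _ mg0 _ _ id); exact: measurable_id.
have mhs : measurable_fun [set: obs] hits_sum.
  by apply: (@measurable_hits_sum _ _ id); exact: measurable_id.
apply: (@le_trans _ _ (\int[lebesgue_tuple R n]_beta
   ((iid_density g0 beta * hits_sum beta)%:E + (lse_tail * iid_density g0 beta)%:E))%E).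
  apply: ge0_le_integral_nonmeas => beta.
    apply: integral_ge0 => y _; rewrite lee_fin mulr_ge0 ?addr_ge0//.
    by rewrite mulr_ge0 ?noise_density_ge0.
  have mEy : measurable_fun [set: data] (lse_excess beta).
    exact: (measurableT_comp measurable_lse_excess (pair1_measurable beta)).
  have -> : (\int[lebesgue_tuple R m]_y
      (iid_density g0 beta * noise beta y * (hits_sum beta + lse_excess beta y))%:E =
    \int[lebesgue_tuple R m]_y ((iid_density g0 beta * hits_sum beta * noise beta y)%:E +
       (iid_density g0 beta * (noise beta y * lse_excess beta y))%:E))%E.
    by apply: eq_integral => y _; rewrite -EFinD; congr EFin; ring.
  rewrite ge0_integralD//; last 4 first.
  - by move=> y _; rewrite lee_fin mulr_ge0 ?mulr_ge0 ?noise_density_ge0.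
  - by apply/measurable_EFinP; exact: measurable_funM.
  - by move=> y _; rewrite lee_fin mulr_ge0 ?mulr_ge0 ?noise_density_ge0.
  - by apply/measurable_EFinP; apply: measurable_funM => //; exact: measurable_funM.
  rewrite !ge0_integral_scale ?mulr_ge0//; last 3 first.
  - exact: measurable_funM.
  - by move=> y; rewrite mulr_ge0 ?noise_density_ge0.
  - by move=> y; exact: noise_density_ge0.
  rewrite integral_noise_density mule1; apply: leeD => //.
  rewrite mulrC EFinM; apply: lee_wpmul2l; first by rewrite lee_fin.
  exact: integral_lse_excess.
rewrite ge0_integralD//; last 4 first.
- by move=> beta _; rewrite lee_fin mulr_ge0.
- by apply/measurable_EFinP; exact: measurable_funM.
- by move=> beta _; rewrite lee_fin mulr_ge0.
- by apply/measurable_EFinP; exact: measurable_funM.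
rewrite EFinD; apply: leeD; first exact: expected_hits_sum.
by rewrite ge0_integral_scale// integral_iid_density// mule1.
Qed.

Lemma expected_posterior_bound (B : set (R -> R)) : (L * 2 ^ L <= n)%N ->
  (forall V : splits, B (polya_density a b V) -> exists2 k, (k < 2 ^ L)%N &
     threshold < `|2 ^+ L / (b - a) * cell_mass V L k - g0 (cell_left a b L k)|) ->
  (true_expectation X s g0 (fun _ y => (posterior X s a b L B y)%:E) <=
   (4 * 2 ^+ L * expR (- (2 * L%:R)) + lse_tail +
    (4 * (b - a) * M0) ^+ n * lse_tail)%:E)%E.
Proof.
move=> Ln BT.
have A0 : 0 <= (4 * (b - a) * M0) ^+ n by rewrite exprn_ge0// !mulr_ge0// ltW.
have tail0 : 0 <= lse_tail by rewrite mulr_ge0 ?exprn_ge0 ?expR_ge0.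
have mPsi : measurable_fun [set: obs * data]
    (fun z => hits_sum z.1 + lse_excess z.1 z.2).
  apply: measurable_funD; last exact: measurable_lse_excess.
  by apply: measurable_hits_sum; exact: measurable_fst.
have Psi0 beta y : 0 <= hits_sum beta + lse_excess beta y.
  by rewrite addr_ge0//; have /andP[] := lse_excess01 beta y.
have eta0 : 0 <= eta by rewrite !mulr_ge0 ?expR_ge0.
have Bchi V : B (polya_density a b V) -> 1 <= chi V.
  move=> /BT[k kL h]; rewrite /chi (_ : [exists _, _] = true)//.
  by apply/existsP; exists (Ordinal kL).
apply: le_trans (@expected_posterior_le R a b L m n X s ab s_gt0 g0 mg0 g0_ge0 g0_out
  g0_int lse_excess ((4 * (b - a) * M0) ^+ n) lse_tail eta
  (2 * 2 ^+ L * expR (- (2 * L%:R)) + lse_tail)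
  (fun beta y => hits_sum beta + lse_excess beta y) chi B
  measurable_lse_excess lse_excess01 tail0 integral_lse_excess A0 (dominated Ln)
  eta0 Psi0 mPsi expected_bad_event measurable_chi chi_ge0 Bchi good) _.
rewrite lee_fin lerD2r addrAC lerD2r.
have NL : N%:R <= 2 ^+ L :> R by rewrite -natrX ler_nat leq_subr.
rewrite /eta; have := ler_wpM2r (expR_ge0 (- (2 * L%:R : R))) NL; lra.
Qed.

End finite_sample.

(** * The cutoff levels *)

Lemma exp2_div_mono (k l : nat) : (0 < k)%N -> (k <= l)%N -> (2 ^ k * l <= 2 ^ l * k)%N.
Proof.
move=> k0 kl; rewrite -(subnKC kl); elim: (l - k)%N => [|d IH]; first by rewrite addn0.
apply: (@leq_trans (2 * (2 ^ k * (k + d)))).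
  by rewrite mulnCA leq_pmul2l ?expn_gt0//; lia.
by rewrite addnS expnS -mulnA leq_pmul2l.
Qed.

Section levels.
Context (R : realType).

Lemma level_cast_le (alpha c : R) (n L : nat) : 0 < alpha -> 0 < c ->
  expR 1 <= n%:R :> R -> (0 < L)%N -> (L <= level_cast alpha c n)%N ->
  (2 ^+ L) `^ (2 * alpha + 1) <= c `^ (2 * alpha + 1) * n%:R.
Proof.
move=> a0 c0 en L0; rewrite /level_cast; set t := c * _ => Lx.
have p0 : 0 < 2 * alpha + 1 by lra.
have n0 : 0 < n%:R :> R by apply: lt_le_trans en; exact: expR_gt0.
have ln1 : 1 <= ln n%:R :> R by rewrite -ler_expR lnK// posrE.
have ln0 : 0 < ln n%:R :> R by lra.
have xL : L%:R <= log2 t.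
  move: Lx L0; case: L => // L; rewrite truncn_gt_nat => h _; exact: h.
have ln2 : 0 < ln (2 : R) by rewrite ln_gt0// ltr1n.
have t0 : 0 < t by rewrite mulr_gt0// powR_gt0// divr_gt0.
have h : 2 ^+ L <= t.
  move: xL; rewrite /log2 ler_pdivlMr// -ler_expR lnK ?posrE//.
  by rewrite mulr_natl -lnXn// lnK// posrE exprn_gt0.
apply: (@le_trans _ _ (t `^ (2 * alpha + 1))).
  by apply: ge0_ler_powR; rewrite ?nnegrE ?exprn_ge0// ltW.
rewrite /t powRM ?powR_ge0//; last exact: ltW.
rewrite ler_wpM2l ?powR_ge0// -powRrM mulVf ?gt_eqF// powRr1; last first.
  by rewrite ltW// divr_gt0.
by rewrite ler_pdivrMr// ler_peMr// ltW.
Qed.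

(** With [y = 2 ^ alpha] the cutoff gives [(y ^ L) ^ 2 * 2 ^ L <= C n]. One factor
    [y ^ L] absorbs [L], since [L (y - 1) <= y ^ L] by Bernoulli's inequality, and
    the other one is the decay that is left. *)
Lemma cell_ratio_le (alpha c : R) (n L : nat) : 0 < alpha -> 0 < c ->
  expR 1 <= n%:R :> R -> (0 < L)%N -> (L <= level_cast alpha c n)%N ->
  L%:R * 2 ^+ L / n%:R <=
  c `^ (2 * alpha + 1) / ((2 : R) `^ alpha - 1) * ((2 : R) `^ (- alpha)) ^+ L.
Proof.
move=> a0 c0 en L0 Lc; have h := level_cast_le a0 c0 en L0 Lc.
have n0 : 0 < n%:R :> R by apply: lt_le_trans en; exact: expR_gt0.
set y := (2 : R) `^ alpha.
have y1 : 1 < y.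
  by rewrite /y /powR gt_eqF// pexpR_gt1// mulr_gt0// ln_gt0// ltr1n.
have y0 : 0 < y by lra.
have p0 : 0 < 2 ^+ L :> R by rewrite exprn_gt0.
have yL : (2 ^+ L) `^ alpha = y ^+ L.
  by rewrite -powR_mulrn// -powRrM mulrC powRrM powR_mulrn// ltW.
have hE : (2 ^+ L) `^ (2 * alpha + 1) = (y ^+ L) ^+ 2 * 2 ^+ L.
  rewrite powRD; last by apply/implyP => _; rewrite gt_eqF.
  rewrite powRr1 ?(ltW p0)//; congr (_ * _).
  by rewrite mulrC powRrM yL powR_mulrn// exprn_ge0// ltW.
rewrite hE in h.
have bern k : 1 + k%:R * (y - 1) <= y ^+ k.
  elim: k => [|k IH]; first by rewrite mul0r addr0.
  rewrite exprS; apply: le_trans (ler_wpM2l (ltW y0) IH).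
  have : 0 <= k%:R * (y - 1) * (y - 1) by rewrite !mulr_ge0//; lra.
  by rewrite -natr1; lra.
have Ly : L%:R * (y - 1) <= y ^+ L by have := bern L; lra.
have yL0 : 0 < y ^+ L by rewrite exprn_gt0.
have y10 : 0 < y - 1 by lra.
rewrite powRN -/y exprVn ler_pdivrMr//; set C := c `^ _ in h *.
have -> : C / (y - 1) / y ^+ L * n%:R = C * n%:R / ((y - 1) * y ^+ L).
  by field; rewrite !gt_eqF.
rewrite ler_pdivlMr ?mulr_gt0//; apply: le_trans h.
by have := ler_wpM2r (ltW (mulr_gt0 yL0 p0)) Ly; lra.
Qed.

(** With [q ^ 2 = L 2 ^ L / n] one has
    [2 ^ (3 L / 2) / L ^ (3 / 2) = n ^ (- 3 / 2) (q / 2 ^ L) ^ (- 3)], so the bound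
    defining the cutoff reads [s ^ 2 / lambda_min <= c (q / 2 ^ L) ^ 3]. That the
    bound also holds below the maximal level is the monotonicity of [2 ^ l / l]. *)
Lemma level_noise_le (c : R) m n (X : 'M[R]_(m, n)) (s : R) (L : nat) (q : R) :
  0 < c -> 0 < s -> (0 < n)%N -> (0 < L)%N -> (L <= level_noise c X s)%N ->
  0 < q -> q ^+ 2 * n%:R = L%:R * 2 ^+ L ->
  0 < lambda_min (X^T *m X) /\
  s ^+ 2 / lambda_min (X^T *m X) <= c * (q ^+ 3 / 8 ^+ L).
Proof.
move=> c0 s0 n0 L0; rewrite /level_noise.
case: xgetP => [l _ [[l0 Sl] _] Ll|_]; last by rewrite leqNgt L0.
move=> q0 qE; set lam := lambda_min _ in Sl *.
have n0R : 0 < n%:R :> R by rewrite ltr0n.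
have l0R : 0 < l%:R :> R by rewrite ltr0n.
have L0R : 0 < L%:R :> R by rewrite ltr0n.
set p : R := 3 / 2.
have p0 : 0 <= p by rewrite /p; lra.
have pow2 k : 2 `^ (3 * k%:R / 2) = (2 ^+ k) `^ p :> R.
  by rewrite mulrAC mulrC powRrM powR_mulrn.
rewrite pow2 -/p in Sl.
have np0 : 0 < n%:R `^ p :> R by rewrite powR_gt0.
have lp0 : 0 < l%:R `^ p :> R by rewrite powR_gt0.
have Lp0 : 0 < L%:R `^ p :> R by rewrite powR_gt0.
have s20 : 0 < s ^+ 2 by rewrite exprn_gt0.
have lam0 : 0 < lam.
  have : 0 < c * (lam / (s ^+ 2 * n%:R `^ p)).
    by apply: lt_le_trans Sl; rewrite divr_gt0// powR_gt0// exprn_gt0.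
  by rewrite pmulr_rgt0// pmulr_lgt0// invr_gt0 mulr_gt0.
split => //.
have mono := exp2_div_mono L0 Ll.
have h1 : (2 ^+ L) `^ p * l%:R `^ p <= (2 ^+ l) `^ p * L%:R `^ p.
  rewrite -!powRM ?exprn_ge0//; apply: ge0_ler_powR => //; rewrite ?nnegrE ?mulr_ge0 ?exprn_ge0//.
  by rewrite -!natrX -!natrM ler_nat.
have h2 : (2 ^+ L) `^ p / L%:R `^ p <= c * (lam / (s ^+ 2 * n%:R `^ p)).
  apply: le_trans Sl; rewrite ler_pdivrMr// mulrAC ler_pdivlMr//.
have uE : (q / 2 ^+ L) ^+ 3 = ((q / 2 ^+ L) ^+ 2) `^ p.
  rewrite -powR_mulrn ?divr_ge0 ?exprn_ge0 ?ltW// -[in RHS]powR_mulrn ?divr_ge0 ?exprn_ge0 ?ltW//.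
  by rewrite -powRrM; congr (_ `^ _); rewrite /p; field.
have -> : q ^+ 3 / 8 ^+ L = (q / 2 ^+ L) ^+ 3.
  rewrite expr_div_n; congr (_ / _); rewrite -exprM mulnC exprM; congr (_ ^+ _); ring.
have e : (q / 2 ^+ L) ^+ 3 * ((2 ^+ L) `^ p * n%:R `^ p) = L%:R `^ p.
  rewrite uE -(powRM (x := 2 ^+ L)) ?exprn_ge0//.
  rewrite -powRM; [|exact: sqr_ge0|by rewrite mulr_ge0 ?exprn_ge0].
  congr (_ `^ _).
  rewrite expr_div_n; have -> : q ^+ 2 / (2 ^+ L) ^+ 2 * (2 ^+ L * n%:R) = q ^+ 2 * n%:R / 2 ^+ L.
    by field; rewrite gt_eqF// exprn_gt0.
  by rewrite qE mulfK// gt_eqF// exprn_gt0.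
have u0 : 0 < (q / 2 ^+ L) ^+ 3 by rewrite exprn_gt0// divr_gt0// exprn_gt0.
have P0 : 0 < (2 ^+ L) `^ p :> R by rewrite powR_gt0// exprn_gt0.
rewrite ler_pdivrMr//.
move: h2; rewrite ler_pdivrMr// -e.
have -> : c * (lam / (s ^+ 2 * n%:R `^ p)) * ((q / 2 ^+ L) ^+ 3 * ((2 ^+ L) `^ p * n%:R `^ p)) =
  (2 ^+ L) `^ p * (c * (q / 2 ^+ L) ^+ 3 * lam) / s ^+ 2.
  by field; rewrite !gt_eqF// exprn_gt0.
by rewrite ler_pdivlMr// ler_pM2l.
Qed.

End levels.

(** * Hölder densities *)

Section hoelder_density.
Context (R : realType) (a b alpha L0 : R) (g0 : R -> R).
Hypothesis ab : a < b.
Hypothesis alpha_gt0 : 0 < alpha.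
Hypothesis g0_out : forall x, x \notin `[a, b] -> g0 x = 0.
Hypothesis g0_hoelder :
  {in `[a, b] &, forall x y, `|g0 x - g0 y| <= L0 * `|x - y| `^ alpha}.

Lemma hoelder_cst_ge0 : 0 <= L0.
Proof.
have h := g0_hoelder (_ : a \in `[a, b]) (_ : b \in `[a, b]).
have : 0 <= L0 * `|a - b| `^ alpha.
  by apply: le_trans (normr_ge0 _) (h _ _); rewrite in_itv/= lexx ltW.
by rewrite pmulr_lge0// powR_gt0// normr_gt0 subr_eq0 lt_eqF.
Qed.

(* The density is discontinuous at the ends of the interval; composing with the
   projection onto the interval makes it continuous. *)
Let clamp (x : R) : R := Num.max a (Num.min b x).

Let clamp_in x : clamp x \in `[a, b].
Proof. by rewrite in_itv/= /clamp le_max lexx/= ge_max ltW//= ge_min lexx. Qed.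

Let clamp_id x : x \in `[a, b] -> clamp x = x.
Proof.
by rewrite in_itv/= => /andP[ax xb]; rewrite /clamp min_r// max_r.
Qed.

Let clamp_lip x y : `|clamp x - clamp y| <= `|x - y|.
Proof.
have mono u v : u <= v -> 0 <= clamp v - clamp u <= v - u.
  move=> uv; have hab := ab; rewrite /clamp.
  case: (leP b u) => bu; case: (leP b v) => bv; case: (leP a b) => h1;
    case: (leP a u) => h2; case: (leP a v) => h3; apply/andP; split; lra.
have [xy|/ltW yx] := leP x y.
  have /andP[h1 h2] := mono _ _ xy.
  by rewrite distrC (ger0_norm h1) distrC ger0_norm ?subr_ge0.
have /andP[h1 h2] := mono _ _ yx.
by rewrite (ger0_norm h1) ger0_norm ?subr_ge0.
Qed.

Let continuous_clamped : continuous (g0 \o clamp).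
Proof.
move=> x; apply/cvgrPdist_lt => e e0.
have L1 : 0 < L0 + 1 by have := hoelder_cst_ge0; lra.
pose d := (e / (L0 + 1)) `^ alpha^-1.
have d0 : 0 < d by rewrite powR_gt0// divr_gt0.
near=> y.
have xy : `|x - y| < d by near: y; apply: (@cvgr_dist_lt _ R^o) => //; exact: cvg_id.
apply: le_lt_trans (g0_hoelder (clamp_in x) (clamp_in y)) _.
have h1 : `|clamp x - clamp y| `^ alpha < e / (L0 + 1).
  have -> : e / (L0 + 1) = d `^ alpha.
    by rewrite /d -powRrM mulVf ?gt_eqF// powRr1// divr_ge0// ltW.
  apply: gt0_ltr_powR; rewrite ?nnegrE//; first exact: ltW.
  exact: le_lt_trans (clamp_lip x y) xy.
have h2 := powR_ge0 `|clamp x - clamp y| alpha.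
have : (L0 + 1) * `|clamp x - clamp y| `^ alpha < e.
  by rewrite mulrC -ltr_pdivlMr.
by have := hoelder_cst_ge0; nra.
Unshelve. all: by end_near. Qed.

Lemma measurable_hoelder_density : measurable_fun [set: R] g0.
Proof.
rewrite (_ : g0 = fun x => (g0 \o clamp) x * \1_(`[a, b]%classic : set R) x).
  apply: measurable_funM; first exact: continuous_measurable_fun.
  by apply: measurable_indic; exact: measurable_itv.
apply/funext => x; rewrite indicE mem_setE /=.
have [xab|xab] := boolP (x \in `[a, b]); first by rewrite clamp_id// mulr1.
by rewrite g0_out// mulr0.
Qed.

Lemma hoelder_oscillation (w : R) : {in `[a, b] &, forall x y, `|x - y| <= w ->
  `|g0 x - g0 y| <= L0 * w `^ alpha}.
Proof.
move=> x y xab yab xyw; apply: le_trans (g0_hoelder xab yab) _.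
rewrite ler_wpM2l ?hoelder_cst_ge0//; apply: ge0_ler_powR => //.
- exact: ltW.
- by rewrite nnegrE (le_trans _ xyw).
Qed.

End hoelder_density.

(** The density drawn from the prior is constant on each cell, so a large error at a
    point forces a large error at the left end of its cell. *)
Lemma sup_norm_gt_cell (R : realType) (a b H c : R) (L : nat) (g0 : R -> R)
    (V : (2 ^ L - 1).-tuple R) : a < b ->
  {in `[a, b] &, forall x y, `|x - y| <= cell_width a b L -> `|g0 x - g0 y| <= H} ->
  (c%:E < sup_norm a b (fun x => polya_density a b V x - g0 x)%R)%E ->
  exists2 k, (k < 2 ^ L)%N &
    c - H < `|2 ^+ L / (b - a) * cell_mass V L k - g0 (cell_left a b L k)|.
Proof.
move=> ab osc /ereal_sup_gt[_ [x xab <-]]; rewrite lte_fin => h.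
have xab' : x \in `[a, b] by exact: xab.
have [kL xk] := cell_indexP ab L xab'.
exists (cell_index a b L x) => //; rewrite -polya_density_in//.
have /andP[h1 h2] := mem_dyadic_cell xk.
set k := cell_index a b L x in kL xk h1 h2 *.
have hH : `|g0 (cell_left a b L k) - g0 x| <= H.
  apply: osc => //; first exact: cell_left_in.
  by rewrite distrC ger0_norm ?subr_ge0// lerBlDl.
rewrite ltrBlDr; apply: lt_le_trans h _.
have -> : polya_density a b V x - g0 x =
  (polya_density a b V x - g0 (cell_left a b L k)) + (g0 (cell_left a b L k) - g0 x) by ring.
by apply: le_trans (ler_normD _ _) _; rewrite lerD2l.
Qed.

(** * Asymptotics *)

Lemma true_expectation_ge0 (R : realType) m n (X : 'M[R]_(m, n)) (s : R) (g0 : R -> R)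
    (f : n.-tuple R -> m.-tuple R -> \bar R) :
  (forall x, 0 <= g0 x) -> (forall beta y, 0 <= f beta y)%E ->
  (0 <= true_expectation X s g0 f)%E.
Proof.
move=> g00 f0; apply: integral_ge0 => z _; rewrite mule_ge0// lee_fin.
by rewrite joint_densityE mulr_ge0 ?noise_density_ge0// prodr_ge0.
Qed.

(** With this constant the chi-square tail of the least squares error beats the
    factor [A ^+ n] paid for the change of measure. *)
Definition tail_cst (R : realType) (A : R) : R := 8 / 3 * ln (4 * (A + 1)).

Lemma tail_cst_ge0 (R : realType) (A : R) : 0 <= A -> 0 <= tail_cst A.
Proof. by move=> A0; rewrite mulr_ge0// ln_ge0//; lra. Qed.

Lemma total_tail_le (R : realType) (A : R) (n L : nat) : 0 <= A ->
  4 * 2 ^+ L * expR (- (2 * L%:R)) + lse_tail n (tail_cst A) +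
  A ^+ n * lse_tail n (tail_cst A) <= 4 * 2^-1 ^+ L + 2 * 2^-1 ^+ n.
Proof.
move=> A0; set K := tail_cst A.
have A4 : 0 < 4 * (A + 1) by lra.
have tailE : lse_tail n K = ((2 * (A + 1))^-1) ^+ n.
  rewrite /lse_tail (_ : - (3 / 8 * (K * n%:R)) = n%:R * - ln (4 * (A + 1))); last first.
    by rewrite /K /tail_cst; field.
  rewrite expRM_natl expRN lnK ?posrE// -exprMn; congr (_ ^+ _).
  by field; rewrite gt_eqF//; lra.
have h0 : 0 < 2 * (A + 1) by lra.
have h1 : lse_tail n K <= 2^-1 ^+ n.
  rewrite tailE lerXn2r ?nnegrE ?invr_ge0 ?(ltW h0)//.
  by rewrite lef_pV2 ?posrE//; lra.
have h2 : A ^+ n * lse_tail n K <= 2^-1 ^+ n.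
  rewrite tailE -exprMn lerXn2r ?nnegrE ?mulr_ge0 ?invr_ge0 ?(ltW h0)//.
  by rewrite ler_pdivrMr//; lra.
have h3 : 2 ^+ L * expR (- (2 * L%:R)) <= 2^-1 ^+ L :> R.
  rewrite (_ : - (2 * L%:R) = L%:R * - 2 :> R); last by ring.
  rewrite expRM_natl -exprMn lerXn2r ?nnegrE ?mulr_ge0 ?expR_ge0//.
  have e1 : 2 <= expR 1 :> R by have := @expR_ge1Dx R 1; lra.
  have e2 : 4 <= expR 2 :> R.
    rewrite (_ : 2 = 1 + 1 :> R)// expRD.
    by have := ler_pM (ltW (ltr0n R 2)) (ltW (ltr0n R 2)) e1 e1; lra.
  by rewrite expRN ler_pdivrMr ?expR_gt0//; lra.
lra.
Qed.

Lemma dyadic_powR (R : realType) (alpha : R) (L : nat) :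
  2 `^ (- alpha * L%:R) = (2 `^ (- alpha)) ^+ L :> R.
Proof. by rewrite powRrM powR_mulrn// powR_ge0. Qed.

Lemma cell_width_powR (R : realType) (a b alpha : R) (L : nat) : a < b ->
  cell_width a b L `^ alpha = (b - a) `^ alpha * (2 `^ (- alpha)) ^+ L.
Proof.
move=> ab; have ba : 0 <= b - a by rewrite subr_ge0 ltW.
rewrite /cell_width powRM// ?invr_ge0 ?exprn_ge0//; congr (_ * _).
rewrite -dyadic_powR -[2 ^+ L]powR_mulrn// -powRN -powRrM; congr (_ `^ _); ring.
Qed.

(** The oscillation of the density on a cell is at most [L0] times the first term of
    the rate; it enters twice, in the counts and in passing from a point to the left
    end of its cell. *)
Lemma posterior_tail_bound (R : realType) (a b alpha L0 m0 M0 : R) (g0 : R -> R)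
    (m n L : nat) (X : 'M[R]_(m, n)) (s c q : R) :
  a < b -> 0 < alpha -> 0 < m0 ->
  (forall x, x \notin `[a, b] -> g0 x = 0) ->
  (\int[lebesgue_measure]_x (g0 x)%:E = 1)%E ->
  {in `[a, b], forall x, m0 <= g0 x <= M0} ->
  {in `[a, b] &, forall x y, `|g0 x - g0 y| <= L0 * `|x - y| `^ alpha} ->
  0 < s -> 0 < c -> (0 < n)%N -> (0 < L)%N -> (L <= level_noise c X s)%N ->
  q = Num.sqrt (L%:R * 2 ^+ L / n%:R) ->
  let K := tail_cst (4 * (b - a) * M0) in
  q <= 2^-1 ->
  L0 * cell_width a b L `^ alpha <= m0 / 4 ->
  count_cst a b M0 c K * q <= (b - a) * m0 / 4 ->
  5 * split_cst a b m0 M0 * q <= 1 ->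
  forall C : R, 2 * L0 + error_cst a b m0 M0 c K * (b - a) <= C ->
  (true_expectation X s g0 (fun _ y => (posterior X s a b L
     [set g | ((C * rate a b alpha n L)%:E < sup_norm a b (fun x => (g x - g0 x)%R))%E]
     y)%:E) <= (4 * 2^-1 ^+ L + 2 * 2^-1 ^+ n)%:E)%E.
Proof.
move=> ab alpha0 m00 gout gint gbd gh s0 c0 n0 L_0 Ln qdef K qhalf Hs q1 q2 C hC.
have n0R : 0 < n%:R :> R by rewrite ltr0n.
have p0 : 0 < L%:R * 2 ^+ L / n%:R :> R.
  by rewrite divr_gt0// mulr_gt0 ?ltr0n// exprn_gt0.
have q0 : 0 < q by rewrite qdef sqrtr_gt0.
have qE : q ^+ 2 * n%:R = L%:R * 2 ^+ L.
  by rewrite qdef sqr_sqrtr ?(ltW p0)// divfK// gt_eqF.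
have [lam0 noise] := level_noise_le c0 s0 n0 L_0 Ln q0 qE.
have Lle : (L * 2 ^ L <= n)%N.
  rewrite -(ler_nat R) natrM natrX -qE; apply: ler_piMl; first exact: ltW.
  by rewrite expr_le1 ?(ltW q0)//; lra.
have M00 : 0 <= M0.
  have /gbd : a \in `[a, b] by rewrite in_itv/= lexx ltW.
  by move=> /andP[h1 h2]; lra.
have ba0 : 0 < b - a by rewrite subr_gt0.
have A0 : 0 <= 4 * (b - a) * M0 by rewrite !mulr_ge0// ltW.
have K0 : 0 <= K := tail_cst_ge0 A0.
have osc := hoelder_oscillation ab alpha0 gh (w := cell_width a b L).
have mg0 := measurable_hoelder_density ab alpha0 gout gh.
apply: le_trans (expected_posterior_bound ab s0 lam0 L_0 n0 m00 mg0 gout gint gbd osc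
  q0 qhalf qE K0 noise Hs q1 q2 Lle _) _; last first.
  by rewrite lee_fin; exact: total_tail_le.
move=> V /= /(sup_norm_gt_cell ab osc)[k kL hk]; exists k => //.
apply: le_lt_trans hk.
rewrite /threshold cell_width_powR// /rate dyadic_powR -qdef.
set W := (b - a) `^ alpha * _; have W0 : 0 <= W.
  by rewrite mulr_ge0 ?powR_ge0// exprn_ge0// powR_ge0.
set ec := error_cst _ _ _ _ _ _ in hC *.
have L00 := hoelder_cst_ge0 ab gh.
have ec0 : 0 <= ec.
  have u0 : 0 <= upper_cst a b M0 by rewrite /upper_cst !mulr_ge0// ltW.
  have l0 : 0 <= lower_cst a b m0 by rewrite /lower_cst !mulr_ge0// ltW.
  have sp0 : 0 <= split_cst a b m0 M0.
    by rewrite /split_cst mulr_ge0 ?sqrtr_ge0// divr_ge0// mulr_ge0.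
  have ct0 : 0 <= count_cst a b M0 c K.
    have h := mulr_ge0 K0 (ltW c0).
    by rewrite /count_cst /chernoff_cst; lra.
  have h := mulr_ge0 (mulr_ge0 (ler0n R 5) sp0) u0.
  by apply: divr_ge0; [exact: addr_ge0|exact: ltW].
have e0 : 0 <= ec * (b - a) by rewrite mulr_ge0// ltW.
have h1 : 2 * L0 * W <= C * W by rewrite ler_wpM2r//; lra.
have h2 : ec * q <= C * ((b - a)^-1 * q).
  rewrite mulrA; apply: ler_wpM2r; first exact: ltW.
  by rewrite ler_pdivlMr//; lra.
rewrite mulrDr; lra.
Qed.

Section limits.
Context (R : realType) (alpha : R).

Lemma powR2N_lt1 : 0 < alpha -> `|2 `^ (- alpha) : R| < 1.
Proof.
move=> a0; rewrite ger0_norm ?powR_ge0// powRN invf_lt1 ?powR_gt0//.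
by rewrite /powR gt_eqF// pexpR_gt1// mulr_gt0// ln_gt0// ltr1n.
Qed.

Lemma cvg_expr_comp (z : R) (L : nat -> nat) : `|z| < 1 -> L @ \oo --> \oo ->
  z ^+ L j @[j --> \oo] --> 0.
Proof. by move=> z1 Loo; exact: (cvg_comp _ _ Loo (cvg_expr z1)). Qed.

Lemma rate_cvg0 (a b : R) (n L : nat -> nat) : 0 < alpha ->
  L @ \oo --> \oo ->
  (exists c : R, \forall j \near \oo,
     (L j)%:R * 2 ^+ L j / (n j)%:R <= c * (2 `^ (- alpha)) ^+ L j) ->
  (Num.sqrt ((L j)%:R * 2 ^+ L j / (n j)%:R : R) @[j --> \oo] --> 0) /\
  (rate a b alpha (n j) (L j) @[j --> \oo] --> 0).
Proof.
move=> a0 Loo [c hc].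
have yL : (2 `^ (- alpha) : R) ^+ L j @[j --> \oo] --> 0.
  exact: cvg_expr_comp (powR2N_lt1 a0) Loo.
have x0 : (L j)%:R * 2 ^+ L j / (n j)%:R @[j --> \oo] --> (0 : R).
  apply: (@squeeze_cvgr _ _ _ _ (fun=> 0) (fun j => c * (2 `^ (- alpha)) ^+ L j)).
  - by apply: filterS hc => j hj; apply/andP; split.
  - exact: cvg_cst.
  - by rewrite -(mulr0 c); apply: cvgMr.
have q0 : Num.sqrt ((L j)%:R * 2 ^+ L j / (n j)%:R : R) @[j --> \oo] --> 0.
  by rewrite -(sqrtr0 R); exact: (cvg_comp _ _ x0 (@sqrt_continuous R 0)).
split => //; rewrite /rate.
under eq_fun do rewrite dyadic_powR.
have -> : 0 = (b - a) `^ alpha * 0 + (b - a)^-1 * 0 by rewrite !mulr0 addr0.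
by apply: cvgD; exact: cvgMr.
Qed.

End limits.

Theorem theorem4p2 (R : realType) (a b alpha L0 m0 M0 : R)
    (hab : a < b) (halpha0 : 0 < alpha) (halpha1 : alpha <= 1)
    (hm0 : 0 < m0) (hmM : m0 <= M0) :
  exists2 c0 : R, 0 < c0 &
  forall cCast cNoise : R, 0 < cCast -> cCast <= c0 -> 0 < cNoise -> cNoise <= c0 ->
  forall g0 : R -> R,
  (forall x, x \notin `[a, b] -> g0 x = 0) ->
  (\int[lebesgue_measure]_x (g0 x)%:E = 1)%E ->
  {in `[a, b], forall x, m0 <= g0 x <= M0} ->
  {in `[a, b] &, forall x y, `|g0 x - g0 y| <= L0 * `|x - y| `^ alpha} ->
  exists2 C0 : R, 0 < C0 &
  forall (m n : nat -> nat) (X : forall j, 'M[R]_(m j, n j)) (sigma : nat -> R),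
  (forall j, (n j <= m j)%N) ->
  m @ \oo --> \oo -> n @ \oo --> \oo ->
  (forall j, \rank (X j) = n j) ->
  (forall j, 0 < sigma j) ->
  let L j := level alpha cCast cNoise (X j) (sigma j) in
  let eps j := rate a b alpha (n j) (L j) in
  L @ \oo --> \oo ->
  (eps j @[j --> \oo] --> 0) /\
  (true_expectation (X j) (sigma j) g0 (fun _ y =>
     (posterior (X j) (sigma j) a b (L j)
       [set g | ((C0 * eps j)%:E < sup_norm a b (fun x => (g x - g0 x)%R))%E] y)%:E)
   @[j --> \oo] --> 0%E).
Proof.
exists 1 => // cC cN cC0 _ cN0 _ g0 gout gint gbd gh.
pose K := tail_cst (4 * (b - a) * M0).
pose ec := error_cst a b m0 M0 cN K.
exists (Num.max 1 (2 * L0 + ec * (b - a))); first by rewrite lt_max ltr01.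
set C0 := Num.max _ _.
have hC : 2 * L0 + ec * (b - a) <= C0 by rewrite le_max lexx orbT.
move=> m n X s _ _ noo _ s0 L eps Loo.
have L1 : \forall j \near \oo, (0 < L j)%N by have /cvgnyPge := Loo; exact.
have n1 : \forall j \near \oo, expR 1 <= (n j)%:R :> R.
  have /cvgnyPge/(_ (Num.truncn (expR 1 : R)).+1) := noo.
  apply: filterS => j nj; apply: (@le_trans _ _ (Num.truncn (expR 1 : R)).+1%:R).
    by rewrite ltW// truncnS_gt.
  by rewrite ler_nat.
have LC j : (L j <= level_cast alpha cC (n j))%N by exact: geq_minl.
have LN j : (L j <= level_noise cN (X j) (s j))%N by exact: geq_minr.
have ratio : exists c : R, \forall j \near \oo,
    (L j)%:R * 2 ^+ L j / (n j)%:R <= c * (2 `^ (- alpha)) ^+ L j.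
  exists (cC `^ (2 * alpha + 1) / ((2 : R) `^ alpha - 1)).
  by apply: filterS2 L1 n1 => j Lj nj; exact: cell_ratio_le (LC j).
have [q0 eps0] := rate_cvg0 a b halpha0 Loo ratio.
split=> //.
have z1 : `|2^-1 : R| < 1 by rewrite ger0_norm ?invr_ge0// invf_lt1// ltr1n.
apply: (@squeeze_cvge _ _ _ _ (fun=> 0%E) _
  (fun j => (4 * 2^-1 ^+ L j + 2 * 2^-1 ^+ n j)%:E)); last 2 first.
- exact: cvg_cst.
- apply: cvg_EFin; first exact: nearW.
  have -> : 0 = 4 * 0 + 2 * 0 :> R by rewrite !mulr0 addr0.
  by apply: cvgD; apply: cvgMr; exact: cvg_expr_comp.
have g00 x : 0 <= g0 x.
  have [/gbd/andP[h _]|/gout ->//] := boolP (x \in `[a, b]).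
  by apply: le_trans h; exact: ltW.
have q_lt c : 0 < c -> \forall j \near \oo,
    Num.sqrt ((L j)%:R * 2 ^+ L j / (n j)%:R : R) < c.
  by move=> c0; exact: (cvgr_lt _ q0).
have q_lt_mul c d : 0 < d -> \forall j \near \oo,
    c * Num.sqrt ((L j)%:R * 2 ^+ L j / (n j)%:R : R) < d.
  move=> d0; have h : c * Num.sqrt ((L j)%:R * 2 ^+ L j / (n j)%:R : R)
      @[j --> \oo] --> 0 by rewrite -(mulr0 c); exact: cvgMr.
  exact: (cvgr_lt _ h).
have ba0 : 0 < b - a by rewrite subr_gt0.
have H_lt : \forall j \near \oo, L0 * cell_width a b (L j) `^ alpha < m0 / 4.
  have h : L0 * cell_width a b (L j) `^ alpha @[j --> \oo] --> 0.
    under eq_fun do rewrite cell_width_powR// mulrA.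
    rewrite -(mulr0 (L0 * (b - a) `^ alpha)); apply: cvgMr.
    by apply: cvg_expr_comp Loo; exact: powR2N_lt1.
  by apply: (cvgr_lt _ h); rewrite divr_gt0.
near=> j; apply/andP; split.
  apply: true_expectation_ge0 => // _ y; rewrite lee_fin; exact: posterior_ge0.
apply: (posterior_tail_bound hab halpha0 hm0 gout gint gbd gh (s0 j) cN0 _ _ (LN j)
  erefl _ _ _ _ hC).
- have : expR 1 <= (n j)%:R :> R by near: j.
  by rewrite -(ltr0n R); apply: lt_le_trans; exact: expR_gt0.
- by near: j.
- by apply: ltW; near: j; apply: q_lt; rewrite invr_gt0.
- by apply: ltW; near: j.
- by apply: ltW; near: j; apply: q_lt_mul; rewrite divr_gt0// mulr_gt0.
- by apply: ltW; near: j; apply: q_lt_mul.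
Unshelve. all: by end_near. Qed.
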